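(* Suppose $\Lambda$ is a discrete, cocompact group of isometries of $\mathbb{R}^2=\mathbb{C}$ containing rotations of order three that leaves invariant a tiling $\mathcal{T}$ of $\mathbb{C}$ into squares and equilateral triangles of side length $1$, with each of the two shapes represented, and such that the minimal translation length $\tau$ among infinite-order elements of $\Lambda$ satisfies $\tau\le 2+\sqrt{3}$. Then $\mathcal{T}$ is, up to isometry of the plane, one of the three tilings $\mathcal{Q}$, $\mathcal{R}$, $\mathcal{S}$.
   Context: Tilings of the plane are edge-to-edge. The three tilings, all by squares and equilateral triangles of side length $1$, are as follows. $\mathcal{Q}$: the rhombitrihexagonal tiling (vertex type $3.4.6.4$, side length $1$) in which each regular hexagon has been subdivided into six equilateral triangles meeting at its center. $\mathcal{R}$: let $L$ be a hexagonal lattice with minimal distance $2+\sqrt3$. Around each point of $L$ place a regular hexagon of side $1$, so that each segment from its center to one of the six nearest points of $L$ crosses an edge of the hexagon perpendicularly at its midpoint. For each pair of nearest points of $L$, join the two facing hexagon edges by a $1\times 2$ rectangle. The complementary regions are equilateral triangles of side $2$. $\mathcal{R}$ is obtained by dividing each hexagon into six equilateral triangles meeting at its center, each rectangle into two unit squares, and each side-$2$ triangle into four unit equilateral triangles. $\mathcal{S}$: let $L$ be a hexagonal lattice with minimal distance $2+\sqrt3$. Around each point of $L$ place a regular hexagon of side $1$, so that each segment from its center to one of the six nearest points of $L$ passes through a vertex of the hexagon. For each pair of nearest points of $L$, the two facing hexagon vertices (at distance $\sqrt3$) are the endpoints of the long diagonal of a rhombus that is a union of two unit equilateral triangles sharing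 an edge (the short diagonal). Each remaining complementary region, centered at the centroid of a triangle formed by three mutually nearest points of $L$, is the union of a unit equilateral triangle, whose vertices are endpoints of short diagonals of three such rhombi, with a unit square on each of its three sides. $\mathcal{S}$ is the resulting tiling, with each hexagon divided into six equilateral triangles meeting at its center. (Every square of $\mathcal{S}$ is adjacent to four triangles.)
   Formalization: The minimal translation length τ is taken over the translations in Λ only, not over glide reflections; counting glide lengths, the claim fails for hexagons joined by 1×3 rectangles with side-3 triangles. *)

(* Defs.v *)
From HB Require Import structures.
From mathcomp Require Import all_boot all_order all_algebra.
From mathcomp Require Export complex.
From mathcomp Require Import boolp classical_sets reals topology normedtype.

Set Implicit Arguments.
Unset Strict Implicit.
Unset Printing Implicit Defensive.

Import Order.TTheory GRing.Theory Num.Theory.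
Import numFieldNormedType.Exports.

Local Open Scope classical_set_scope.
Local Open Scope ring_scope.
Local Open Scope complex_scope.

(* R[i] under a name typed as a [numClosedFieldType], which is what makes the
   topology induced by the modulus available on it.  In this type [0 <= z]
   means that z is a nonnegative real, and [`|z|] is the modulus, as an element
   of the plane itself. *)
Definition plane (R : realType) : numClosedFieldType := R[i].

Section SquareTriangleTilings.
Variable R : realType.
Local Notation C := (plane R).

Definition conv (p : seq C) : set C :=
  [set z | exists w : 'I_(size p) -> C,
     [/\ forall i, 0 <= w i, \sum_i w i = 1 & z = \sum_i w i * p`_i]].

(* Polygons are listed by their vertices in cyclic order. *)
Definition unit_triangle (p : seq C) : Prop :=
  exists a b c : C, p = [:: a; b; c] /\
    [/\ `|b - a| = 1, `|c - b| = 1 & `|a - c| = 1].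

Definition unit_square (p : seq C) : Prop :=
  exists a u : C, `|u| = 1 /\
    p = [:: a; a + u; a + u + 'i%R * u; a + 'i%R * u].

Definition is_unit_triangle (A : set C) : Prop :=
  exists2 p, unit_triangle p & A = conv p.

Definition is_unit_square (A : set C) : Prop :=
  exists2 p, unit_square p & A = conv p.

Definition is_vertex (A : set C) (v : C) : Prop :=
  exists p, [/\ unit_triangle p \/ unit_square p, A = conv p & v \in p].

Definition is_side (A s : set C) : Prop :=
  exists p v, [/\ unit_triangle p \/ unit_square p, A = conv p, v \in p
                & s = conv [:: v; next p v]].

Definition tiling (T : set (set C)) : Prop :=
  [/\ forall A, T A -> is_unit_triangle A \/ is_unit_square A,
      \bigcup_(A in T) A = setT
    & forall A B, T A -> T B -> A <> B -> A° `&` B° = set0].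

Definition edge_to_edge (T : set (set C)) : Prop :=
  forall A B, T A -> T B -> A <> B ->
    [\/ A `&` B = set0,
        exists v, [/\ is_vertex A v, is_vertex B v & A `&` B = [set v]]
      | exists s, [/\ is_side A s, is_side B s & A `&` B = s]].

Definition move (f : C -> C) (T : set (set C)) : set (set C) :=
  [set f @` A | A in T].

Definition is_isometry (f : C -> C) : Prop :=
  forall z w, `|f z - f w| = `|z - w|.

Definition isometry_group (Lam : set (C -> C)) : Prop :=
  [/\ forall f, Lam f -> is_isometry f,
      Lam id,
      forall f g, Lam f -> Lam g -> Lam (f \o g)
    & forall f, Lam f -> exists g, [/\ Lam g, cancel f g & cancel g f]].

(* The identity is isolated in Lam for the topology of uniform convergence on
   compact sets. *)
Definition discrete_group (Lam : set (C -> C)) : Prop :=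
  exists (K : set C) (e : C), [/\ compact K, 0 < e
    & forall f, Lam f -> (forall z, K z -> `|f z - z| < e) -> f =1 id].

Definition cocompact (Lam : set (C -> C)) : Prop :=
  exists K : set C, compact K /\
    forall z, exists f w, [/\ Lam f, K w & f w = z].

Definition rotation (c u : C) : C -> C := fun z => c + u * (z - c).

Definition translation (v : C) : C -> C := fun z => z + v.

Definition has_order (f : C -> C) (n : nat) : Prop :=
  [/\ (0 < n)%N, iter n f =1 id
    & forall m, (0 < m < n)%N -> ~ (iter m f =1 id)].

Definition infinite_order (f : C -> C) : Prop :=
  forall n, (0 < n)%N -> ~ (iter n f =1 id).

Definition has_rotation_of_order (n : nat) (Lam : set (C -> C)) : Prop :=
  exists c u : C, [/\ `|u| = 1, Lam (rotation c u) & has_order (rotation c u) n].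

(* Only translations count: Lam may contain glide reflections, which also have
   infinite order, but it is not their glide distance that is bounded.  (With
   three squares instead of two in each rectangle, and side-3 triangles, the
   construction of [tilingR] gives a tiling with symmetry group p6m and shortest
   translations of length 3 + sqrt 3, but with glide reflections moving the
   points of their axes by only half of that, which is less than 2 + sqrt 3.) *)
Definition translation_lengths (Lam : set (C -> C)) : set R :=
  [set t | exists v : C, [/\ Lam (translation v),
             infinite_order (translation v) & `|v| = (t%:C : C)]].

Definition is_minimum (t : R) (X : set R) : Prop :=
  X t /\ forall s, X s -> t <= s.

Definition sqrt3 : C := sqrtC 3.

(* e k = exp(i k pi / 6), a unit vector *)
Definition e (k : nat) : C := ((sqrt3 + 'i%R) / 2) ^+ k.

Definition hex_lattice (d : C) : set C :=
  [set p | exists m n : int, p = d * (m%:~R + n%:~R * e 2)].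

Definition tri (a b c : C) : set C := conv [:: a; b; c].
Definition quad (a b c d : C) : set C := conv [:: a; b; c; d].

(* The points of [hex_lattice d] nearest to its point p are the p + d * e (2k).
   In [tilingQ] and [tilingR], the hexagon around p has vertices p + e (2k + 1),
   so that it faces p + d * e (2k + 2) by its side from p + e (2k + 1) to
   p + e (2k + 3). *)

(* Hexagons and squares of the rhombitrihexagonal tiling alternate along the
   segments joining nearest lattice points, so these have length 1 + sqrt 3. *)
Definition tilingQ : set (set C) :=
  [set A | exists (p : C) (k : nat), hex_lattice (1 + sqrt3) p /\
     let a := p + e (2 * k + 1) in
     let b := p + e (2 * k + 3) in
     let u := e (2 * k) in
     let v := e (2 * k + 2) in
     [\/ A = tri p a b,
         A = quad a b (b + v) (a + v)
       | A = tri a (a + u) (a + v)]].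

(* The square a, b, b + v, a + v and its translate by v form the rectangle
   between p and p + d * v; a, a + 2u and a + 2v are the vertices of the side-2
   triangle centered at the centroid of p, p + d * u and p + d * v. *)
Definition tilingR : set (set C) :=
  [set A | exists (p : C) (k : nat), hex_lattice (2 + sqrt3) p /\
     let a := p + e (2 * k + 1) in
     let b := p + e (2 * k + 3) in
     let u := e (2 * k) in
     let v := e (2 * k + 2) in
     [\/ A = tri p a b,
         A = quad a b (b + v) (a + v)
         \/ A = quad (a + v) (b + v) (b + 2 * v) (a + 2 * v)
       | [\/ A = tri a (a + u) (a + v),
             A = tri (a + u) (a + 2 * u) (a + u + v),
             A = tri (a + v) (a + u + v) (a + 2 * v)
           | A = tri (a + u) (a + u + v) (a + v)]]].

(* The hexagon around p has vertices p + e (2k).  The rhombus between p and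
   p + d * u has long diagonal from a to a + sqrt3 * u and short diagonal from
   r' to r.  The remaining region centered at the centroid of p, p + d * u and
   p + d * v is the union of the triangle r s t and of a square on each of its
   sides; the square on the side r s has a and b as its other vertices. *)
Definition tilingS : set (set C) :=
  [set A | exists (p : C) (k : nat), hex_lattice (2 + sqrt3) p /\
     let u := e (2 * k) in
     let v := e (2 * k + 2) in
     let a := p + u in
     let b := p + v in
     let r' := a + e (2 * k + 11) in
     let r := a + e (2 * k + 1) in
     let s := b + e (2 * k + 1) in
     let t := p + (1 + sqrt3) * e (2 * k + 1) in
     [\/ A = tri p a b,
         A = tri a r' r \/ A = tri (a + sqrt3 * u) r' r,
         A = tri r s t
       | [\/ A = quad a b s r,
             A = quad s t (t + e (2 * k + 3)) (s + e (2 * k + 3))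
           | A = quad t r (r + e (2 * k + 11)) (t + e (2 * k + 11))]]].

End SquareTriangleTilings.

(* Main.v *)
(* Only the order-3 rotation about c and the shortest translation by v are used.
   Conjugating and composing them, all points of the triangular lattice
   K = c + Z[omega] v / (1 - omega) are centers of order-3 rotations preserving
   the tiling.  As |v| <= 2 + sqrt 3, the lattice K has covering radius less than
   5/4, so the tiling is known once it is known at distance 5/4 from the points
   of K.  A center of an order-3 rotation is the center of a triangle or a point
   where six triangles meet.  Adding orbits of tiles along free sides as long as
   tiles do not overlap, one finds that the tiling around such a center is one of
   eight patches.  The patches around two neighbours in K share a tile containing
   the midpoint of these neighbours, which leaves finitely many relative
   positions.  Some neighbour of a patch with a square is the hexagon with six
   squares and six triangles around it; starting from such a hexagon, the positions
   of two neighbours for which no tiles overlap yield the three tilings, by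
   comparing generators modulo the translation lattice.  All vertices met are in
   Z[zeta] for zeta = exp(i pi / 6), which makes these finite checks exact
   computations with integers. *)
From Stdlib Require Import ZArith.
Require Import Defs.
From HB Require Import structures.
From mathcomp Require Import all_boot all_order all_algebra.
From mathcomp Require Import boolp classical_sets reals topology normedtype.
From mathcomp Require Import ring lra zify ssrZ.

Set Implicit Arguments.
Unset Strict Implicit.
Unset Printing Implicit Defensive.

Import Order.TTheory GRing.Theory Num.Theory.
Import numFieldNormedType.Exports.

Local Open Scope classical_set_scope.
Local Open Scope ring_scope.

(** * Unit tiles as intersections of half-planes *)

Section Tiles.
Variable R : realType.
Local Notation C := (plane R).
Local Notation Re := (@complex.Re R).
Local Notation Im := (@complex.Im R).
Implicit Types (x y z p q u d c : C) (b : bool).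

(** The bound on the translation length enters through one inequality: K has covering radius
    [|v| / 3 <= (2 + sqrt 3) / 3 = 1.244...], and [5 / 4] is a round number just above it. A tile
    given as a set carries no distinguished vertex, so it is coded by a base vertex and a direction,
    and the codes of one set are compared through its extreme points. The frame in which the patch
    around a center takes its listed form is a priori an arbitrary rotation; a tile shared with the
    patch of a neighbour forces the relative rotation to be a power of zeta, which makes the
    positions finite in number. Two neighbours at 60 degrees are used because 0, 1 and [zeta ^ 2]
    represent the three classes of Z[omega] modulo [1 - omega]: the patches around the corresponding
    three points of K contain every tile up to translations by [(1 - omega) K]. The overlap tests
    only have to be sound: a conflict comes with an explicit common interior point, so a missed
    overlap could only leave more cases to check. *)

Lemma plane_ext x y : Re x = Re y -> Im x = Im y -> x = y.
Proof. by case: x y => [a b] [a' b'] /= -> ->. Qed.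

Lemma reD x y : Re (x + y) = Re x + Re y. Proof. by case: x y => ? ? []. Qed.
Lemma imD x y : Im (x + y) = Im x + Im y. Proof. by case: x y => ? ? []. Qed.
Lemma reN x : Re (- x) = - Re x. Proof. by case: x. Qed.
Lemma imN x : Im (- x) = - Im x. Proof. by case: x. Qed.
Lemma reM x y : Re (x * y) = Re x * Re y - Im x * Im y.
Proof. by case: x y => ? ? []. Qed.
Lemma imM x y : Im (x * y) = Re x * Im y + Im x * Re y.
Proof. by case: x y => ? ? []. Qed.
Lemma re0 : Re 0 = 0. Proof. by []. Qed.
Lemma im0 : Im 0 = 0. Proof. by []. Qed.
Lemma re1 : Re 1 = 1. Proof. by []. Qed.
Lemma im1 : Im 1 = 0. Proof. by []. Qed.
Definition reimE :=
  (reD, imD, reN, imN, reM, imM, re0, im0, re1, im1).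

Definition s3 : R := Num.sqrt 3.
Lemma s3M : s3 * s3 = 3.
Proof. by rewrite -expr2 sqr_sqrtr. Qed.
Lemma s3_gt0 : 0 < s3. Proof. by rewrite sqrtr_gt0. Qed.
Lemma s3_bounds : 17/10 < s3 < 174/100.
Proof. have h := s3M; have h0 := s3_gt0; nra. Qed.

Definition zeta : C := Complex (s3 / 2) (1 / 2).

Definition nsq z : R := Re z * Re z + Im z * Im z.
Lemma nsqM x y : nsq (x * y) = nsq x * nsq y.
Proof. by rewrite /nsq ?reimE; ring. Qed.
Lemma nsq_ge0 x : 0 <= nsq x. Proof. by rewrite /nsq; nra. Qed.
Lemma nsq_eq0 x : nsq x = 0 -> x = 0.
Proof. by rewrite /nsq => h; apply: plane_ext; rewrite ?reimE; nra. Qed.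

Lemma normE z : `|z| = Complex (Num.sqrt (nsq z)) 0 :> C.
Proof. by case: z. Qed.
Lemma lecE x y : (x <= y) = (Im y == Im x) && (Re x <= Re y).
Proof. by case: x y => ? ? []. Qed.
Lemma ltcE x y : (x < y) = (Im y == Im x) && (Re x < Re y).
Proof. by case: x y => ? ? []. Qed.

Lemma norm_sqrt z (r : R) : 0 <= r -> `|z| = Complex (Num.sqrt r) 0 :> C <-> nsq z = r.
Proof.
move=> r0; rewrite normE; split => [[]|-> //].
by move/(congr1 (fun t => t ^+ 2)); rewrite !sqr_sqrtr // nsq_ge0.
Qed.

Lemma unitP u : `|u| = 1 <-> nsq u = 1.
Proof. by rewrite -norm_sqrt // sqrtr1. Qed.

(** The exterior angle, 90 or 120 degrees, as a unit complex number. *)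
Definition wt b : C := if b then Complex 0 1 else Complex (- (1 / 2)) (s3 / 2).
Arguments wt : simpl never.
Definition nsides b := if b then 4%N else 3%N.
Definition next_side b (s : C * C) := (s.1 + s.2, s.2 * wt b).
Definition side b p u j := iter j (next_side b) (p, u).
(* Positive on the left of the line through [p] directed by [u]. *)
Definition left p u x : R := Re u * (Im x - Im p) - Im u * (Re x - Re p).
(* The triangle or (if [b]) the square on the left of its side from [p] to [p + u]. *)
Definition tile b p u : set C :=
  [set x | forall j, 0 <= left (side b p u j).1 (side b p u j).2 x].
Definition stile b p u : set C :=
  [set x | forall j, 0 < left (side b p u j).1 (side b p u j).2 x].

Lemma wt_sq : wt true * wt true = -1.
Proof. by apply: plane_ext; rewrite ?reimE /=; ring. Qed.
Lemma wt_tri : 1 + wt false + wt false * wt false = 0.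
Proof. by have h3 := s3M; apply: plane_ext; rewrite ?reimE /=; nra. Qed.

Lemma side_period b p u j : side b p u (j + nsides b) = side b p u j.
Proof.
rewrite /side iterD; congr iter.
case: b; rewrite /= /next_side /=; congr pair.
- have := wt_sq; move: (wt true) => w h.
  rewrite -[RHS]addr0 -(mulr0 (u + u * w)) -(subrr (w * w)) {2}h. ring.
- have := wt_sq; move: (wt true) => w h.
  by rewrite -[RHS]addr0 -(mulr0 (u * (w * w - 1))) -(subrr (w * w)) {3}h; ring.
- have := wt_tri; move: (wt false) => w h.
  by rewrite -[RHS]addr0 -(mulr0 u) -h; ring.
- have := wt_tri; move: (wt false) => w h.
  by rewrite -[RHS]addr0 -(mulr0 (u * (w - 1))) -h; ring.
Qed.

Lemma side_mod b p u j : side b p u j = side b p u (j %% nsides b).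
Proof.
rewrite {1}(divn_eq j (nsides b)) addnC.
by elim: (j %/ _)%N => [|k IH]; rewrite ?mul0n ?addn0 // mulSn addnCA addnC side_period.
Qed.

Lemma side_side b p u i j : side b (side b p u i).1 (side b p u i).2 j = side b p u (j + i).
Proof. by rewrite /side iterD -surjective_pairing. Qed.

Lemma nsq_wt b : nsq (wt b) = 1.
Proof. by have := s3M; case: b; rewrite /nsq /wt /=; nra. Qed.

Lemma nsq_side b p u j : nsq (side b p u j).2 = nsq u.
Proof. by elim: j => [//|j IH] /=; rewrite nsqM nsq_wt mulr1. Qed.

(** As [tile] quantifies over all [j : nat], a change of base side only shifts the index, which is
    periodic. *)
Lemma tile_side b p u j : tile b (side b p u j).1 (side b p u j).2 = tile b p u.
Proof.
apply/seteqP; split => x h i; last by rewrite side_side.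
suff [k hk] : exists k, side b p u i = side b p u (k + j).
  by rewrite hk -side_side.
(* [nsides b * j - j] is a natural number congruent to [- j] modulo the number of sides. *)
exists (i + (nsides b * j - j))%N; rewrite -addnA subnK; last by case: b {h} => /=; lia.
by rewrite side_mod [RHS]side_mod addnC mulnC modnMDl.
Qed.

Lemma stile_tile b p u x : stile b p u x -> tile b p u x.
Proof. by move=> h j; apply: ltW. Qed.

Lemma side_frame b c u p d j :
  side b (c + u * p) (u * d) j = (c + u * (side b p d j).1, u * (side b p d j).2).
Proof.
elim: j => [//|j]; rewrite /side !iterS => ->; rewrite /next_side /=.
by congr pair; rewrite ?mulrA // mulrDr addrA.
Qed.

Lemma left_frame c u p d x : left (c + u * p) (u * d) (c + u * x) = nsq u * left p d x.
Proof. by rewrite /left /nsq ?reimE; ring. Qed.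

(** Questions about a tile are moved in this way to the tile based at 0 with direction 1, where they
    are linear in [Re] and [Im]. *)
Lemma tile_frame b c u p d x : nsq u = 1 ->
  tile b (c + u * p) (u * d) (c + u * x) <-> tile b p d x.
Proof.
by move=> hu; split=> h j; have := h j; rewrite side_frame left_frame hu mul1r.
Qed.
Lemma stile_frame b c u p d x : nsq u = 1 ->
  stile b (c + u * p) (u * d) (c + u * x) <-> stile b p d x.
Proof.
by move=> hu; split=> h j; have := h j; rewrite side_frame left_frame hu mul1r.
Qed.

Lemma unit_neq0 u : nsq u = 1 -> u != 0.
Proof. by move=> h; apply/eqP => h0; move: h; rewrite h0 /nsq /=; lra. Qed.

Lemma frameK c u x : nsq u = 1 -> c + u * ((x - c) / u) = x.
Proof. by move=> /unit_neq0 h; rewrite mulrCA divff // mulr1 addrC subrK. Qed.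

Lemma left_std_tri z :
  [/\ left (side false 0 1 0).1 (side false 0 1 0).2 z = Im z,
     left (side false 0 1 1).1 (side false 0 1 1).2 z = (s3 * (1 - Re z) - Im z) / 2
   & left (side false 0 1 2).1 (side false 0 1 2).2 z = (s3 * Re z - Im z) / 2].
Proof.
have h3 := s3M; split; rewrite /left /= ?reimE /wt /=; first by lra.
  by lra.
have -> : 1 * - (1 / 2) - 0 * (s3 / 2) = - (1 / 2) by lra.
have -> : 1 * (s3 / 2) + 0 * - (1 / 2) = s3 / 2 by lra.
have -> : - (1 / 2) * - (1 / 2) - s3 / 2 * (s3 / 2) = - (1 / 2) :> R by nra.
by lra.
Qed.

Lemma left_std_sq z :
  [/\ left (side true 0 1 0).1 (side true 0 1 0).2 z = Im z,
     left (side true 0 1 1).1 (side true 0 1 1).2 z = 1 - Re z,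
     left (side true 0 1 2).1 (side true 0 1 2).2 z = 1 - Im z
   & left (side true 0 1 3).1 (side true 0 1 3).2 z = Re z].
Proof. by split; rewrite /left /= ?reimE /wt /=; lra. Qed.

Lemma std_tri z : tile false 0 1 z <->
  [/\ 0 <= Im z, 0 <= s3 * (1 - Re z) - Im z & 0 <= s3 * Re z - Im z].
Proof.
have [e0 e1 e2] := left_std_tri z; split => [h|[h0 h1 h2] j].
  by split; [have := h 0%N; rewrite e0|have := h 1%N; rewrite e1|have := h 2%N; rewrite e2]; lra.
rewrite side_mod; have: (j %% nsides false < 3)%N by rewrite ltn_mod.
by case: (_ %% _)%N => [|[|[|//]]] _; rewrite ?(e0, e1, e2); lra.
Qed.

Lemma std_stri z : stile false 0 1 z <->
  [/\ 0 < Im z, 0 < s3 * (1 - Re z) - Im z & 0 < s3 * Re z - Im z].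
Proof.
have [e0 e1 e2] := left_std_tri z; split => [h|[h0 h1 h2] j].
  by split; [have := h 0%N; rewrite e0|have := h 1%N; rewrite e1|have := h 2%N; rewrite e2]; lra.
rewrite side_mod; have: (j %% nsides false < 3)%N by rewrite ltn_mod.
by case: (_ %% _)%N => [|[|[|//]]] _; rewrite ?(e0, e1, e2); lra.
Qed.

Lemma std_sq z : tile true 0 1 z <-> [/\ 0 <= Im z, Re z <= 1, Im z <= 1 & 0 <= Re z].
Proof.
have [e0 e1 e2 e3] := left_std_sq z; split => [h|[h0 h1 h2 h3] j].
  by split; [have := h 0%N; rewrite e0|have := h 1%N; rewrite e1|have := h 2%N; rewrite e2
    |have := h 3%N; rewrite e3]; lra.
rewrite side_mod; have: (j %% nsides true < 4)%N by rewrite ltn_mod.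
by case: (_ %% _)%N => [|[|[|[|//]]]] _; rewrite ?(e0, e1, e2, e3); lra.
Qed.

Lemma std_ssq z : stile true 0 1 z <-> [/\ 0 < Im z, Re z < 1, Im z < 1 & 0 < Re z].
Proof.
have [e0 e1 e2 e3] := left_std_sq z; split => [h|[h0 h1 h2 h3] j].
  by split; [have := h 0%N; rewrite e0|have := h 1%N; rewrite e1|have := h 2%N; rewrite e2
    |have := h 3%N; rewrite e3]; lra.
rewrite side_mod; have: (j %% nsides true < 4)%N by rewrite ltn_mod.
by case: (_ %% _)%N => [|[|[|[|//]]]] _; rewrite ?(e0, e1, e2, e3); lra.
Qed.

End Tiles.

(** * Metric and topological estimates for a single tile *)

Section TileGeometry.
Variable R : realType.
Local Notation C := (plane R).
Local Notation Re := (@complex.Re R).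
Local Notation Im := (@complex.Im R).
Local Notation s3 := (s3 R).
Local Notation zeta := (zeta R).
Implicit Types (x y z p q u d c : C) (b : bool).

Lemma nsq_zeta : nsq zeta = 1.
Proof. by have := s3M R; rewrite /nsq /=; nra. Qed.
Lemma zeta2 : zeta ^+ 2 = Complex (1 / 2) (s3 / 2).
Proof. by have h := s3M R; apply: plane_ext; rewrite expr2 ?reimE /=; nra. Qed.
Lemma zeta3 : zeta ^+ 3 = Complex 0 1.
Proof. by have h := s3M R; rewrite exprS zeta2; apply: plane_ext; rewrite ?reimE /=; nra. Qed.
Lemma zeta4 : zeta ^+ 4 = Complex (- (1 / 2)) (s3 / 2).
Proof. by rewrite exprS zeta3; apply: plane_ext; rewrite ?reimE /=; lra. Qed.
Lemma zeta6 : zeta ^+ 6 = -1.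
Proof. by rewrite (exprD _ 3 3) zeta3; apply: plane_ext; rewrite ?reimE /=; lra. Qed.
Lemma zeta12 : zeta ^+ 12 = 1.
Proof. by rewrite (exprD _ 6 6) zeta6 mulrNN mulr1. Qed.
Lemma wtE b : wt R b = zeta ^+ (if b then 3 else 4).
Proof. by case: b; rewrite ?zeta3 ?zeta4. Qed.

Lemma nsq_sub x y : nsq (x - y) = nsq (y - x).
Proof. by rewrite /nsq ?reimE; ring. Qed.

Lemma nsq_frame c u x y : nsq (c + u * x - (c + u * y)) = nsq u * nsq (x - y).
Proof. by rewrite -nsqM; congr nsq; ring. Qed.

Lemma frame_ex p u x : nsq u = 1 -> exists z, x = p + u * z.
Proof. by move=> hu; exists ((x - p) / u); rewrite frameK. Qed.
Lemma tile_std b p u z : nsq u = 1 -> tile b p u (p + u * z) <-> tile b 0 1 z.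
Proof. by move=> hu; rewrite -(tile_frame _ p 0 1 _ hu) mulr0 addr0 mulr1. Qed.
Lemma stile_std b p u z : nsq u = 1 -> stile b p u (p + u * z) <-> stile b 0 1 z.
Proof. by move=> hu; rewrite -(stile_frame _ p 0 1 _ hu) mulr0 addr0 mulr1. Qed.

Definition cen0 b : C := Complex (1 / 2) (if b then 1 / 2 else s3 / 6).
Definition cen b p u : C := p + u * cen0 b.

(** [1 / 12] is the squared inradius of the unit triangle; that of the square is [1 / 4]. *)
Lemma stile_near_cen b p u x : nsq u = 1 -> nsq (x - cen b p u) < 1 / 12 -> stile b p u x.
Proof.
move=> hu; have [z ->] := frame_ex p x hu; rewrite stile_std // nsq_frame hu mul1r.
have h3 := s3M R; have h0 := s3_gt0 R.
have sq_lt (t k : R) : 0 <= k -> t * t < k * k -> t < k by move=> ? ?; nra.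
case: b; rewrite /nsq ?reimE /= => h; [apply/std_ssq|apply/std_stri]; split.
- have := sq_lt (1 / 2 - Im z) (1 / 2); have := sqr_ge0 (Re z - 1 / 2); rewrite expr2; lra.
- have := sq_lt (Re z - 1 / 2) (1 / 2); have := sqr_ge0 (Im z - 1 / 2); rewrite expr2; lra.
- have := sq_lt (Im z - 1 / 2) (1 / 2); have := sqr_ge0 (Re z - 1 / 2); rewrite expr2; lra.
- have := sq_lt (1 / 2 - Re z) (1 / 2); have := sqr_ge0 (Im z - 1 / 2); rewrite expr2; lra.
- have := sq_lt (s3 / 6 - Im z) (s3 / 6); have := sqr_ge0 (Re z - 1 / 2); rewrite expr2; lra.
(* Cauchy-Schwarz for a normal vector of length 2: this square and the one compared with [s3 / 3]
   add up to four times the squared distance to the center. *)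
- have := sqr_ge0 ((Re z - 1 / 2) - s3 * (Im z - s3 / 6)).
  have := sq_lt (s3 * (Re z - 1 / 2) + (Im z - s3 / 6)) (s3 / 3).
  by rewrite expr2; nra.
- have := sqr_ge0 ((Re z - 1 / 2) + s3 * (Im z - s3 / 6)).
  have := sq_lt (Im z - s3 / 6 - s3 * (Re z - 1 / 2)) (s3 / 3).
  by rewrite expr2; nra.
Qed.

Lemma tile_diam b p u x y : nsq u = 1 -> tile b p u x -> tile b p u y -> nsq (x - y) <= 2.
Proof.
move=> hu; have [{}x ->] := frame_ex p x hu; have [{}y ->] := frame_ex p y hu.
rewrite !tile_std // nsq_frame hu mul1r.
have h3 := s3M R; have h0 := s3_bounds R.
case: b => [/std_sq[? ? ? ?] /std_sq[? ? ? ?]|/std_tri[h1 h2 h4] /std_tri[h5 h6 h7]].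
  by rewrite /nsq ?reimE; nra.
have rx : 0 <= Re x <= 1 by apply/andP; split; nra.
have ry : 0 <= Re y <= 1 by apply/andP; split; nra.
have ix : Im x <= 1 by nra.
have iy : Im y <= 1 by nra.
by rewrite /nsq ?reimE; nra.
Qed.

Lemma cen_stile b p u : nsq u = 1 -> stile b p u (cen b p u).
Proof. by move=> hu; apply: stile_near_cen => //; rewrite subrr /nsq /=; lra. Qed.

Lemma left_aff p u x y (s : R) :
  left p u (x + Complex s 0 * (y - x)) = (1 - s) * left p u x + s * left p u y.
Proof. by rewrite /left ?reimE /=; ring. Qed.

Lemma stile_dense b p u x (s : R) : nsq u = 1 -> tile b p u x -> 0 < s <= 1 ->
  stile b p u (x + Complex s 0 * (cen b p u - x)).
Proof.
move=> hu hx hs j; rewrite left_aff.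
by have := hx j; have := cen_stile b p hu j; nra.
Qed.

Lemma tile_convex b p u x y (s : R) : tile b p u x -> tile b p u y -> 0 <= s <= 1 ->
  tile b p u (x + Complex s 0 * (y - x)).
Proof.
by move=> hx hy hs j; rewrite left_aff; have := hx j; have := hy j; nra.
Qed.

(** Distance to a line is 1-Lipschitz; by the identity of Lagrange the defect is a square. *)
Lemma left_lip p u x y : nsq u = 1 -> (left p u y - left p u x) * (left p u y - left p u x) <= nsq (y - x).
Proof.
move=> hu; rewrite -[leRHS]mul1r -hu -subr_ge0.
suff -> : nsq u * nsq (y - x) - (left p u y - left p u x) * (left p u y - left p u x) =
  (Re u * (Re y - Re x) + Im u * (Im y - Im x)) ^+ 2 by exact: sqr_ge0.
by rewrite /left /nsq ?reimE; ring.
Qed.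

Lemma notin_tile b p u x : nsq u = 1 -> ~ tile b p u x ->
  exists2 eps : R, 0 < eps & forall y, nsq (y - x) < eps -> ~ tile b p u y.
Proof.
move=> hu /existsNP[j /negP]; rewrite -ltNge; set l := left _ _ => hl.
exists (l x * l x); first by nra.
move=> y hy /(_ j); rewrite -/(l y) => h.
have := left_lip (side b p u j).1 x y (etrans (nsq_side b p u j) hu).
by rewrite -/l; nra.
Qed.

Lemma in_stile b p u x : nsq u = 1 -> stile b p u x ->
  exists2 eps : R, 0 < eps & forall y, nsq (y - x) < eps -> stile b p u y.
Proof.
move=> hu hx.
have [e1 e1p he1] : exists2 eps : R, 0 < eps & forall y, nsq (y - x) < eps ->
    forall j, (j < nsides b)%N -> 0 < left (side b p u j).1 (side b p u j).2 y.
  elim: (nsides b) => [|n [e ep IH]]; first by exists 1.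
  have := hx n; set l := left _ _ => hl.
  exists (Num.min e (l x * l x)); first by rewrite lt_min ep /=; nra.
  move=> y; rewrite lt_min => /andP[he hy] j; rewrite ltnS leq_eqVlt => /orP[/eqP->|]; last exact: IH.
  have := left_lip (side b p u n).1 x y (etrans (nsq_side b p u n) hu).
  by rewrite -/l; nra.
exists e1 => // y /he1 hy j; rewrite side_mod; apply: hy.
by rewrite ltn_mod; case: (b).
Qed.

Lemma stile_interior b p u x : nsq u = 1 -> stile b p u x -> (tile b p u)° x.
Proof.
move=> hu /(in_stile hu)[e e0 he].
rewrite /interior /=; apply/nbhs_ballP; exists (Complex (Num.sqrt e) 0 : C).
  by rewrite /= ltcE /= eqxx sqrtr_gt0.
move=> y hy; apply: stile_tile; apply: he.
have: `|x - y| < Complex (Num.sqrt e) 0 by exact: hy. rewrite normE ltcE /= eqxx /= nsq_sub ltr_sqrt //.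
Qed.

End TileGeometry.

(** * Convex hulls of three or four points as tiles *)

Section ConvexHulls.
Variable R : realType.
Local Notation C := (plane R).
Local Notation Re := (@complex.Re R).
Local Notation Im := (@complex.Im R).
Local Notation s3 := (s3 R).
Local Notation zeta := (zeta R).
Local Notation re r := (Complex r 0 : C).
Implicit Types (x y z p q u v d c : C) (b : bool) (r s t : R).

Definition seg p u : set C := [set p + re t * u | t in [set t | 0 <= t <= 1]].

Lemma ge0_re x : 0 <= x -> x = re (Re x) /\ 0 <= Re x.
Proof. by case: x => a b; rewrite lecE /= => /andP[/eqP-> ->]. Qed.
Lemma re_ge0 r : (0 <= re r) = (0 <= r).
Proof. by rewrite lecE /= eqxx. Qed.

Lemma conv_seg p u : conv [:: p; p + u] = seg p u.
Proof.
apply/seteqP; split => x.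
  move=> [w [w0 w1 ->]]; move: w1; rewrite !big_ord_recl !big_ord0 /=.
  have [-> h0] := ge0_re (w0 ord0); have [-> h1] := ge0_re (w0 (lift ord0 ord0)).
  move/(congr1 Re); rewrite ?reimE /= => h.
  exists (Re (w (lift ord0 ord0))) => /=; first lra.
  have -> : Re (w ord0) = 1 - Re (w (lift ord0 ord0)) by lra.
  by apply: plane_ext; rewrite ?reimE /=; ring.
move=> [t /= ht <-]; exists (fun i : 'I_2 => if i == ord0 then re (1 - t) else re t).
split.
- by move=> i; case: ifP; rewrite re_ge0; lra.
- by rewrite !big_ord_recl !big_ord0 /=; apply: plane_ext; rewrite ?reimE /=; ring.
- by rewrite !big_ord_recl !big_ord0 /=; apply: plane_ext; rewrite ?reimE /=; ring.
Qed.

Lemma conv_tri p q d : conv [:: p; p + q; p + d] =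
  [set p + re st.1 * q + re st.2 * d | st in [set st : R * R | [/\ 0 <= st.1, 0 <= st.2 & st.1 + st.2 <= 1]]].
Proof.
apply/seteqP; split => x.
  move=> [w [w0 w1 ->]]; move: w1; rewrite !big_ord_recl !big_ord0 /=.
  have [-> h0] := ge0_re (w0 ord0); have [-> h1] := ge0_re (w0 (lift ord0 ord0)).
  have [-> h2] := ge0_re (w0 (lift ord0 (lift ord0 ord0))).
  move/(congr1 Re); rewrite ?reimE /= => h.
  exists (Re (w (lift ord0 ord0)), Re (w (lift ord0 (lift ord0 ord0)))) => /=; first by split; lra.
  set r := Re (w ord0); have -> : r = 1 - Re (w (lift ord0 ord0)) - Re (w (lift ord0 (lift ord0 ord0))).
    by rewrite /r; lra.
  by apply: plane_ext; rewrite ?reimE /=; ring.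
move=> [[s t] /= [hs ht hst] <-].
exists (fun i : 'I_3 => nth 0 [:: re (1 - s - t); re s; re t] i).
split.
- by case=> [[|[|[|//]]]] /= _; rewrite re_ge0; lra.
- by rewrite !big_ord_recl !big_ord0 /=; apply: plane_ext; rewrite ?reimE /=; ring.
- by rewrite !big_ord_recl !big_ord0 /=; apply: plane_ext; rewrite ?reimE /=; ring.
Qed.

Lemma conv_quad p q d : conv [:: p; p + q; p + q + d; p + d] =
  [set p + re st.1 * q + re st.2 * d | st in [set st : R * R | 0 <= st.1 <= 1 /\ 0 <= st.2 <= 1]].
Proof.
apply/seteqP; split => x.
  move=> [w [w0 w1 ->]]; move: w1; rewrite !big_ord_recl !big_ord0 /=.
  have [-> h0] := ge0_re (w0 ord0); have [-> h1] := ge0_re (w0 (lift ord0 ord0)).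
  have [-> h2] := ge0_re (w0 (lift ord0 (lift ord0 ord0))).
  have [-> h3] := ge0_re (w0 (lift ord0 (lift ord0 (lift ord0 ord0)))).
  move/(congr1 Re); rewrite ?reimE /=.
  set r0 := Re (w ord0) in h0 *; set r1 := Re (w (lift ord0 ord0)) in h1 *.
  set r2 := Re (w (lift ord0 (lift ord0 ord0))) in h2 *.
  set r3 := Re _ in h3 * => h.
  (* The weight of the corner opposite to [p] counts in both directions; conversely, product weights
     will do. *)
  exists (r1 + r2, r2 + r3) => /=; first by split; lra.
  have e0 : r0 = 1 - r1 - r2 - r3 by lra.
  by apply: plane_ext; rewrite ?reimE /= -?/r0 ?e0; ring.
move=> [[s t] /= [hs ht] <-].
exists (fun i : 'I_4 => nth 0 [:: re ((1 - s) * (1 - t)); re (s * (1 - t)); re (s * t); re ((1 - s) * t)] i).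
split.
- by case=> [[|[|[|[|//]]]]] /= _; rewrite re_ge0; apply: mulr_ge0; move/andP: hs => []; move/andP: ht => [] *; lra.
- by rewrite !big_ord_recl !big_ord0 /=; apply: plane_ext; rewrite ?reimE /=; ring.
- by rewrite !big_ord_recl !big_ord0 /=; apply: plane_ext; rewrite ?reimE /=; ring.
Qed.

Lemma tri_tile p u : nsq u = 1 -> tri p (p + u) (p + u * zeta ^+ 2) = tile false p u.
Proof.
move=> hu; rewrite /tri conv_tri zeta2; have h3 := s3M R; have h0 := s3_gt0 R.
apply/seteqP; split => x.
  move=> [[s t] /= [hs ht hst] <-].
  rewrite [u * _]mulrC mulrA -addrA -mulrDl [_ * u]mulrC tile_std // std_tri ?reimE /=.
  by split; nra.
have [z ->] := frame_ex p x hu; rewrite tile_std // std_tri => -[h1 h2 h4].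
(* The coordinates of [z] in the basis [1, zeta ^ 2]. *)
exists (Re z - s3 * Im z / 3, 2 * s3 * Im z / 3) => /=; first by split; nra.
rewrite -addrA [u * Complex _ _]mulrC mulrA -mulrDl [_ * u]mulrC; congr (p + u * _).
by apply: plane_ext; rewrite ?reimE /=; [lra|nra].
Qed.

Lemma quad_tile p u : nsq u = 1 ->
  quad p (p + u) (p + u + u * zeta ^+ 3) (p + u * zeta ^+ 3) = tile true p u.
Proof.
move=> hu; rewrite /quad conv_quad zeta3.
apply/seteqP; split => x.
  move=> [[s t] /= [hs ht] <-].
  rewrite [u * _]mulrC mulrA -addrA -mulrDl [_ * u]mulrC tile_std // std_sq ?reimE /=.
  by split; lra.
have [z ->] := frame_ex p x hu; rewrite tile_std // std_sq => -[h1 h2 h3 h4].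
exists (Re z, Im z) => /=; first by split; lra.
rewrite -addrA [u * Complex _ _]mulrC mulrA -mulrDl [_ * u]mulrC; congr (p + u * _).
by apply: plane_ext; rewrite ?reimE /=; ring.
Qed.

Lemma triC p q d : tri p q d = tri p d q.
Proof.
rewrite /tri -[q](subrK p) -[d](subrK p) ![_ - _ + p]addrC !conv_tri.
by apply/seteqP; split => x [[s t] /= [h1 h2 h3] <-];
  exists (t, s) => /=; rewrite 1?addrAC //; split => //; lra.
Qed.

Lemma triR p q d : tri p q d = tri q d p.
Proof.
rewrite /tri -[q](subrK p) -[d](subrK p) ![_ - _ + p]addrC.
move: (q - p) (d - p) => {}q {}d; rewrite conv_tri.
have -> : [:: p + q; p + d; p] = [:: p + q; (p + q) + (d - q); (p + q) + (- q)].
  by congr [:: _; _; _]; ring.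
rewrite conv_tri.
apply/seteqP; split => x [[s t] /= [h1 h2 h3] <-].
  exists (t, 1 - s - t) => /=; first by split; lra.
  by apply: plane_ext; rewrite ?reimE /=; ring.
exists (1 - s - t, s) => /=; first by split; lra.
by apply: plane_ext; rewrite ?reimE /=; ring.
Qed.

Lemma quadC p q d : quad p (p + q) (p + q + d) (p + d) = quad p (p + d) (p + q + d) (p + q).
Proof.
rewrite /quad conv_quad addrAC conv_quad.
by apply/seteqP; split => x [[s t] /= [h1 h2] <-]; exists (t, s) => //=; rewrite 1?addrAC.
Qed.

End ConvexHulls.

(** * A tile, as a set, determines its shape and its sides *)

Section TileShapes.
Variable R : realType.
Local Notation C := (plane R).
Local Notation Re := (@complex.Re R).
Local Notation Im := (@complex.Im R).
Local Notation s3 := (s3 R).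
Local Notation re r := (Complex r 0 : C).
Implicit Types (x y z p q u v d c : C) (b : bool) (r s t : R).

(** Extreme points, in midpoint form: they depend on the set only, and so recover the vertices
    whatever the base. *)
Definition extreme (A : set C) x := A x /\ forall h, A (x + h) -> A (x - h) -> h = 0.

Lemma extreme_base b p u : nsq u = 1 -> extreme (tile b p u) p.
Proof.
move=> hu; split.
  rewrite -[X in tile _ _ _ X]addr0 -(mulr0 u) tile_std //.
  by have h0 := s3_gt0 R; case: b; [apply/std_sq|apply/std_tri]; rewrite ?reimE /=; split; lra.
move=> h; have [k hk] := frame_ex p (p + h) hu.
have {hk}-> : h = u * k by apply: (addrI p).
rewrite -mulrN !tile_std //.
have h0 := s3_gt0 R; case: b => [/std_sq[? ? ? ?] /std_sq|/std_tri[? ? ?] /std_tri].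
  by rewrite ?reimE => -[? ? ? ?]; rewrite (_ : k = 0) ?mulr0 //; apply: plane_ext; rewrite ?reimE /=; lra.
rewrite ?reimE => -[? ? ?]; rewrite (_ : k = 0) ?mulr0 //; apply: plane_ext; rewrite ?reimE /=; last by lra.
suff: s3 * Re k = 0 by move/eqP; rewrite mulf_eq0 (gt_eqF h0) => /eqP.
by lra.
Qed.

Lemma extreme_side b p u j : nsq u = 1 -> extreme (tile b p u) (side b p u j).1.
Proof.
by move=> hu; rewrite -(tile_side b p u j); apply: extreme_base; rewrite nsq_side.
Qed.

(* A point with two strictly positive barycentric coordinates, or on which one
   coordinate of the square is neither 0 nor 1, can be moved both ways. *)
Lemma extreme_vertex b p u x : nsq u = 1 -> extreme (tile b p u) x ->
  exists j, x = (side b p u j).1.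
Proof.
move=> hu; have [{}x ->] := frame_ex p x hu.
have h0 := s3_gt0 R; have h3 := s3M R.
move=> [/(tile_std _ p _ hu) hx hh].
have {}hh h : tile b 0 1 (x + h) -> tile b 0 1 (x - h) -> h = 0.
  move=> h1 h2; apply: (mulfI (unit_neq0 hu)); rewrite mulr0; apply: hh.
    by rewrite -addrA -mulrDr tile_std.
  by rewrite -addrA -mulrBr tile_std.
suff [j hj] : exists j, x = (side b 0 1 j).1.
  exists j; rewrite hj; have := side_frame b p u 0 1 j.
  by rewrite mulr0 addr0 mulr1 => ->.
have re_neq0 (r : R) : 0 < r -> re r = 0 -> False by move=> ? []; lra.
case: b hx hh => [/std_sq[y0 x1 y1 x0] hh|/std_tri[a0 b0 c0] hh].
  have im_neq0 (r : R) : 0 < r -> Complex 0 r = 0 :> C -> False by move=> ? []; lra.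
  have hx : Re x = 0 \/ Re x = 1.
    case: (ltrgt0P (Re x)) x0 => // [hx|->] _; last by left.
    case: (ltrP (Re x) 1) => hx1; last by right; lra.
    have [le|le] := leP (Re x) (1 / 2).
      by case: (re_neq0 (Re x)) => //; apply: hh; apply/std_sq; rewrite ?reimE /=; split; lra.
    by case: (re_neq0 (1 - Re x)); [lra|apply: hh; apply/std_sq; rewrite ?reimE /=; split; lra].
  have hy : Im x = 0 \/ Im x = 1.
    case: (ltrgt0P (Im x)) y0 => // [hy|->] _; last by left.
    case: (ltrP (Im x) 1) => hy1; last by right; lra.
    have [le|le] := leP (Im x) (1 / 2).
      by case: (im_neq0 (Im x)) => //; apply: hh; apply/std_sq; rewrite ?reimE /=; split; lra.
    by case: (im_neq0 (1 - Im x)); [lra|apply: hh; apply/std_sq; rewrite ?reimE /=; split; lra].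
  case: hx hy => hx [] hy.
  - by exists 0%N; apply: plane_ext; rewrite /wt /= ?reimE /= ?hx ?hy; lra.
  - by exists 3%N; apply: plane_ext; rewrite /wt /= ?reimE /= ?hx ?hy; lra.
  - by exists 1%N; apply: plane_ext; rewrite /wt /= ?reimE /= ?hx ?hy; lra.
  - by exists 2%N; apply: plane_ext; rewrite /wt /= ?reimE /= ?hx ?hy; lra.
have move_re (r : R) : 0 < r -> s3 * r <= s3 * (1 - Re x) - Im x -> s3 * r <= s3 * Re x - Im x -> False.
  by move=> r0 h1 h2; apply: (re_neq0 r) => //; apply: hh; apply/std_tri; rewrite ?reimE /=; split; nra.
have small (s t : R) : 0 < s -> 0 < t -> exists2 r : R, 0 < r & s3 * r <= s /\ s3 * r <= t.
  move=> s0 t0; have [le|le] := leP s t.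
    by exists (s / s3); [rewrite divr_gt0|rewrite mulrC divfK ?gt_eqF].
  by exists (t / s3); [rewrite divr_gt0|rewrite mulrC divfK ?gt_eqF //; split; lra].
have [bz|cz] : s3 * (1 - Re x) - Im x = 0 \/ s3 * Re x - Im x = 0.
  case: (ltrgt0P (s3 * (1 - Re x) - Im x)) b0 => // [hb|->] _; last by left.
  case: (ltrgt0P (s3 * Re x - Im x)) c0 => // [hc|->] _; last by right.
  by have [r r0 [h1 h2]] := small _ _ hb hc; case: (move_re r).
- have [az|cz] : Im x = 0 \/ s3 * Re x - Im x = 0.
    case: (ltrgt0P (Im x)) a0 => // [ha|->] _; last by left.
    case: (ltrgt0P (s3 * Re x - Im x)) c0 => // [hc|->] _; last by right.
    have [r r0 [h1 h2]] := small _ _ ha hc.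
    case: (re_neq0 (r / 2)); first by lra.
    suff: Complex (r / 2) (- (s3 * r / 2)) = 0 :> C by case=> -> _.
    by apply: hh; apply/std_tri; rewrite ?reimE /=; split; nra.
  + by exists 1%N; apply: plane_ext; rewrite /wt /= ?reimE /=; nra.
  + by exists 2%N; apply: plane_ext; rewrite /wt /= ?reimE /=; nra.
have [az|bz] : Im x = 0 \/ s3 * (1 - Re x) - Im x = 0.
  case: (ltrgt0P (Im x)) a0 => // [ha|->] _; last by left.
  case: (ltrgt0P (s3 * (1 - Re x) - Im x)) b0 => // [hb|->] _; last by right.
  have [r r0 [h1 h2]] := small _ _ ha hb.
  case: (re_neq0 (r / 2)); first by lra.
  suff: Complex (r / 2) (s3 * r / 2) = 0 :> C by case=> -> _.
  by apply: hh; apply/std_tri; rewrite ?reimE /=; split; nra.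
+ by exists 0%N; apply: plane_ext; rewrite /wt /= ?reimE /=; nra.
+ by exists 2%N; apply: plane_ext; rewrite /wt /= ?reimE /=; nra.
Qed.

(** The vertex [p'] is extreme, hence a vertex of the first tile. Basing both tiles there leaves a
    direction [v] that is again a vertex of the standard tile, at distance 1 from 0; of the two
    neighbours of 0, only the counterclockwise one has the tile on its left. *)
Lemma tile_inj b b' p p' u u' : nsq u = 1 -> nsq u' = 1 -> tile b p u = tile b' p' u' ->
  b = b' /\ exists j, (p', u') = side b p u j.
Proof.
move=> hu hu' hT.
have [j hj] : exists j, p' = (side b p u j).1.
  by apply: extreme_vertex hu _; rewrite hT; apply: extreme_base.
suff [<- [k hk]] : b = b' /\ exists k, (p', u') = side b p' (side b p u j).2 k.
  by split=> //; exists (k + j)%N; rewrite hk {1}hj side_side.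
move: hT; rewrite -(tile_side b p u j) -hj.
have: nsq (side b p u j).2 = 1 by rewrite nsq_side.
move: (side b p u j).2 => {p j hj hu} {}u hu; move: p' => p hT.
have [v hv] : exists v, u' = u * v by exists (u' / u); rewrite mulrCA divff ?mulr1 ?unit_neq0.
have hv1 : nsq v = 1 by move: hu'; rewrite hv nsqM hu mul1r.
have {}hT z : tile b 0 1 z <-> tile b' 0 v z.
  rewrite -(tile_std _ p _ hu) hT hv -(tile_frame _ p 0 v z hu).
  by rewrite mulr0 addr0.
suff [<- [k hk]] : b = b' /\ exists k, (0, v) = side b 0 1 k.
  split => //; exists k; have := side_frame b p u 0 1 k.
  by rewrite mulr0 addr0 mulr1 -hk /= mulr0 addr0 -hv.
have h0 := s3_gt0 R; have h3 := s3M R.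
have [j hj] : exists j, v = (side b 0 1 j).1.
  apply: extreme_vertex; first by rewrite /nsq /=; lra.
  have -> : tile b 0 1 = tile b' 0 v by apply/seteqP; split=> z /hT.
  by have := extreme_side b' 0 1%N hv1; rewrite /= add0r.
have hin z : tile b' 0 1 z -> tile b 0 1 (v * z).
  by move=> hz; apply/hT; rewrite -(add0r (v * z)) tile_std.
have hout z : tile b 0 1 (v * z) -> tile b' 0 1 z.
  by move=> /hT; rewrite -(add0r (v * z)) tile_std.
move: hj hin hout hv1; rewrite side_mod.
have: (j %% nsides b < nsides b)%N by rewrite ltn_mod; case: (b).
move: (_ %% _)%N => {}j; case: b {hT} => /=.
- move: j => [|[|[|[|//]]]] _ /=; rewrite /next_side /=.
  + by move=> -> _ _; rewrite /nsq /=; lra.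
  + rewrite add0r => ->; case: b' => [_ _ _|_ hout _]; first by split=> //; exists 0%N.
    have : tile false 0 1 (Complex 0 1 : C).
      by apply: hout; apply/std_sq; rewrite ?reimE /=; split; lra.
    by move/std_tri => []; rewrite ?reimE /=; lra.
  + by move=> -> _ _; rewrite /nsq /wt /= ?reimE /=; lra.
  + move=> -> hin _ _; exfalso; case: b' hin => hin.
      have /(hin _)/std_sq[] : tile true 0 1 (Complex 0 1 : C) by apply/std_sq; split=> /=; lra.
      by rewrite /wt /= ?reimE /=; lra.
    have /(hin _)/std_sq[] : tile false 0 1 (Complex (1 / 2) (s3 / 2) : C) by apply/std_tri; split=> /=; lra.
    by rewrite /wt /= ?reimE /=; lra.
- move: j => [|[|[|//]]] _ /=; rewrite /next_side /=.
  + by move=> -> _ _; rewrite /nsq /=; lra.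
  + rewrite add0r => ->; case: b' => [hin _ _|_ _ _]; last by split=> //; exists 0%N.
    exfalso; have /(hin _)/std_tri[] : tile true 0 1 (Complex 1 1 : C) by apply/std_sq; split=> /=; lra.
    by rewrite ?reimE /=; nra.
  + move=> -> hin _ _; exfalso; case: b' hin => hin.
      have /(hin _)/std_tri[] : tile true 0 1 (Complex 0 1 : C) by apply/std_sq; split=> /=; lra.
      by rewrite /wt /= ?reimE /=; nra.
    have /(hin _)/std_tri[] : tile false 0 1 (Complex (1 / 2) (s3 / 2) : C) by apply/std_tri; split=> /=; lra.
    by rewrite /wt /= ?reimE /=; nra.
Qed.

End TileShapes.

(** * From lists of vertices to tiles with a base side *)

Section GoodTilings.
Variable R : realType.
Local Notation C := (plane R).
Local Notation Re := (@complex.Re R).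
Local Notation Im := (@complex.Im R).
Local Notation s3 := (s3 R).
Local Notation zeta := (zeta R).
Implicit Types (x y z p q u v d c : C) (b : bool) (r s t : R) (T : set (set C)).

Lemma seg_rev p u : seg (p + u) (- u) = seg p u.
Proof.
apply/seteqP; split => x [t /= ht <-]; exists (1 - t) => /=.
- by lra.
- by apply: plane_ext; rewrite ?reimE /=; ring.
- by lra.
- by apply: plane_ext; rewrite ?reimE /=; ring.
Qed.

Lemma addrBC p q : p + (q - p) = q. Proof. by rewrite addrC subrK. Qed.

(** The third vertex is at height [sqrt 3 / 2] on one side or the other of the first edge, as lists
    may run clockwise. *)
Lemma third_vertex p q d : nsq (q - p) = 1 -> nsq (d - q) = 1 -> nsq (p - d) = 1 ->
  d = p + (q - p) * zeta ^+ 2 \/ q = p + (d - p) * zeta ^+ 2.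
Proof.
move=> h1; have [z ->] := frame_ex p d h1; set u := q - p in h1 *.
have -> : q = p + u * 1 by rewrite /u; ring.
have -> : p - (p + u * z) = p + u * 0 - (p + u * z) by ring.
rewrite !nsq_frame h1 !mul1r zeta2 => h2 h3; have hs := s3M R.
have e1 : Re z = 1 / 2 by move: h2 h3; rewrite /nsq ?reimE; nra.
have : (Im z - s3 / 2) * (Im z + s3 / 2) = 0.
  by move: h2 h3; rewrite /nsq ?reimE e1; nra.
move/eqP; rewrite mulf_eq0 => /orP[/eqP e2|/eqP e2]; [left|right].
  by congr (p + u * _); apply: plane_ext => /=; lra.
have -> : p + u * z - p = u * z by ring.
by rewrite -mulrA; congr (p + u * _); apply: plane_ext; rewrite ?reimE /= e1; nra.
Qed.

(** What is retained of a side of [A]: the tile can be based on it, up to direction since a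
    clockwise list runs through it backwards, and its first end is extreme. *)
Definition side_at (A : set C) v w :=
  exists b p u, [/\ nsq u = 1, A = tile b p u, conv [:: v; w] = seg p u & extreme A v].

Lemma side_at_tri p q d : nsq (q - p) = 1 -> nsq (d - q) = 1 -> nsq (p - d) = 1 ->
  side_at (tri p q d) p q.
Proof.
move=> h1 h2 h3.
have ccw p' q' d' : nsq (q' - p') = 1 -> d' = p' + (q' - p') * zeta ^+ 2 ->
    tri p' q' d' = tile false p' (q' - p').
  by move=> h ->; rewrite -tri_tile // addrBC.
have [hd|hq] := third_vertex h1 h2 h3.
  exists false, p, (q - p); rewrite (ccw p q d) //; split => //; last exact: extreme_base.
  by rewrite -conv_seg addrBC.
have hp' : d = q + (p - q) * zeta ^+ 2.
  have e2 : zeta ^+ 4 = zeta ^+ 2 - 1 by rewrite zeta4 zeta2; apply: plane_ext; rewrite ?reimE /=; lra.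
  rewrite hq opprD addNKr mulNr -mulrA -exprD e2.
  by ring.
exists false, q, (p - q); rewrite triR triC (ccw q p d) //; last by rewrite nsq_sub.
split => //.
- by rewrite nsq_sub.
- by have := seg_rev p (q - p); rewrite addrBC opprB => ->; rewrite -conv_seg addrBC.
- have hp : (side false q (p - q) 1).1 = p by rewrite /= addrBC.
  by rewrite -{2}hp; apply: extreme_side; rewrite nsq_sub.
Qed.

Lemma side_at_square p u j : nsq u = 1 ->
  side_at (tile true p u) (side true p u j).1 (side true p u j.+1).1.
Proof.
move=> hu; exists true, (side true p u j).1, (side true p u j).2.
rewrite nsq_side tile_side; split => //; first by rewrite -conv_seg.
exact: extreme_side.
Qed.

Lemma imaginaryE : 'i%R = Complex 0 1 :> C. Proof. by []. Qed.

Lemma side_atP (l : seq C) v : unit_triangle l \/ unit_square l -> v \in l ->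
  side_at (conv l) v (next l v).
Proof.
have sub_neq x y : nsq (x - y) = 1 -> (y == x) = false.
  by move=> h; apply/eqP => e; move: h; rewrite e subrr /nsq /=; lra.
case=> [[p [q [d [-> [/unitP h1 /unitP h2 /unitP h3]]]]]|[p [u [/unitP hu ->]]]].
  (* [next] searches by equality, so it computes only once the vertices are known to be distinct. *)
  have n1 := sub_neq _ _ h1; have n2 := sub_neq _ _ h2; have n3 := sub_neq _ _ h3.
  have ns := (n1, n2, n3, etrans (eq_sym _ _) n1, etrans (eq_sym _ _) n2, etrans (eq_sym _ _) n3).
  rewrite !inE => /or3P[] /eqP->; rewrite /= ?eqxx ?ns.
  - exact: side_at_tri.
  - by rewrite -/(tri p q d) triR; apply: side_at_tri.
  - by rewrite -/(tri p q d) -triR; apply: side_at_tri.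
rewrite imaginaryE.
have e1 : (side true p u 1).1 = p + u by [].
have e2 : (side true p u 2).1 = p + u + Complex 0 1 * u by rewrite /= mulrC.
have e3 : (side true p u 3).1 = p + Complex 0 1 * u.
  by apply: plane_ext; rewrite /wt /= ?reimE /=; ring.
have -> : conv [:: p; p + u; p + u + Complex 0 1 * u; p + Complex 0 1 * u] = tile true p u.
  by rewrite -quad_tile // zeta3 [u * _]mulrC.
have u0 := unit_neq0 hu.
have i0 : (Complex 0 1 : C) != 0 by apply/eqP => -[]; lra.
have iu0 := mulf_neq0 i0 u0.
have i1 : 1 + Complex 0 1 != 0 :> C by apply/eqP => -[]; lra.
have i2 : 1 - Complex 0 1 != 0 :> C by apply/eqP => -[]; lra.
have add_neq x y : y != 0 -> (x == x + y) = false.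
  by move=> h; apply: contraNF h => /eqP e; apply/eqP/(addrI x); rewrite addr0.
have n1 : (p == p + u) = false by apply: add_neq.
have n2 : (p == p + u + Complex 0 1 * u) = false.
  by rewrite -addrA -{1}[u]mul1r -mulrDl; apply/add_neq/mulf_neq0.
have n3 : (p == p + Complex 0 1 * u) = false by apply: add_neq.
have n4 : (p + u == p + u + Complex 0 1 * u) = false by apply: add_neq.
have n5 : (p + u == p + Complex 0 1 * u) = false.
  rewrite eq_sym; have -> : p + u = p + Complex 0 1 * u + (1 - Complex 0 1) * u by ring.
  exact/add_neq/mulf_neq0.
have n6 : (p + u + Complex 0 1 * u == p + Complex 0 1 * u) = false.
  by rewrite eq_sym addrAC; apply: add_neq.
have ns := (n1, n2, n3, n4, n5, n6, etrans (eq_sym _ _) n1, etrans (eq_sym _ _) n2,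
  etrans (eq_sym _ _) n3, etrans (eq_sym _ _) n4, etrans (eq_sym _ _) n5, etrans (eq_sym _ _) n6).
rewrite !inE => /or4P[] /eqP->; rewrite /= ?eqxx ?ns.
- exact: (side_at_square p 0%N).
- by rewrite -e2; apply: (side_at_square p 1%N).
- by rewrite -e2 -e3; apply: side_at_square.
- by have := side_at_square p 3%N hu; rewrite e3 (side_period true p u 0).
Qed.

Lemma is_tile A : is_unit_triangle A \/ is_unit_square A ->
  exists b p u, nsq u = 1 /\ A = tile b p u.
Proof.
move=> h; have [l [hl hA]] : exists l, (unit_triangle l \/ unit_square l) /\ A = conv l.
  by case: h => [[l hl ->]|[l hl ->]]; exists l; split; auto.
have [v hv] : exists v, v \in l.
  by case: hl => [[p [? [? [-> _]]]]|[p [? [_ ->]]]]; exists p; rewrite inE eqxx.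
have [b [p [u [hu e _ _]]]] := side_atP hl hv.
by exists b, p, u; rewrite hA.
Qed.

End GoodTilings.

(** * Local finiteness, and the tile across a side *)

Section EdgeLemma.
Variable R : realType.
Local Notation C := (plane R).
Local Notation Re := (@complex.Re R).
Local Notation Im := (@complex.Im R).
Local Notation re r := (Complex r 0 : C).
Implicit Types (x y z p q u v d c : C) (b : bool) (r s t : R) (T : set (set C)).

Lemma uniform_bound (P : nat -> R -> Prop) :
  (forall i e e', P i e -> 0 < e' <= e -> P i e') ->
  (forall i, exists2 e, 0 < e & P i e) ->
  forall n, exists2 e, 0 < e & forall i, (i < n)%N -> P i e.
Proof.
move=> mono h; elim=> [|n [e e0 IH]]; first by exists 1.
have [e' e'0 he'] := h n; exists (Num.min e e'); first by rewrite lt_min e0.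
move=> i; rewrite ltnS leq_eqVlt => /orP[/eqP->|hi].
  by apply: mono he' _; rewrite lt_min e0 e'0 /= ge_min lexx orbT.
by apply: mono (IH _ hi) _; rewrite lt_min e0 e'0 /= ge_min lexx.
Qed.

Lemma grid_index (N : nat) t : 0 <= t < N%:R / 5 ->
  exists2 i, (i < N)%N & i%:R / 5 <= t < (i.+1)%:R / 5.
Proof.
elim: N => [|N IH]; first by rewrite mul0r => /andP[h h']; have := le_lt_trans h h'; rewrite ltxx.
move=> /andP[h0 h1]; have [le|lt] := leP (N%:R / 5) t; first by exists N => //; rewrite le h1.
by have [|i hi h] := IH; [rewrite h0|exists i => //; apply: ltnW].
Qed.

Lemma sqr_lt s t : - t < s -> s < t -> s * s < t * t.
Proof. by move=> ? ?; nra. Qed.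

Lemma lt_sqr s t : 0 <= t -> s * s < t * t -> - t < s < t.
Proof. by move=> ? ?; apply/andP; split; nra. Qed.

(* Two tiles whose centers lie in the same cell of a grid of mesh 1/5 overlap. *)
Lemma locally_finite T x :
  (forall b p u b' p' u' y, nsq u = 1 -> nsq u' = 1 -> T (tile b p u) ->
     T (tile b' p' u') -> stile b p u y -> stile b' p' u' y -> tile b p u = tile b' p' u') ->
  exists2 e : R, 0 < e & forall b p u y, nsq u = 1 -> T (tile b p u) -> tile b p u y ->
    nsq (y - x) < e -> tile b p u x.
Proof.
move=> disj.
pose cell (i j : nat) z := i%:R / 5 <= Re z - Re x + 3 < i.+1%:R / 5 /\
  j%:R / 5 <= Im z - Im x + 3 < j.+1%:R / 5.
pose P i j (e : R) := forall b p u y, nsq u = 1 -> T (tile b p u) -> cell i j (cen b p u) ->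
  tile b p u y -> nsq (y - x) < e -> tile b p u x.
have Pmono i j e e' : P i j e -> 0 < e' <= e -> P i j e'.
  move=> h /andP[_ le] b p u y h1 h2 h3 h4 h5; apply: (h b p u y) => //.
  exact: lt_le_trans h5 le.
have Pex i j : exists2 e, 0 < e & P i j e.
  have [[b [p [u [hu hT hc hx]]]]|no] := pselect (exists b p u,
    [/\ nsq u = 1, T (tile b p u), cell i j (cen b p u) & ~ tile b p u x]); last first.
    exists 1 => // b p u y h1 h2 h3 h4 _; apply: contra_notP no => h5.
    by exists b, p, u.
  have [e e0 he] := notin_tile hu hx.
  exists e => // b' p' u' y hu' hT' hc' hy hye.
  suff eT : tile b p u = tile b' p' u' by move: hy; rewrite -eT => /he; case.
  apply: (disj _ _ _ _ _ _ (cen b' p' u')) => //; last exact: cen_stile.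
  apply: stile_near_cen => //.
  case: hc hc' => /andP[h1 h2] /andP[h3 h4] [/andP[h5 h6] /andP[h7 h8]].
  rewrite -?(natr1 i) -?(natr1 j) in h2 h4 h6 h8.
  move: h1 h2 h3 h4 h5 h6 h7 h8; move: (cen b p u) (cen b' p' u') => k k'.
  rewrite /nsq ?reimE; move: (i%:R) (j%:R) => ii jj h1 h2 h3 h4 h5 h6 h7 h8.
  (* The squared distance of the centers is below [2 / 25 < 1 / 12], the squared inradius. *)
  have e1 : (Re k' - Re k) * (Re k' - Re k) < 1 / 5 * (1 / 5) by apply: sqr_lt; lra.
  have e2 : (Im k' - Im k) * (Im k' - Im k) < 1 / 5 * (1 / 5) by apply: sqr_lt; lra.
  by lra.
(* A tile with a point at distance less than 1 from [x] has its center at coordinate distance less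
   than 3; with the offset 3 in [cell], these centers lie in 30 by 30 cells of mesh [1 / 5]. *)
have [e e0 he] : exists2 e, 0 < e & forall i, (i < 30)%N -> forall j, (j < 30)%N -> P i j e.
  apply: (uniform_bound (P := fun i e => forall j, (j < 30)%N -> P i j e)).
    by move=> i e e' h h' j hj; apply: Pmono (h j hj) h'.
  move=> i; apply: uniform_bound => // j e e'; exact: Pmono.
exists (Num.min e 1); first by rewrite lt_min e0 ltr01.
move=> b p u y hu hT hy; rewrite lt_min => /andP[hye hy1].
have hd := tile_diam hu hy (stile_tile (cen_stile b p hu)).
set k := cen b p u in hd.
have [k1 k2] : -3 < Re k - Re x < 3 /\ -3 < Im k - Im x < 3.
  move: hy1 hd; move: (k) => k'; rewrite /nsq ?reimE.
  move=> h1 h2.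
  have b1 : - 1 < Re y - Re x < 1.
    by apply: lt_sqr => //; have := sqr_ge0 (Im y - Im x); rewrite expr2; lra.
  have b2 : - 1 < Im y - Im x < 1.
    by apply: lt_sqr => //; have := sqr_ge0 (Re y - Re x); rewrite expr2; lra.
  have b3 : - 2 < Re y - Re k' < 2.
    by apply: lt_sqr => //; have := sqr_ge0 (Im y - Im k'); rewrite expr2; lra.
  have b4 : - 2 < Im y - Im k' < 2.
    by apply: lt_sqr => //; have := sqr_ge0 (Re y - Re k'); rewrite expr2; lra.
  by split; lra.
have [|i hi ci] := @grid_index 30 (Re k - Re x + 3); first by lra.
have [|j hj cj] := @grid_index 30 (Im k - Im x + 3); first by lra.
by apply: (he i hi j hj b p u y).
Qed.

(** The last property is what is kept of edge-to-edge: across each side there is a tile based on the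
    reversed side. *)
Definition good T :=
  [/\ forall A, T A -> exists b p u, nsq u = 1 /\ A = tile b p u,
      forall x, exists2 A, T A & A x,
      forall b p u b' p' u' x, nsq u = 1 -> nsq u' = 1 -> T (tile b p u) -> T (tile b' p' u') ->
        stile b p u x -> stile b' p' u' x -> tile b p u = tile b' p' u'
    & forall b p u, nsq u = 1 -> T (tile b p u) -> exists b', T (tile b' (p + u) (- u))].

Lemma seg_inj p u p' u' : nsq u = 1 -> nsq u' = 1 -> seg p u = seg p' u' ->
  (p' = p /\ u' = u) \/ (p' = p + u /\ u' = - u).
Proof.
move=> hu hu' e.
have [s /= hs es] : seg p u p' by rewrite e; exists 0 => /=; [lra|apply: plane_ext; rewrite ?reimE /=; ring].
have [t /= ht et] : seg p u (p' + u').
  by rewrite e; exists 1 => /=; [lra|apply: plane_ext; rewrite ?reimE /=; ring].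
have eu' : u' = re (t - s) * u.
  apply: (addrI p'); rewrite -et -es; apply: plane_ext; rewrite ?reimE /=; ring.
have : (t - s) * (t - s) = 1 by move: hu'; rewrite eu' nsqM hu /nsq /=; nra.
move=> h; have [[e1 e2]|[e1 e2]] : (s = 0 /\ t = 1) \/ (s = 1 /\ t = 0).
  have [le|lt] := leP s t; [left|right]; split; nra.
- by left; rewrite eu' -es e1 e2; split; apply: plane_ext; rewrite ?reimE /=; ring.
- by right; rewrite eu' -es e1 e2; split; apply: plane_ext; rewrite ?reimE /=; ring.
Qed.

(** Identifies a side of a tile from the sole knowledge that its line contains the midpoint of the
    base. *)
Lemma side_middle b p u j : nsq u = 1 ->
  left (side b p u j).1 (side b p u j).2 (p + u * re (1 / 2)) = 0 -> side b p u j = (p, u).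
Proof.
move=> hu; have := side_frame b p u 0 1 j; rewrite mulr0 addr0 mulr1 => ->.
rewrite left_frame hu mul1r [side b 0 1 j]side_mod.
have h0 := s3_gt0 R.
have : (j %% nsides b < nsides b)%N by rewrite ltn_mod; case: (b).
move: (j %% _)%N => k; case: b => hk.
  have [_ f1 f2 f3] := left_std_sq (re (1 / 2)).
  move: k hk => [_ _|[_|[_|[_|//]]]]; rewrite ?(f1, f2, f3); last 3 first.
  - by move=> /= h; exfalso; lra.
  - by move=> /= h; exfalso; lra.
  - by move=> /= h; exfalso; lra.
  - by rewrite /= mulr0 addr0 mulr1.
have [_ f1 f2] := left_std_tri (re (1 / 2)).
move: k hk => [_ _|[_|[_|//]]]; rewrite ?(f1, f2); last 2 first.
- by move=> /= h; exfalso; nra.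
- by move=> /= h; exfalso; nra.
- by rewrite /= mulr0 addr0 mulr1.
Qed.

(** The tile [B] containing a point [x] just outside the midpoint [m] of the base contains [m], by
    local finiteness. As [m] is not a vertex, edge-to-edge leaves a common side through [m], which
    is the base itself. *)
Lemma tiling_good T : tiling T -> edge_to_edge T -> good T.
Proof.
move=> [shape cover disj] e2e.
have disj' b p u b' p' u' x : nsq u = 1 -> nsq u' = 1 -> T (tile b p u) -> T (tile b' p' u') ->
    stile b p u x -> stile b' p' u' x -> tile b p u = tile b' p' u'.
  move=> hu hu' hT hT' hx hx'; apply: contrapT => ne.
  suff : (set0 : set C) x by [].
  rewrite -(disj _ _ hT hT' ne); split; exact: stile_interior.
have cover' x : exists2 A, T A & A x.
  by have: [set: C] x by []; rewrite -cover => -[A hA hx]; exists A.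
split => // [A /shape/is_tile//|b p u hu hT].
pose m := p + re (1 / 2) * u.
have mE : m = p + u * Complex (1 / 2) 0 by rewrite /m mulrC.
have [e e0 he] := locally_finite m disj'.
pose t := Num.min e 1 / 2.
have tm : 0 < Num.min e 1 by rewrite lt_min e0 ltr01.
have te : t < e /\ t < 1 by rewrite /t; split; case: (leP e 1) tm => *; lra.
have t0 : 0 < t by rewrite /t; lra.
pose x := p + u * Complex (1 / 2) (- t).
have [B hB Bx] := cover' x.
have [b1 [p1 [u1 [hu1 eB]]]] := is_tile (shape _ hB).
have Ax : ~ tile b p u x.
  by rewrite /x tile_std //; case: (b) => [/std_sq|/std_tri] [/= h *]; move: h t0; clear; lra.
have Am : tile b p u m.
  clear eB.
  have h0 := s3_gt0 R; rewrite mE tile_std //.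
  by case: (b); [apply/std_sq|apply/std_tri]; split => /=; lra.
have Bm : B m.
  rewrite eB; apply: (he _ _ _ x) => //; rewrite -?eB //.
  by rewrite mE /x nsq_frame hu mul1r /nsq /=; move: te t0; clear; nra.
have neAB : tile b p u <> B by move=> eAB; apply: Ax; rewrite eAB.
case: (e2e _ _ hT hB neAB) => [eI|[v [[l [hl eA hv]] _ eI]]|[s [[l [v [hl eA hv es]]] [l' [v' [hl' eB' hv' es']]] eI]]].
- by suff : (set0 : set C) m by []; rewrite -eI.
- have [b2 [p2 [u2 [_ _ _]]]] := side_atP hl hv; rewrite -eA => -[_ hext].
  have vm : v = m by have : (tile b p u `&` B) m by []; rewrite eI.
  (* From [m] one can move by half the base both ways inside the tile, so [m] is not extreme. *)
  have/eqP : u * Complex (1 / 2) 0 = 0.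
    clear eA eB; have h0 := s3_gt0 R.
    apply: hext; rewrite vm mE -addrA -?mulrDr -?mulrBr tile_std //;
      by case: (b); [apply/std_sq|apply/std_tri]; rewrite ?reimE /=; split => /=; lra.
  by rewrite mulf_eq0 (negbTE (unit_neq0 hu)) /= => /eqP[]; lra.
have [b2 [p2 [u2 [hu2 eA2 eseg _]]]] := side_atP hl hv; rewrite -eA in eA2; rewrite -es in eseg.
have [b3 [p3 [u3 [hu3 eB3 eseg' _]]]] := side_atP hl' hv'; rewrite -eB' in eB3; rewrite -es' in eseg'.
have sm : s m by rewrite -eI.
have [eb [j ej]] := tile_inj hu hu2 eA2.
have e2 : (p2, u2) = (p, u).
  have lm : left p2 u2 m = 0.
    by move: sm; rewrite eseg => -[r _ <-]; rewrite /left ?reimE /=; ring.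
  by rewrite ej; apply: side_middle => //; rewrite -mE -ej.
case: e2 => ep eu; rewrite ep eu in eseg.
have [[e3 e4]|[e3 e4]] := seg_inj hu hu3 (etrans (esym eseg) eseg'); last first.
  by exists b3; rewrite -e3 -e4 -eB3.
(* If [B] had the base in the same direction, the point at height [1 / 4] above [m] would be
   interior to both tiles. *)
case: neAB; rewrite eB3 e3 e4.
apply: (disj' _ _ _ _ _ _ (p + u * Complex (1 / 2) (1 / 4))) => //.
- by rewrite -e3 -e4 -eB3.
- rewrite stile_std //; have hs := s3_bounds R.
  by case: (b); [apply/std_ssq|apply/std_stri]; split => /=; lra.
- rewrite stile_std //; have hs := s3_bounds R.
  by case: (b3); [apply/std_ssq|apply/std_stri]; split => /=; lra.
Qed.

End EdgeLemma.

(* Versions of [has] and [all] that stop early under call by value. *)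
Definition any (A : Type) (a : pred A) (s : seq A) : bool := (find a s < size s)%N.
Definition every (A : Type) (a : pred A) (s : seq A) : bool := ~~ any (fun x => ~~ a x) s.

Lemma anyE (A : Type) (a : pred A) s : any a s = has a s.
Proof. by rewrite /any has_find. Qed.
Lemma everyE (A : Type) (a : pred A) s : every a s = all a s.
Proof. by rewrite /every anyE has_predC negbK. Qed.

(** * Exact integer arithmetic and the finite searches *)

Section Coordinates.
Local Open Scope Z_scope.

(* (a, b, c, d) stands for (a + b zeta + c zeta^2 + d zeta^3) / 12, where
   zeta = exp(i pi / 6); the denominator makes centers and midpoints integral. *)
Definition pt : Type := (Z * Z * Z * Z)%type.
Definition padd (x y : pt) : pt :=
  let: (a, b, c, d) := x in let: (a', b', c', d') := y in (a + a', b + b', c + c', d + d').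
Definition popp (x : pt) : pt := let: (a, b, c, d) := x in (- a, - b, - c, - d).
Definition psub (x y : pt) : pt := padd x (popp y).
Definition pscale (n : Z) (x : pt) : pt := let: (a, b, c, d) := x in (n * a, n * b, n * c, n * d).
(** Multiplication by zeta, reduced by [zeta ^ 4 = zeta ^ 2 - 1]. *)
Definition pzeta (x : pt) : pt := let: (a, b, c, d) := x in (- d, a, b + d, c).
Definition prot (k : nat) (x : pt) : pt := iter k pzeta x.
Definition pdir (k : nat) : pt := prot k (12, 0, 0, 0).
Definition phalf (x : pt) : pt :=
  let: (a, b, c, d) := x in (Z.div2 a, Z.div2 b, Z.div2 c, Z.div2 d).

(* (a, b) stands for a + b * sqrt 3. *)
Definition qpos (x : Z * Z) : bool :=
  let: (a, b) := x in
  if 0 <=? a then (if 0 <=? b then (0 <? a) || (0 <? b) else 3 * (b * b) <? a * a)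
  else (0 <? b) && (a * a <? 3 * (b * b)).
Definition qneg (x : Z * Z) : Z * Z := (- x.1, - x.2).
Definition qnn (x : Z * Z) : bool := ~~ qpos (qneg x).

Definition re24 (x : pt) : Z * Z := let: (a, b, c, d) := x in (2 * a + c, b).
Definition im24 (x : pt) : Z * Z := let: (a, b, c, d) := x in (b + 2 * d, c).
Definition nsq576 (x : pt) : Z * Z :=
  let: (a, b) := re24 x in let: (c, d) := im24 x in
  (a * a + 3 * (b * b) + c * c + 3 * (d * d), 2 * (a * b + c * d)).

(* (b, p, k) stands for [tile b p (zeta ^+ k)]. *)
Definition tcode : Type := (bool * pt * nat)%type.
Definition addk (k j : nat) : nat := (if k + j < 12 then k + j else k + j - 12)%N.
Definition turn (b : bool) : nat := if b then 3%N else 4%N.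
Definition next_code (t : tcode) : tcode :=
  let: (b, p, k) := t in (b, padd p (pdir k), addk k (turn b)).
Definition orbit_code (t : tcode) : seq tcode :=
  if t.1.1 then traject next_code t 4 else traject next_code t 3.
(** [f] is [qnn] for the closed tile and [qpos] for its interior. The slanted sides of the triangle
    give [24 (sqrt 3 (1 - Re z) - Im z)] and [24 (sqrt 3 Re z - Im z)]. Nested conditionals stop at
    the first failure. *)
Definition inside0 (f : Z * Z -> bool) (b : bool) (z : pt) : bool :=
  let: (r1, r2) := re24 z in let: (i1, i2) := im24 z in
  if f (i1, i2) then
    if b then
      if f (24 - r1, - r2) then if f (24 - i1, - i2) then f (r1, r2) else false else false
    else if f (- 3 * r2 - i1, 24 - r1 - i2) then f (3 * r2 - i1, r1 - i2) else false
  else false.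
Definition inside (f : Z * Z -> bool) (t : tcode) (x : pt) : bool :=
  let: (b, p, k) := t in inside0 f b (prot (12 - k) (psub x p)).

(* Centers of the tiles based at 0, and points inside each of their 30-degree
   sectors at the vertices. *)
Definition center_table : seq (seq pt) := Eval vm_compute in
  [seq [seq (if b then phalf (padd (pdir k) (pdir (k + 3))) else prot k (4, 0, 4, 0))
       | k <- iota 0 12] | b <- [:: false; true]].
Definition probe_table : seq (seq (seq pt)) := Eval vm_compute in
  [seq [seq flatten [seq [seq padd s.1.2 (prot (s.2 + j) (3, 3, 0, 0))
               | j <- iota 0 (if b then 3 else 2)%N] | s <- orbit_code (b, (0, 0, 0, 0), k)]
       | k <- iota 0 12] | b <- [:: false; true]].
Definition center_code (t : tcode) : pt :=
  let: (b, p, k) := t in padd p (nth (0, 0, 0, 0) (nth [::] center_table b) k).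
Definition probes (b : bool) (k : nat) : seq pt := nth [::] (nth [::] probe_table b) k.
(** [1152 = 2 * 576]: circumradii are at most [1 / sqrt 2], so tiles with centers at distance
    [sqrt 2] or more have disjoint interiors. *)
Definition near_code (s t : tcode) : bool :=
  let: (a, b) := nsq576 (psub (center_code s) (center_code t)) in qpos (1152 - a, - b).
Definition half_overlap (s t : tcode) : bool :=
  let: (b, p, k) := s in let: (b', p', k') := t in
  let q := prot (12 - k) (psub p' p) in
  any (fun v => inside0 qpos b (padd q v)) (probes b' (addk k' (12 - k))).
Definition overlap (s t : tcode) : bool :=
  if half_overlap s t then true else half_overlap t s.
(** One tile has several codes, so tiles are told apart by a vertex of one that lies outside the
    other. *)
Definition distinct_tiles (s t : tcode) : bool :=
  has (fun v => ~~ inside qnn s v.1.2) (orbit_code t) ||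
  has (fun v => ~~ inside qnn t v.1.2) (orbit_code s).
(* The test of distance only saves time. *)
Definition conflict (s t : tcode) : bool :=
  if (s.2 < 12)%N && (t.2 < 12)%N then
    if near_code s t then if overlap s t then distinct_tiles s t else false else false
  else false.

Definition side_codes (P : seq tcode) : seq (pt * nat) :=
  flatten [seq [seq (s.1.2, s.2) | s <- orbit_code t] | t <- P].
Definition reverse_side (s : pt * nat) : pt * nat := (padd s.1 (pdir s.2), addk s.2 6).
(* [far]: more than 5/4 away from 0.  [outer]: all points of the side are. *)
Definition far (x : pt) : bool := let: (a, b) := nsq576 x in qpos (a - 900, b).
Definition outer (s : pt * nat) : bool :=
  let q := prot (12 - s.2) s.1 in
  let: (h1, h2) := im24 q in let: (r1, r2) := re24 q in
  if qpos (h1 - 30, h2) || qpos (- h1 - 30, - h2) then true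
  else if qnn (r1, r2) then far s.1
  else if qnn (- r1 - 24, - r2) then far (padd s.1 (pdir s.2)) else false.

Definition unmatched (P : seq tcode) : seq (pt * nat) :=
  let S := side_codes P in
  [seq s <- S | (reverse_side s \notin S) && ~~ outer s].
Definition rot_code (m : nat) (t : tcode) : tcode :=
  let: (b, p, k) := t in (b, prot m p, addk k m).
Definition rot_orbit (t : tcode) : seq tcode := [:: t; rot_code 4 t; rot_code 8 t].
Definition compatible (t : tcode) (P : seq tcode) : bool := ~~ any (conflict t) P.

(* Patches that are invariant under the rotation of order 3 about 0 are grown by
   filling the first free side, in both possible ways, with an orbit of tiles. *)
Fixpoint explore (n : nat) (P : seq tcode) : seq (seq tcode) :=
  if n is n'.+1 then
    if unmatched P is s :: _ then
      let: (p, k) := reverse_side s in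
      flatten [seq (let new := rot_orbit (b, p, k) in
                    let Q := P ++ new in
                    if compatible (b, p, k) Q then explore n' Q else [::])
              | b <- [:: false; true]]
    else [:: P]
  else [:: P].

(** Ordered as two successive orbits of the rotation of order 3, so that patches grown from it are
    lists of consecutive orbits, as [thirds] requires. *)
Definition hex_code : seq tcode := [seq (false, (0, 0, 0, 0), j) | j <- [:: 0; 4; 8; 2; 6; 10]%N].
(** The base vertex is [- (1 + zeta ^ 2) / 3], so the triangle is centered at 0 and the three codes
    name the same tile. *)
Definition tri_code : seq tcode := rot_orbit (false, (- 4, 0, - 4, 0), 0%N).

(** A tile fills two or three of the twelve 30-degree sectors at each of its vertices, counted from
    its direction there. *)
Definition vertex_full (S : seq tcode) (v : pt) : bool :=
  let K := [seq (s.2, if s.1.1 then 3%N else 2%N) | s <- S & s.1.2 == v] in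
  all (fun k => has (fun s => ((addk k (12 - s.1) %% 12) < s.2)%N) K) (iota 0 12).
Definition complete (P : seq tcode) : bool :=
  let S := flatten [seq orbit_code t | t <- P] in
  [&& nilp (unmatched P), all (fun t => (t.2 < 12)%N) P, has (fun t => inside qnn t (0, 0, 0, 0)) P
    & all (fun v => far v || vertex_full S v) (undup [seq s.1.2 | s <- S])].

Definition patches : seq (seq tcode) :=
  Eval vm_compute in explore 20 hex_code ++ explore 20 tri_code.

Definition place (C : pt) (m : nat) (P : seq tcode) : seq tcode :=
  [seq (let: (b, p, k) := t in (b, padd C (prot m p), addk k m)) | t <- P].
Definition patch (i : nat) : seq tcode := nth [::] patches i.

(* (D, i, m) stands for the position of a copy of patch i, rotated by zeta ^ m
   about 0 and then translated by D. *)
Definition link : Type := (pt * nat * nat)%type.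
(* A neighbour D of the center 0 satisfies |D|^2 <= (7 + 4 sqrt 3) / 3, and
   [t] has to contain their midpoint, which is not tested if [phalf] rounds. *)
Definition candidate (t : tcode) (C : pt) : bool :=
  [&& C != (0, 0, 0, 0),
     (let: (a, b) := nsq576 C in ~~ qpos (a - 1344, b - 768))
   & (pscale 2 (phalf C) != C) || inside qnn t (phalf C)].
(** One tile per orbit is enough for the second patch of a link, since that patch may be rotated
    about its own center. *)
Fixpoint thirds (P : seq tcode) : seq tcode :=
  if P is t :: _ :: _ :: P' then t :: thirds P' else [::].
Definition reps : seq (seq tcode) := Eval vm_compute in map thirds patches.
(** Identifying a side [s] of [t] with the base of a tile [u] of the other patch determines the
    rotation [m] and the center [C] of that patch. *)
Definition candidates (P : seq tcode) : seq link :=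
  undup (flatten [seq flatten [seq flatten [seq
    pmap (fun u => if u.1.1 == t.1.1 then
        let m := addk s.2 (12 - u.2) in
        let C := psub s.1.2 (prot m u.1.2) in
        if candidate t C then Some (C, i, m) else None else None)
      (nth [::] reps i)
    | i <- iota 0 (size patches)] | s <- orbit_code t] | t <- P]).

Definition no_tile : tcode := (false, (0, 0, 0, 0), 0%N).
Definition conflict_at (P Q : seq tcode) (c : nat * nat) : bool :=
  conflict (nth no_tile P c.1) (nth no_tile Q c.2).
Definition find_conflict (P Q : seq tcode) : nat * nat :=
  let a := find (fun s => any (conflict s) Q) P in (a, find (conflict (nth no_tile P a)) Q).

(* The patches with squares; patch 3 is a hexagon with six squares and six
   triangles around it. *)
Definition linked : seq nat := [:: 1; 2; 3; 5; 6; 7]%N.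
(* For each candidate, the indices of two conflicting tiles of the patches around
   0 and D; they are out of range for the links that survive. *)
Definition certificates : seq (seq (link * (nat * nat))) := Eval vm_compute in
  [seq [seq (l, find_conflict (patch i) (place l.1.1 l.2 (patch l.1.2))) | l <- candidates (patch i)]
  | i <- linked].
Definition link_table : seq (seq link) := Eval vm_compute in
  [seq [seq lc.1 | lc <- L & (size (patch (nth 0 linked i)) <= lc.2.1)%N ] | '(i, L) <- zip (iota 0 6) certificates].
Definition links (i : nat) : seq link := nth [::] link_table (index i linked).
(** The certificates are not trusted: candidates are recomputed, but conflicts are tested only at
    the recorded pairs instead of being searched again. *)
Definition check_links (i : nat) : bool :=
  let L := nth [::] certificates (index i linked) in
  (map fst L == candidates (patch i)) &&
  all (fun lc : link * (nat * nat) => let: (l, c) := lc in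
     let P := patch i in let Q := place l.1.1 l.2 (patch l.1.2) in
     [|| l \in links i | [&& (c.1 < size P)%N, (c.2 < size Q)%N & conflict_at P Q c]]) L.

Definition distinct_pts (x y : pt) : bool := qpos (nsq576 (psub x y)).
(** Only pairs where the second neighbour is the first turned by 60 degrees about 0 are constrained;
    one of the two then has to be a hexagon of type 3. *)
Definition check_neighbours (i : nat) : bool :=
  all (fun l => all (fun l' => [|| distinct_pts (prot 2 l.1.1) l'.1.1, l.1.2 == 3%N | l'.1.2 == 3%N])
    (links i)) (links i).

(** Zero and the six shortest vectors of the translation lattice, which are enough to compare tiles
    so close to 0. *)
Definition hex_translations (d : pt) : seq pt :=
  (0, 0, 0, 0) :: [seq prot (2 * j) d | j <- iota 0 6].
(* Tiles around one lattice point, generating the tiling under rotations by 60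
   degrees about this point and translations by d * Z[zeta^2].  The last component
   is the power of zeta by which the hexagon [hex_code] has to be rotated. *)
Definition generators : Type := (seq tcode * pt * nat)%type.
(** As [sqrt 3 = zeta + zeta ^ 11 = 2 zeta - zeta ^ 3], the vector [(12, 24, 0, - 12)] is
    [1 + sqrt 3], and [(24, 24, 0, - 12)] below is [2 + sqrt 3]. *)
Definition gensQ : generators :=
  ([:: (false, (0, 0, 0, 0), 1%N); (true, (0, 12, 0, 0), 2%N); (false, (0, 12, 0, 0), 0%N)],
   (12, 24, 0, - 12), 1%N).
Definition gensR : generators :=
  ([:: (false, (0, 0, 0, 0), 1%N); (true, (0, 12, 0, 0), 2%N); (true, (0, 12, 12, 0), 2%N);
      (false, (0, 12, 0, 0), 0%N); (false, (12, 12, 0, 0), 0%N); (false, (0, 12, 12, 0), 0%N);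
      (false, (12, 12, 0, 0), 2%N)],
   (24, 24, 0, - 12), 1%N).
Definition gensS : generators :=
  ([:: (false, (0, 0, 0, 0), 0%N); (false, (12, 0, 0, 0), 11%N);
      (false, (12, 24, 0, - 12), 5%N); (false, (12, 12, 0, 0), 2%N);
      (true, (12, 0, 0, 0), 1%N); (true, (0, 12, 12, 0), 0%N); (true, (12, 12, 12, 0), 8%N)],
   (24, 24, 0, - 12), 0%N).
Definition hex_orbit (G : seq tcode) : seq tcode :=
  flatten [seq [seq rot_code (2 * k) g | g <- G] | k <- iota 0 6].
Definition same_mod (d : pt) (t g : tcode) : bool :=
  if t.1.1 == g.1.1 then
    any (fun r => if r.2 == t.2 then psub t.1.2 r.1.2 \in hex_translations d else false)
      (orbit_code g)
  else false.
(** [v] is [(1 - zeta ^ 4) w] for the first neighbour [w], a generator of the translation lattice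
    over Z[zeta^2]; after the rotation by [zeta ^ s] it has to be [d] up to a unit. The two
    inclusions modulo this lattice are then tested. *)
Definition generates (l l' : link) (X : generators) : bool :=
  let: (G, d, s) := X in
  let F := map (rot_code s) (patch 3 ++ place l.1.1 l.2 (patch l.1.2) ++ place l'.1.1 l'.2 (patch l'.1.2)) in
  let H := hex_orbit G in
  let v := psub l.1.1 (prot 4 l.1.1) in
  if any (fun j => prot s v == prot (2 * j) d) (iota 0 6) then
    if every (fun t => any (same_mod d t) H) F then every (fun g => any (fun t => same_mod d t g) F) H
    else false
  else false.
Definition check_tilings : bool :=
  every (fun l => every (fun l' => if distinct_pts (prot 2 l.1.1) l'.1.1 then true
     else any (generates l l') [:: gensQ; gensR; gensS]) (links 3)) (links 3).

Lemma patchesE : explore 20 hex_code ++ explore 20 tri_code = patches.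
Proof. by vm_compute. Qed.
(** This also shows that the fuel 20 suffices: a patch with a free side left would fail. *)
Lemma patches_complete : all complete patches. Proof. by vm_compute. Qed.
Lemma links_checked : all check_links linked. Proof. by vm_compute. Qed.
Lemma neighbours_checked : all check_neighbours [:: 1; 2; 5; 6; 7]%N. Proof. by vm_compute. Qed.
Lemma tilings_checked : check_tilings. Proof. by vm_compute. Qed.
End Coordinates.
Arguments rot_orbit : simpl never.

(** * Soundness of the integer computations *)

Section CodedTiles.
Variable R : realType.
Local Notation C := (plane R).
Local Notation Re := (@complex.Re R).
Local Notation Im := (@complex.Im R).
Local Notation s3 := (s3 R).
Local Notation zeta := (zeta R).
Implicit Types (x y z : pt) (t : tcode) (P : seq tcode).

Definition zr (n : Z) : R := (int_of_Z n)%:~R.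

Arguments zr : simpl never.

Lemma int_of_ZD m n : int_of_Z (Z.add m n) = int_of_Z m + int_of_Z n.
Proof. lia. Qed.
Lemma int_of_ZM m n : int_of_Z (Z.mul m n) = int_of_Z m * int_of_Z n.
Proof. lia. Qed.
Lemma int_of_ZN m : int_of_Z (Z.opp m) = - int_of_Z m.
Proof. lia. Qed.
Lemma zrD (m n : Z) : zr (Z.add m n) = zr m + zr n. Proof. by rewrite /zr int_of_ZD intrD. Qed.
Lemma zrM m n : zr (Z.mul m n) = zr m * zr n. Proof. by rewrite /zr int_of_ZM intrM. Qed.
Lemma zrN m : zr (Z.opp m) = - zr m. Proof. by rewrite /zr int_of_ZN intrN. Qed.
Lemma zrB m n : zr (Z.sub m n) = zr m - zr n. Proof. by exact: etrans (zrD _ _) (congr1 _ (zrN _)). Qed.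
Lemma zr_pos (p : positive) : zr (Zpos p) = (Pos.to_nat p)%:R. Proof. by []. Qed.
Lemma zr_le m n : Z.leb m n = (zr m <= zr n).
Proof. by rewrite /zr ler_int; lia. Qed.
Lemma zr_lt m n : Z.ltb m n = (zr m < zr n).
Proof. by rewrite /zr ltr_int; lia. Qed.
Definition zrE := (zrD, zrM, zrN, zrB, zr_pos).

Definition qval (x : Z * Z) : R := zr x.1 + zr x.2 * s3.

Lemma qvalE (a b : Z) : qval (a, b) = zr a + zr b * s3. Proof. by []. Qed.

(** When the two terms have opposite signs, the sign of [a - b sqrt 3] is known, and
    [a ^ 2 - 3 b ^ 2] decides that of the other factor. *)
Lemma qposE (q : Z * Z) : qpos q = (0 < qval q).
Proof.
case: q => a b; rewrite /qpos /qval !(zr_le, zr_lt) !(zrM, zrD) [(a, b).1]/= [(a, b).2]/=.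
have -> : zr Z0 = 0 by []. have -> : zr (Zpos 3) = 3 by [].
have h3 := s3M R; have h0 := s3_gt0 R; move: (zr a) (zr b) => {}a {}b.
have hm : (a - b * s3) * (a + b * s3) = a * a - 3 * (b * b) by rewrite -h3; ring.
case: (leP 0 a) => ha; first case: (leP 0 b) => hb.
- case: (ltP 0 a) => ha' /=; first by symmetry; nra.
  have -> : a = 0 by lra.
  by rewrite add0r pmulr_lgt0.
- have hp : 0 < a - b * s3 by nra.
  by rewrite -subr_gt0 -hm pmulr_rgt0.
case: (ltP 0 b) => hb /=; last by symmetry; apply/negbTE; rewrite -leNgt; nra.
have hp : 0 < b * s3 - a by nra.
rewrite -subr_gt0; have -> : 3 * (b * b) - a * a = (b * s3 - a) * (a + b * s3) by nra.
by rewrite pmulr_rgt0.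
Qed.

Lemma qnnE (q : Z * Z) : qnn q = (0 <= qval q).
Proof.
rewrite /qnn qposE -leNgt /qneg /qval /= !zrN; set u := zr _; set v := zr _.
by apply/idP/idP; lra.
Qed.

Definition ev (x : pt) : C :=
  Complex (qval (re24 x) / 24) (qval (im24 x) / 24).

Lemma ev_re a b c d : Re (ev (a, b, c, d)) = (2 * zr a + zr c + zr b * s3) / 24.
Proof.
have -> : Re (ev (a, b, c, d)) = (zr (Z.add (Z.mul (Zpos 2) a) c) + zr b * s3) / 24 by [].
by rewrite zrD zrM.
Qed.
Lemma ev_im a b c d : Im (ev (a, b, c, d)) = (zr b + 2 * zr d + zr c * s3) / 24.
Proof.
have -> : Im (ev (a, b, c, d)) = (zr (Z.add b (Z.mul (Zpos 2) d)) + zr c * s3) / 24 by [].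
by rewrite zrD zrM.
Qed.
Definition evE := (ev_re, ev_im).

Lemma evD x y : ev (padd x y) = ev x + ev y.
Proof.
case: x => [[[a b] c] d]; case: y => [[[a' b'] c'] d'].
by apply: plane_ext; rewrite ?(reD, imD) !evE !zrE /=; ring.
Qed.
Lemma evN x : ev (popp x) = - ev x.
Proof.
by case: x => [[[a b] c] d]; apply: plane_ext; rewrite ?(reN, imN) !evE !zrE /=; ring.
Qed.
Lemma evB x y : ev (psub x y) = ev x - ev y. Proof. by rewrite evD evN. Qed.
Lemma ev_zeta x : ev (pzeta x) = zeta * ev x.
Proof.
have h3 := s3M R.
case: x => [[[a b] c] d]; apply: plane_ext; rewrite ?(reM, imM) !evE !zrE [Re zeta]/= [Im zeta]/=;
  move: (zr a) (zr b) (zr c) (zr d) => {}a {}b {}c {}d.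
- have e : b * (s3 * s3) = b * 3 by rewrite h3.
  by lra.
- have e : c * (s3 * s3) = c * 3 by rewrite h3.
  by lra.
Qed.
Lemma ev_rot k x : ev (prot k x) = zeta ^+ k * ev x.
Proof. by elim: k => [|k IH]; rewrite ?mul1r // exprS -mulrA -IH -ev_zeta. Qed.
Lemma ev_dir k : ev (pdir k) = zeta ^+ k.
Proof.
rewrite ev_rot -[RHS]mulr1; congr (_ * _).
by apply: plane_ext; rewrite !evE; change (zr Z0) with (0 : R); change (zr (Zpos 12)) with (12 : R); rewrite /=; lra.
Qed.
Lemma ev0 : ev (Z0, Z0, Z0, Z0) = 0.
Proof. by apply: plane_ext; rewrite !evE; change (zr Z0) with (0 : R); rewrite /=; lra. Qed.

Lemma nsq_ev x : nsq (ev x) = qval (nsq576 x) / 576.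
Proof.
have h3 := s3M R; case: x => [[[a b] c] d].
pose r := Z.add (Z.mul (Zpos 2) a) c; pose i := Z.add b (Z.mul (Zpos 2) d).
have -> : qval (nsq576 (a, b, c, d)) =
  zr (Z.add (Z.add (Z.add (Z.mul r r) (Z.mul (Zpos 3) (Z.mul b b))) (Z.mul i i)) (Z.mul (Zpos 3) (Z.mul c c)))
  + zr (Z.mul (Zpos 2) (Z.add (Z.mul r b) (Z.mul i c))) * s3 by [].
rewrite /nsq !evE /r /i !zrE; change (Pos.to_nat 2)%:R with (2 : R); change (Pos.to_nat 3)%:R with (3 : R).
move: (zr a) (zr b) (zr c) (zr d) => {r i} {}a {}b {}c {}d.
have e : (b * b + c * c) * (s3 * s3) = (b * b + c * c) * 3 by rewrite h3.
by lra.
Qed.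

Lemma ev_half x : pscale 2 (phalf x) = x -> ev x = ev (phalf x) + ev (phalf x).
Proof.
move=> {1}<-; rewrite -evD; case: (phalf x) => [[[a b] c] d].
by rewrite /pscale /padd; congr (ev (_, _, _, _)); lia.
Qed.

Definition tset t : set C := tile t.1.1 (ev t.1.2) (zeta ^+ t.2).

Lemma nsq_zetaX k : nsq (zeta ^+ k) = 1.
Proof. by elim: k => [|k IH]; [rewrite /nsq /=; lra|rewrite exprS nsqM IH nsq_zeta mulr1]. Qed.

Lemma zeta_addk k j : zeta ^+ addk k j = zeta ^+ (k + j).
Proof.
rewrite /addk; case: ifPn => // h.
by rewrite -[in RHS](subnK (_ : 12 <= k + j)%N) ?exprD ?zeta12 ?mulr1 // leqNgt.
Qed.

Lemma zeta_mod k : zeta ^+ (k %% 12) = zeta ^+ k.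
Proof. by rewrite [in RHS](divn_eq k 12) exprD mulnC exprM zeta12 expr1n mul1r. Qed.

Lemma ltn_addk k j : (k < 12)%N -> (j <= 12)%N -> (addk k j < 12)%N.
Proof. by rewrite /addk; case: ifPn => //; lia. Qed.

Lemma inside0E b (z : pt) : (inside0 qnn b z <-> tile b 0 1 (ev z)) /\
  (inside0 qpos b z <-> stile b 0 1 (ev z)).
Proof.
case: z => [[[a' b'] c] d].
pose r1 := Z.add (Z.mul (Zpos 2) a') c; pose i1 := Z.add b' (Z.mul (Zpos 2) d).
have er : Re (ev (a', b', c, d)) = (zr r1 + zr b' * s3) / 24 by [].
have ei : Im (ev (a', b', c, d)) = (zr i1 + zr c * s3) / 24 by [].
have e24 : zr (Zpos 24) = 24 by [].
have e3 : zr (Zneg 3) = - 3 by [].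
have h3 := s3M R.
have q1 : qval (Z.sub (Zpos 24) r1, Z.opp b') = 24 * (1 - Re (ev (a', b', c, d))).
  by rewrite er /qval zrB zrN e24; lra.
have q2 : qval (Z.sub (Zpos 24) i1, Z.opp c) = 24 * (1 - Im (ev (a', b', c, d))).
  by rewrite ei /qval zrB zrN e24; lra.
have q3 : qval (r1, b') = 24 * Re (ev (a', b', c, d)) by rewrite er /qval /=; lra.
have q4 : qval (i1, c) = 24 * Im (ev (a', b', c, d)) by rewrite ei /qval /=; lra.
have q5 : qval (Z.sub (Z.mul (Zneg 3) b') i1, Z.sub (Z.sub (Zpos 24) r1) c) =
    24 * (s3 * (1 - Re (ev (a', b', c, d))) - Im (ev (a', b', c, d))).
  rewrite er ei qvalE !zrB zrM e24 e3.
  have e : zr b' * (s3 * s3) = zr b' * 3 by rewrite h3.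
  by lra.
have q6 : qval (Z.sub (Z.mul (Zpos 3) b') i1, Z.sub r1 c) =
    24 * (s3 * Re (ev (a', b', c, d)) - Im (ev (a', b', c, d))).
  rewrite er ei qvalE !zrB zrM; change (zr (Zpos 3)) with (3 : R).
  have e : zr b' * (s3 * s3) = zr b' * 3 by rewrite h3.
  by lra.
rewrite /inside0 /re24 /im24 -/r1 -/i1 !qnnE !qposE q1 q2 q3 q4 q5 q6.
split; case: b.
- rewrite std_sq; split; last by move=> [g1 g2 g3 g4]; do 3!(rewrite ifT; last by lra); lra.
  by case: ifP => // g1; case: ifP => // g2; case: ifP => // g3 g4; split; lra.
- rewrite std_tri; split; last by move=> [g1 g2 g3]; do 2!(rewrite ifT; last by lra); lra.
  by case: ifP => // g1; case: ifP => // g2 g3; split; lra.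
- rewrite std_ssq; split; last by move=> [g1 g2 g3 g4]; do 3!(rewrite ifT; last by lra); lra.
  by case: ifP => // g1; case: ifP => // g2; case: ifP => // g3 g4; split; lra.
- rewrite std_stri; split; last by move=> [g1 g2 g3]; do 2!(rewrite ifT; last by lra); lra.
  by case: ifP => // g1; case: ifP => // g2 g3; split; lra.
Qed.

Lemma zeta_inv k : (k <= 12)%N -> zeta ^+ k * zeta ^+ (12 - k) = 1.
Proof. by move=> h; rewrite -exprD subnKC // zeta12. Qed.

Lemma ev_relative p x k : (k <= 12)%N ->
  ev x = ev p + zeta ^+ k * ev (prot (12 - k) (psub x p)).
Proof. by move=> h; rewrite ev_rot mulrA zeta_inv // mul1r evB addrBC. Qed.

Lemma insideE t x : (t.2 < 12)%N -> (inside qnn t x <-> tset t (ev x)) /\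
  (inside qpos t x <-> stile t.1.1 (ev t.1.2) (zeta ^+ t.2) (ev x)).
Proof.
case: t => [[b p] k] /= /ltnW hk; rewrite /tset /= (ev_relative p x hk).
rewrite tile_std ?nsq_zetaX // stile_std ?nsq_zetaX //; exact: inside0E.
Qed.

Lemma iter_next_code t j :
  [/\ (iter j next_code t).1.1 = t.1.1,
      (ev (iter j next_code t).1.2, zeta ^+ (iter j next_code t).2) =
        side t.1.1 (ev t.1.2) (zeta ^+ t.2) j
    & (t.2 < 12)%N -> ((iter j next_code t).2 < 12)%N].
Proof.
elim: j => [//|j [IH1 IH2 IH3]]; rewrite /side !iterS -/(side _ _ _ _) -IH2.
move: IH1 IH3; case: (iter j next_code t) => [[b p] k] /= -> IH3; split => //.
  rewrite /next_side /= evD ev_dir zeta_addk exprD; congr (_, _ * _).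
  by rewrite wtE; case: (t.1.1).
by move=> /IH3 hk; apply: ltn_addk => //; case: (t.1.1).
Qed.

Lemma orbit_codeE t : orbit_code t = traject next_code t (nsides t.1.1).
Proof. by rewrite /orbit_code; case: (t.1.1). Qed.

Lemma orbit_codeP t s : s \in orbit_code t -> exists j, s = iter j next_code t.
Proof. by rewrite orbit_codeE => /trajectP[j _ ->]; exists j. Qed.

Lemma iter_in_orbit t j : (j < nsides t.1.1)%N -> iter j next_code t \in orbit_code t.
Proof. by move=> h; rewrite orbit_codeE; apply/trajectP; exists j. Qed.

Lemma tset_iter t j : tset (iter j next_code t) = tset t.
Proof.
have [e1 e2 _] := iter_next_code t j; rewrite /tset e1.
by have := tile_side t.1.1 (ev t.1.2) (zeta ^+ t.2) j; rewrite -e2.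
Qed.

Lemma tset_orbit t s : s \in orbit_code t -> tset s = tset t.
Proof. by move/orbit_codeP => [j ->]; apply: tset_iter. Qed.

Lemma probe_inside b k : (k < 12)%N -> {in probes b k, forall v,
  stile b 0 (zeta ^+ k) (ev v)}.
Proof.
have : all (fun b => all (fun k => all (inside qpos (b, (Z0, Z0, Z0, Z0), k)) (probes b k)) (iota 0 12))
  [:: false; true] by vm_compute.
move=> /allP/(_ b); have -> : b \in [:: false; true] by case: b.
move=> /(_ isT)/allP/(_ k) h hk; move: h; rewrite mem_iota /= => /(_ hk)/allP h v /h.
by have [_ ->] := @insideE (b, (Z0, Z0, Z0, Z0), k) v hk; rewrite ev0.
Qed.

Lemma half_overlapP s t : (s.2 < 12)%N -> (t.2 < 12)%N -> half_overlap s t ->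
  exists x : C, stile s.1.1 (ev s.1.2) (zeta ^+ s.2) x /\ stile t.1.1 (ev t.1.2) (zeta ^+ t.2) x.
Proof.
case: s => [[b p] k]; case: t => [[b' p'] k'] hk hk'.
rewrite /half_overlap anyE => /hasP[v hv] hs /=.
have hj : (addk k' (12 - k) < 12)%N by apply: ltn_addk; rewrite ?leq_subr.
exists (ev p + zeta ^+ k * ev (padd (prot (12 - k) (psub p' p)) v)); split.
  by rewrite stile_std ?nsq_zetaX //; apply: (inside0E _ _).2.1.
rewrite evD mulrDr addrA -ev_relative ?(ltnW hk) //.
have := probe_inside hj hv; rewrite zeta_addk.
have -> : zeta ^+ k' = zeta ^+ k * zeta ^+ (k' + (12 - k)).
  by rewrite -exprD addnCA subnKC ?(ltnW hk) // exprD zeta12 mulr1.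
have := stile_frame b' (ev p') 0 (zeta ^+ (k' + (12 - k))) (ev v) (nsq_zetaX k).
by rewrite mulr0 addr0 => ->.
Qed.

(** A common interior point makes the two tiles equal as sets, and then no vertex of one can lie
    outside the other. *)
Lemma conflictP (T : set (set C)) s t : good T -> T (tset s) -> T (tset t) -> conflict s t -> False.
Proof.
move=> [_ _ disj _] hs ht; rewrite /conflict.
case: ifP => // /andP[ws wt']; case: ifP => // _; case: ifP => // ho hd.
have [x [xs xt]] : exists x : C, stile s.1.1 (ev s.1.2) (zeta ^+ s.2) x /\
    stile t.1.1 (ev t.1.2) (zeta ^+ t.2) x.
  move: ho; rewrite /overlap; case: ifP => [/(half_overlapP ws wt')//|_ /(half_overlapP wt' ws)].
  by move=> [x []]; exists x.
have e : tset s = tset t := disj _ _ _ _ _ _ _ (nsq_zetaX _) (nsq_zetaX _) hs ht xs xt.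
have vertex a b' : b' \in orbit_code a -> tset a (ev b'.1.2).
  move=> h; rewrite -(tset_orbit h) /tset.
  by have [h1 _] := extreme_base b'.1.1 (ev b'.1.2) (nsq_zetaX b'.2).
case/orP: hd => /hasP[v hv /negP]; case.
  by apply/(insideE _ ws).1; rewrite e; apply: vertex.
by apply/(insideE _ wt').1; rewrite -e; apply: vertex.
Qed.

End CodedTiles.
Arguments ev : simpl never.

(** * Soundness of the growth of patches; directions at a point *)

Section Patches.
Variable R : realType.
Local Notation C := (plane R).
Local Notation Re := (@complex.Re R).
Local Notation Im := (@complex.Im R).
Local Notation s3 := (s3 R).
Local Notation zeta := (zeta R).
Local Notation ev := (@ev R).
Local Notation tset := (@tset R).
Local Notation re r := (Complex r 0 : C).
Implicit Types (x y z p u d c : C) (b : bool) (s t : tcode) (P : seq tcode) (T : set (set C)).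

(** One implication is enough, as two more applications give the inverse rotation. *)
Definition rotinv T c := forall b p u, nsq u = 1 -> T (tile b p u) ->
  T (tile b (c + zeta ^+ 4 * (p - c)) (zeta ^+ 4 * u)).
Definition sub_tiling T P := forall t, t \in P -> T (tset t).

Lemma tset_rot m t : tset (rot_code m t) = tile t.1.1 (zeta ^+ m * ev t.1.2) (zeta ^+ m * zeta ^+ t.2).
Proof. by case: t => [[b p] k]; rewrite /tset /= ev_rot zeta_addk addnC exprD. Qed.

Lemma rotinv0 T b p u n : rotinv T 0 -> nsq u = 1 -> T (tile b p u) ->
  T (tile b (zeta ^+ (4 * n) * p) (zeta ^+ (4 * n) * u)).
Proof.
move=> h hu hT; elim: n => [|n IH]; first by rewrite muln0 !mul1r.
have := h _ _ _ _ IH; rewrite add0r subr0 !mulrA -exprD -mulnS; apply.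
by rewrite nsqM nsq_zetaX hu mulr1.
Qed.

Lemma rot_orbitP T t : rotinv T 0 -> T (tset t) -> sub_tiling T (rot_orbit t).
Proof.
move=> hr hT s; rewrite !inE => /or3P[] /eqP-> //; rewrite tset_rot.
  exact: (rotinv0 1 hr (nsq_zetaX R _) hT).
exact: (rotinv0 2 hr (nsq_zetaX R _) hT).
Qed.

Lemma side_codesP P v : v \in side_codes P ->
  exists t s, [/\ t \in P, s \in orbit_code t & v = (s.1.2, s.2)].
Proof. by move=> /flattenP[l /mapP[t ht ->]] /mapP[s hs ->]; exists t, s. Qed.

(** Across a free side, [T] has a tile of one of the two shapes, together with its orbit; tiles of
    [T] never conflict, so this branch is not pruned. *)
Lemma explore_sound T n P : good T -> rotinv T 0 -> sub_tiling T P ->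
  exists2 P', P' \in explore n P & sub_tiling T P'.
Proof.
move=> gT hr; elim: n P => [|n IH] P hP /=; first by exists P; rewrite ?inE.
case eU: (unmatched P) => [|s l]; first by exists P; rewrite ?inE.
have : s \in unmatched P by rewrite eU inE eqxx.
rewrite mem_filter => /andP[_ /side_codesP[t [v [htP hv es]]]].
have hT : T (tset v) by rewrite (tset_orbit R hv); apply: hP.
case: (gT) => _ _ _ edge; have [b hb] := edge _ _ _ (nsq_zetaX R _) hT.
rewrite -[padd s.1 _]/(reverse_side s).1 -[addk s.2 6]/(reverse_side s).2.
case er: (reverse_side s) => [p k] /=.
have {}hb : T (tset (b, p, k)).
  move: er; rewrite es /reverse_side /= => -[<- <-].
  by rewrite /tset /= evD ev_dir zeta_addk exprD zeta6 mulrN1.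
have hQ : sub_tiling T (P ++ rot_orbit (b, p, k)).
  by move=> q; rewrite mem_cat => /orP[/hP//|]; apply: rot_orbitP.
have hcomp : compatible (b, p, k) (P ++ rot_orbit (b, p, k)).
  rewrite /compatible anyE; apply/negP => /hasP[q hq].
  by apply: conflictP gT hb (hQ _ hq).
have [P' hP' hsub] := IH _ hQ; exists P' => //.
rewrite !mem_cat.
by case: b hb hQ hcomp hP' => _ _ -> ->; rewrite ?orbT.
Qed.

Lemma first_sign_change (f : nat -> R) k n : 0 <= f k -> f (k + n.+1)%N <= 0 ->
  exists2 j, (k <= j <= k + n)%N & 0 <= f j /\ f j.+1 <= 0.
Proof.
elim: n k => [|n IH] k h0 h1; first by exists k; rewrite ?addn0 ?leqnn // -addn1.
have [le|lt] := leP (f k.+1) 0; first by exists k; rewrite ?leqnn ?leq_addr.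
have [|j hj h] := IH k.+1 (ltW lt); first by rewrite addSn -addnS.
by exists j => //; lia.
Qed.

(** The signed distances [f k] of [d] to the lines directed by [zeta ^ k] satisfy
    [f (k + 6) = - f k], so they pass from nonnegative to nonpositive between two consecutive
    directions, which enclose [d]. *)
Lemma sector d : exists (k : nat) (a b : R), [/\ (k < 12)%N, 0 <= a, 0 <= b &
  d = zeta ^+ k * (re a + re b * zeta)].
Proof.
pose f k := left 0 (zeta ^+ k) d.
have f6 k : f (k + 6)%N = - f k by rewrite /f exprD zeta6 /left ?reimE; ring.
have [k hk [h0 h1]] : exists2 k, (k < 12)%N & 0 <= f k /\ f k.+1 <= 0.
  have [h|h] := leP 0 (f 0%N).
    have [|k hk hf] := @first_sign_change f 0 5 h; first by rewrite (f6 0%N) oppr_le0.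
    by exists k => //; lia.
  have [||k hk hf] := @first_sign_change f 6 5; rewrite ?(f6 6%N) ?(f6 0%N); [lra|lra|].
  by exists k => //; lia.
have [z ez] := frame_ex 0 d (nsq_zetaX R k); rewrite add0r in ez.
have fk : f k = Im z.
  have left0 w z' : left 0 w (w * z') = nsq w * Im z' by rewrite /left /nsq ?reimE; ring.
  by rewrite /f ez left0 nsq_zetaX mul1r.
have fk1 : f k.+1 = (s3 * Im z - Re z) / 2.
  have left1 w z' : left 0 (w * zeta) (w * z') = nsq w * ((s3 * Im z' - Re z') / 2).
    by rewrite /left /nsq ?reimE /=; lra.
  by rewrite /f ez exprSr left1 nsq_zetaX mul1r.
exists k, (Re z - s3 * Im z), (2 * Im z); split => //; [lra|lra|].
by rewrite ez; congr (_ * _); apply: plane_ext; rewrite ?reimE /=; lra.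
Qed.

(* From a point [z] of the base side of a standard tile one can move inside the
   tile in any upward direction, and from its base vertex in any direction of
   the angle there. *)
Lemma inward_side b (r : R) d : 0 < r < 1 -> 0 <= Im d ->
  exists2 eps : R, 0 < eps & tile b 0 1 (re r + re eps * d).
Proof.
move=> /andP[r0 r1] hd; have hs := s3_bounds R.
(* With [eps = m / (4 * M)], no coordinate moves by more than a quarter of the distance to the
   nearer end of the side. *)
pose M := 1 + `|Re d| + Im d; pose m := Num.min r (1 - r).
have M1 : 1 <= M by rewrite /M; have := normr_ge0 (Re d); lra.
have M0 : 0 < M by lra.
have m0 : 0 < m by rewrite lt_min r0; lra.
have mr : m <= r by rewrite ge_min lexx.
have mr1 : m <= 1 - r by rewrite ge_min lexx orbT.
have e0 : 0 < m / (4 * M) by rewrite divr_gt0 //; lra.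
exists (m / (4 * M)) => //.
have eM : m / (4 * M) * M = m / 4 by field; lra.
set eps := m / (4 * M) in e0 eM *.
have [h1 h2] : - (m / 4) <= eps * Re d <= m / 4 /\ eps * Im d <= m / 4.
  rewrite -eM /M; have := ler_norm (Re d); have := ler_norm (- Re d); rewrite normrN => h1 h2.
  by split; [apply/andP; split|]; nra.
have h3 : 0 <= eps * Im d by apply: mulr_ge0 => //; lra.
case: b; [apply/std_sq|apply/std_tri]; rewrite ?reimE /= !mul0r; split; try lra.
  by nra.
by nra.
Qed.

Lemma inward_vertex b k (a c : R) : (k < if b then 3 else 2)%N -> 0 <= a -> 0 <= c ->
  exists2 eps : R, 0 < eps & tile b 0 1 (re eps * (zeta ^+ k * (re a + re c * zeta))).
Proof.
move=> hk a0 c0; have hs := s3_bounds R; have h3 := s3M R.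
pose M := 4 + 4 * a + 4 * c; have M0 : 0 < M by rewrite /M; lra.
exists M^-1; first by rewrite invr_gt0.
have e0 : 0 < M^-1 by rewrite invr_gt0.
have eM : M^-1 * M = 1 by rewrite mulVf // gt_eqF.
move: e0 eM; rewrite /M; move: (M^-1) => e e0 eM.
have ea : 0 <= e * a by nra.
have ec : 0 <= e * c by nra.
have h : 4 * e + 4 * (e * a) + 4 * (e * c) = 1 by apply: etrans eM; ring.
have -> : re e * (zeta ^+ k * (re a + re c * zeta)) = zeta ^+ k * (re (e * a) + re (e * c) * zeta).
  by rewrite mulrCA; congr (_ * _); apply: plane_ext; rewrite ?reimE /=; ring.
move: (e * a) (e * c) ea ec h => A B A0 B0 h.
have sA : 0 <= s3 * A <= 174 / 100 * A by apply/andP; split; nra.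
have sB : 0 <= s3 * B <= 174 / 100 * B by apply/andP; split; nra.
have ssA : s3 * (s3 * A) = 3 * A by rewrite mulrA h3.
have ssB : s3 * (s3 * B) = 3 * B by rewrite mulrA h3.
have sssA : s3 * (s3 * (s3 * A)) = 3 * (s3 * A) by rewrite mulrA h3.
have sssB : s3 * (s3 * (s3 * B)) = 3 * (s3 * B) by rewrite mulrA h3.
case: b hk => hk; [apply/std_sq|apply/std_tri].
  case: k hk => [|[|[|//]]] _; rewrite ?zeta2 ?expr1 ?expr0 ?reimE /=; split; lra.
by case: k hk => [|[|//]] _; rewrite ?expr1 ?expr0 ?reimE /=; split; lra.
Qed.

End Patches.

(** * A complete patch covers the disc of radius 5/4 *)

Section Covering.
Variable R : realType.
Local Notation C := (plane R).
Local Notation Re := (@complex.Re R).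
Local Notation Im := (@complex.Im R).
Local Notation zeta := (zeta R).
Local Notation ev := (@ev R).
Local Notation tset := (@tset R).
Local Notation re r := (Complex r 0 : C).
Implicit Types (x y z u d c : C) (b : bool) (s t : tcode) (P : seq tcode).

Lemma farP (p : pt) : far p -> 25 / 16 < nsq (ev p).
Proof.
rewrite /far nsq_ev; case: (nsq576 p) => a b; rewrite (qposE R) !qvalE zrB.
by change (zr R (Zpos 900)) with (900 : R); lra.
Qed.

(** The side is turned to be horizontal, from [q] to [q + 1]. Either its line is more than
    [5 / 4 = 30 / 24] away from 0, or the end of the side nearest to 0 is a far vertex. *)
Lemma outerP (p : pt) k (r : R) : (k < 12)%N -> outer (p, k) -> 0 <= r <= 1 ->
  25 / 16 < nsq (ev p + zeta ^+ k * re r).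
Proof.
move=> hk ho hr; have wk := ltnW hk.
set q := prot (12 - k) p; have ep : ev p = zeta ^+ k * ev q.
  by rewrite /q ev_rot mulrA zeta_inv // mul1r.
have hq : nsq (ev q) = nsq (ev p) by rewrite ep nsqM nsq_zetaX mul1r.
have hq1 : nsq (ev q + 1) = nsq (ev (padd p (pdir k))).
  by rewrite evD ev_dir ep -[LHS]mul1r -(nsq_zetaX R k) -nsqM mulrDr mulr1.
rewrite ep -mulrDr nsqM nsq_zetaX mul1r.
move: ho; rewrite /outer -/q.
have er : Re (ev q) = qval R (re24 q) / 24 by [].
have ei : Im (ev q) = qval R (im24 q) / 24 by [].
move: (ev q) hq hq1 er ei => z hq hq1 er ei.
case: (re24 q) er => r1 r2 er; case: (im24 q) ei => i1 i2 ei.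
rewrite !(qposE R) !(qnnE R) !qvalE ?zrB ?zrN.
change (zr R (Zpos 30)) with (30 : R); change (zr R (Zpos 24)) with (24 : R).
move: er ei; rewrite !qvalE => er ei.
case: ifPn => [/orP h _|_].
  have {}h : 25 / 16 < Im z * Im z.
    case: h => h; first by (have {}h : 5 / 4 < Im z by rewrite ei; lra); move: h; clear; nra.
    by (have {}h : Im z < - (5 / 4) by rewrite ei; lra); move: h; clear; nra.
  rewrite /nsq ?reimE /= addr0; have := sqr_ge0 (Re z + r); rewrite expr2.
  by move: h; clear; lra.
move: hr => /andP[r0 r1'].
case: ifPn => [h /farP|_].
  have hR : 0 <= Re z by rewrite er; lra.
  have : 0 <= r * (2 * Re z + r) by apply: mulr_ge0; lra.
  by rewrite -hq /nsq ?reimE /= addr0; clear; lra.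
case: ifPn => [h /farP|_ //].
have hR : Re z <= - 1 by rewrite er; lra.
have : 0 <= (1 - r) * (- (2 * Re z + 1 + r)) by apply: mulr_ge0; lra.
by rewrite -hq1 /nsq ?reimE /= !addr0; clear; lra.
Qed.

Lemma completeP P : complete P -> [/\
  forall t s, t \in P -> s \in orbit_code t -> ~~ outer (s.1.2, s.2) ->
    exists t' s', [/\ t' \in P, s' \in orbit_code t', s'.1.2 = padd s.1.2 (pdir s.2) & s'.2 = addk s.2 6],
  forall t, t \in P -> (t.2 < 12)%N,
  exists2 t, t \in P & tset t 0
  & forall t s k, t \in P -> s \in orbit_code t -> ~~ far s.1.2 -> (k < 12)%N ->
    exists t' s', [/\ t' \in P, s' \in orbit_code t', s'.1.2 = s.1.2 &
      (addk k (12 - s'.2) %% 12 < if s'.1.1 then 3 else 2)%N]].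
Proof.
move=> /and4P[/nilP hu /allP wf /hasP[t0 ht0 hi] /allP hv]; split.
- move=> t s ht hs ho.
  have hS : (s.1.2, s.2) \in side_codes P.
    by apply/flattenP; exists [seq (s.1.2, s.2) | s <- orbit_code t]; apply/mapP; [exists t|exists s].
  have : (s.1.2, s.2) \notin unmatched P by rewrite hu.
  rewrite mem_filter hS ho !andbT negbK => /side_codesP[t' [s' [ht' hs' [e1 e2]]]].
  by exists t', s'.
- exact: wf.
- by exists t0 => //; rewrite -(ev0 R); apply/(insideE R _ (wf _ ht0)).1.
- move=> t s k ht hs hf hk.
  have : s.1.2 \in undup [seq s.1.2 | s <- flatten [seq orbit_code t | t <- P]].
    rewrite mem_undup; apply/mapP; exists s => //; apply/flattenP.
    by exists (orbit_code t) => //; apply/mapP; exists t.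
  move/hv; rewrite (negbTE hf) /= => /allP /(_ k); rewrite mem_iota => /(_ hk).
  move=> /hasP[a /mapP[s' hs' ->]] /= h.
  move: hs'; rewrite mem_filter => /andP[/eqP e /flattenP[l /mapP[t' ht' ->] hs']].
  by exists t', s'.
Qed.

Lemma tset_vertex s (d : C) k (a c : R) : (s.2 < 12)%N -> (k < 12)%N -> 0 <= a -> 0 <= c ->
  d = zeta ^+ k * (re a + re c * zeta) ->
  (addk k (12 - s.2) %% 12 < if s.1.1 then 3 else 2)%N ->
  tset s (ev s.1.2) /\ exists2 eps : R, 0 < eps & tset s (ev s.1.2 + re eps * d).
Proof.
move=> hs hk a0 c0 -> hm; split.
  exact: (extreme_base _ _ (nsq_zetaX R _)).1.
have [eps e0 he] := inward_vertex hm a0 c0; exists eps => //.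
have -> : re eps * (zeta ^+ k * (re a + re c * zeta)) =
   zeta ^+ s.2 * (re eps * (zeta ^+ (addk k (12 - s.2) %% 12) * (re a + re c * zeta))).
  rewrite [RHS]mulrCA; congr (_ * _); rewrite mulrA zeta_mod zeta_addk -exprD addnCA subnKC ?(ltnW hs) //.
  by rewrite exprD zeta12 mulr1.
by rewrite /tset tile_std ?nsq_zetaX.
Qed.

(** If [y] is interior to its tile, any direction is possible; at a vertex, some tile of [P] fills
    the sector of [d]; inside a side, [d] points into the tile or into the one across. The bound on
    [y] excludes far vertices and outer sides, where tiles may be missing. *)
Lemma progress P t y d : complete P -> t \in P -> tset t y -> nsq y <= 25 / 16 ->
  exists t', [/\ t' \in P, tset t' y & exists2 eps : R, 0 < eps & tset t' (y + re eps * d)].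
Proof.
move=> /completeP[matched wf _ full] ht hy hn.
have wfo t1 s1 : t1 \in P -> s1 \in orbit_code t1 -> (s1.2 < 12)%N.
  by move=> h1 /orbit_codeP[j ->]; have [_ _] := iter_next_code R t1 j; apply; apply: wf.
have [hs|] := pselect (stile t.1.1 (ev t.1.2) (zeta ^+ t.2) y).
  exists t; split => //; have [e e0 he] := in_stile (nsq_zetaX R _) hs.
  have hd := nsq_ge0 d; pose M := 1 + e + nsq d.
  have M0 : 0 < M by rewrite /M; lra.
  have f0 : 0 < e / M by rewrite divr_gt0.
  exists (e / M) => //; apply/stile_tile/he.
  rewrite addrC addKr nsqM {1}/nsq /= mul0r addr0.
  have fM : e / M * M = e by rewrite divfK // gt_eqF.
  move: f0 fM; rewrite /M; move: (e / _) => f f0 fM; nra.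
move=> /existsNP[j /negP]; rewrite -leNgt side_mod.
have := hy j; rewrite side_mod => l0 l1.
have hj : (j %% nsides t.1.1 < nsides t.1.1)%N by rewrite ltn_mod; case: (t.1.1).
have hs := iter_in_orbit hj; have [eb es _] := iter_next_code R t (j %% nsides t.1.1).
have hsy : tset (iter (j %% nsides t.1.1) next_code t) y by rewrite tset_iter.
move: l0 l1; rewrite -es; move: hs eb hsy; move: (iter _ _ t) => s hs eb hsy /= l0 l1.
have ws := wfo _ _ ht hs.
have {l0 l1} ly : left (ev s.1.2) (zeta ^+ s.2) y = 0 by lra.
have vertex s1 : s1 \in orbit_code t -> y = ev s1.1.2 ->
    exists t', [/\ t' \in P, tset t' y & exists2 eps : R, 0 < eps & tset t' (y + re eps * d)].
  move=> hs1 ey; have [k [a [c [hk a0 c0 ed]]]] := sector d.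
  have nf : ~~ far s1.1.2.
    by apply/negP => /farP; rewrite -ey => h; have := lt_le_trans h hn; rewrite ltxx.
  have [t' [s' [ht' hs' ep hm]]] := full _ _ k ht hs1 nf hk.
  exists t'; rewrite ey -ep -!(tset_orbit R hs').
  by have [? ?] := tset_vertex (wfo _ _ ht' hs') hk a0 c0 ed hm.
have [z ez] := frame_ex (ev s.1.2) y (nsq_zetaX R s.2).
have {ly} iz : Im z = 0.
  move: ly; rewrite ez -[X in left X]addr0 -{1}(mulr0 (zeta ^+ s.2)) -[X in left _ X]mulr1.
  by rewrite left_frame nsq_zetaX mul1r /left ?reimE; lra.
have zE : z = re (Re z) by apply: plane_ext.
have hz : 0 <= Re z <= 1.
  move: hsy; rewrite ez /tset tile_std ?nsq_zetaX //; have h0 := s3_gt0 R.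
  by case: (s.1.1) => [/std_sq[]|/std_tri[]]; rewrite ?iz => *; apply/andP; split; nra.
have [r0|r0] := eqVneq (Re z) 0.
  by apply: (vertex s) => //; rewrite ez zE r0 -[re 0]/(0 : C) mulr0 addr0.
have [r1|r1] := eqVneq (Re z) 1.
  have [j' ej] : exists j', (next_code s) = iter j' next_code t.
    by have [j' ->] := orbit_codeP hs; exists j'.+1.
  have hs1 : iter (j' %% nsides t.1.1) next_code t \in orbit_code t.
    by apply: iter_in_orbit; rewrite ltn_mod; case: (t.1.1).
  apply: (vertex _ hs1).
  have [_ e1 _] := iter_next_code R t (j' %% nsides t.1.1).
  have [_ e2 _] := iter_next_code R t j'.
  have -> : ev (iter (j' %% nsides t.1.1) next_code t).1.2 = ev (next_code s).1.2.
    by rewrite ej; have := congr1 fst e1; rewrite -side_mod -e2.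
  case: (s) ez => [[b p] k] /= ->; rewrite zE r1 -[re 1]/(1 : C) mulr1.
  by rewrite evD ev_dir.
have hz' : 0 < Re z < 1 by move: hz r0 r1; rewrite !lt_neqAle [0 == _]eq_sym => /andP[-> ->] -> ->.
have [d' ed] := frame_ex 0 d (nsq_zetaX R s.2); rewrite add0r in ed.
have [le|lt] := leP 0 (Im d').
  exists t; split => //; have [eps e0 he] := inward_side s.1.1 hz' le; exists eps => //.
  rewrite -(tset_orbit R hs) /tset ez ed zE.
  by rewrite mulrCA -addrA -mulrDr tile_std ?nsq_zetaX.
have no : ~~ outer (s.1.2, s.2).
  apply/negP => ho; have := outerP ws ho hz; rewrite -zE -ez => h.
  by have := lt_le_trans h hn; rewrite ltxx.
have [t' [s' [ht' hs' ep ek]]] := matched _ _ ht hs no.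
exists t'; rewrite -!(tset_orbit R hs').
have hz1 : 0 < 1 - Re z < 1 by lra.
have dN : 0 <= Im (- d') by rewrite imN; lra.
have yE : y = ev s'.1.2 + zeta ^+ s'.2 * re (1 - Re z).
  rewrite ep evD ev_dir ek zeta_addk exprD zeta6 ez {1}zE.
  by rewrite -addrA; congr (_ + _); rewrite mulrN1 mulNr -[X in X - _]mulr1 -mulrBr;
    congr (_ * _); apply: plane_ext; rewrite ?reimE /=; ring.
have dE : d = zeta ^+ s'.2 * - d' by rewrite ek zeta_addk exprD zeta6 mulrN1 mulrNN.
split => //.
  have := inward_side s'.1.1 hz1 (_ : 0 <= Im (0 : C)); case=> [//|eps e0].
  by rewrite mulr0 addr0 /tset yE tile_std ?nsq_zetaX.
have [eps e0 he] := inward_side s'.1.1 hz1 dN; exists eps => //.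
by rewrite /tset {1}yE dE mulrCA -addrA -mulrDr tile_std ?nsq_zetaX.
Qed.

(** Let [m] be the supremum of the covered parameters on the segment from 0 to [x]. It is attained
    because finitely many closed tiles are involved, and [progress] goes beyond it unless it is
    1. *)
Lemma complete_cover P x : complete P -> nsq x <= 25 / 16 -> exists2 t, t \in P & tset t x.
Proof.
move=> hP hx.
pose S := [set r : R | 0 <= r <= 1 /\ exists2 t, t \in P & tset t (re r * x)].
have S0 : S 0.
  have [_ _ [t ht h0] _] := completeP hP.
  by split; [lra|exists t => //; rewrite -[re 0]/(0 : C) mul0r].
have hsup : has_sup S by split; [exists 0|exists 1 => r [] /andP[]].
pose m := sup S.
have m01 : 0 <= m <= 1.
  apply/andP; split; first exact: (sup_upper_bound hsup).
  by apply: ge_sup; [exists 0|move=> r [] /andP[]].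
have [t ht hm] : exists2 t, t \in P & tset t (re m * x).
  apply: contrapT => no.
  have [e e0 he] : exists2 e : R, 0 < e & forall t, t \in P -> forall y, nsq (y - re m * x) < e -> ~ tset t y.
    have : forall t, t \in P -> ~ tset t (re m * x) by move=> t ht h; apply: no; exists t.
    elim: (P) => [|t l IH] h; first by exists 1.
    have [|e e0 he] := IH; first by move=> s hs; apply: h; rewrite inE hs orbT.
    have [|e' e'0 he'] := notin_tile (nsq_zetaX R t.2) (h t _); first by rewrite inE eqxx.
    exists (Num.min e e'); first by rewrite lt_min e0.
    move=> s; rewrite inE => /orP[/eqP->|hs] y; rewrite lt_min => /andP[h1 h2]; first exact: he'.
    exact: (he s).
  have hxx := nsq_ge0 x; pose M := 1 + e + nsq x; have M0 : 0 < M by rewrite /M; lra.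
  have f0 : 0 < e / M by rewrite divr_gt0.
  have [r [hr [t ht htr]] hmr] := sup_adherent f0 hsup.
  apply: (he t ht _ _ htr).
  have rm : r <= m by apply: (sup_upper_bound hsup); split => //; exists t.
  have -> : re r * x - re m * x = re (r - m) * x by apply: plane_ext; rewrite ?reimE /=; ring.
  rewrite nsqM {1}/nsq /= mul0r addr0.
  have fM : e / M * M = e by rewrite divfK // gt_eqF.
  move: f0 fM hmr; rewrite /M -/m; move: (e / _) => f f0 fM hmr.
  have h1 : (r - m) * (r - m) <= f * f by nra.
  by nra.
have [m1|m1] := eqVneq m 1; first by exists t => //; move: hm; rewrite m1 -[re 1]/(1 : C) mul1r.
have {}m1 : m < 1 by rewrite lt_neqAle m1; case/andP: m01.
have hn : nsq (re m * x) <= 25 / 16.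
  by rewrite nsqM {1}/nsq /= mul0r addr0; have := nsq_ge0 x; nra.
have [t' [ht' h1 [eps e0 h2]]] := progress x hP ht hm hn.
(* The farther point given by [progress] may be beyond [x]; by convexity the step can be cut at
   parameter 1. *)
have : S (m + Num.min eps (1 - m)).
  have q0 : 0 < Num.min eps (1 - m) by rewrite lt_min e0; lra.
  have q1 : Num.min eps (1 - m) <= 1 - m by rewrite ge_min lexx orbT.
  have q2 : Num.min eps (1 - m) <= eps by rewrite ge_min lexx.
  move: (Num.min _ _) q0 q1 q2 => q q0 q1 q2.
  split; first lra.
  exists t' => //.
  have -> : re (m + q) * x = re m * x + re (q / eps) * (re m * x + re eps * x - re m * x).
    by apply: plane_ext; rewrite ?reimE /=; field; lra.
  by apply: tile_convex => //; rewrite divr_ge0 ?ler_pdivrMr ?mul1r //; lra.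
move/(sup_upper_bound hsup); rewrite -/m.
have q0 : 0 < Num.min eps (1 - m) by rewrite lt_min e0; lra.
by lra.
Qed.

End Covering.

(** * Change of frame, and tiles equal to their rotated image *)

Section Frames.
Variable R : realType.
Local Notation C := (plane R).
Local Notation Re := (@complex.Re R).
Local Notation Im := (@complex.Im R).
Local Notation zeta := (zeta R).
Local Notation tset := (@tset R).
Local Notation re r := (Complex r 0 : C).
Implicit Types (x y z p u d c w : C) (b : bool) (s t : tcode) (P : seq tcode) (T : set (set C)).

(** [T] read in the frame with origin [c] and first axis [u]: it brings a center to 0 and a patch to
    its listed position. *)
Definition pull T c u : set (set C) := [set A | T ((fun z => c + u * z) @` A)].

Lemma frame_image b c u p d : nsq u = 1 ->
  (fun z => c + u * z) @` tile b p d = tile b (c + u * p) (u * d).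
Proof.
move=> hu; apply/seteqP; split => x; first by move=> [z hz <-]; rewrite tile_frame.
by have [z ->] := frame_ex c x hu; rewrite tile_frame // => hz; exists z.
Qed.

Lemma pull_tile T c u b p d : nsq u = 1 ->
  pull T c u (tile b p d) = T (tile b (c + u * p) (u * d)).
Proof. by move=> hu; rewrite /pull /= frame_image. Qed.

Lemma frame_inj c u : nsq u = 1 -> injective (fun z => c + u * z).
Proof. by move=> hu x y /addrI /(mulfI (unit_neq0 hu)). Qed.

Lemma frame_image_inj c u (A B : set C) : nsq u = 1 ->
  (fun z => c + u * z) @` A = (fun z => c + u * z) @` B -> A = B.
Proof.
move=> hu e; apply/seteqP; split => x hx.
  by have [y hy /(frame_inj hu) <-] : ((fun z => c + u * z) @` B) (c + u * x) by rewrite -e; exists x.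
by have [y hy /(frame_inj hu) <-] : ((fun z => c + u * z) @` A) (c + u * x) by rewrite e; exists x.
Qed.

Lemma good_pull T c u : good T -> nsq u = 1 -> good (pull T c u).
Proof.
move=> [g1 g2 g3 g4] hu; have u0 := unit_neq0 hu; split.
- move=> A /g1[b [p [d [hd eA]]]]; exists b, ((p - c) / u), (d / u).
  have hd' : nsq (d / u) = 1.
    by have : nsq (u * (d / u)) = 1; [rewrite mulrCA divff ?mulr1|rewrite nsqM hu mul1r].
  split => //; have : (fun z => c + u * z) @` A = (fun z => c + u * z) @` tile b ((p - c) / u) (d / u).
    by rewrite frame_image // frameK // mulrCA divff ?mulr1.
  by move/(frame_image_inj hu).
- move=> x; have [A hA hx] := g2 (c + u * x); have [b [p [d [hd eA]]]] := g1 _ hA.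
  have eA' : A = tile b (c + u * ((p - c) / u)) (u * (d / u)).
    by rewrite frameK // mulrCA divff ?mulr1.
  exists (tile b ((p - c) / u) (d / u)); first by rewrite pull_tile // -eA'.
  by move: hx; rewrite eA' tile_frame.
- move=> b p d b' p' d' x hd hd'; rewrite !pull_tile // => h1 h2 h3 h4.
  apply: (@frame_image_inj c u) => //; rewrite !frame_image //.
  by apply: (g3 _ _ _ _ _ _ (c + u * x)); rewrite ?nsqM ?hu ?mul1r ?stile_frame.
- move=> b p d hd; rewrite pull_tile // => /g4[|b' hb']; first by rewrite nsqM hu mul1r.
  by exists b'; rewrite pull_tile // mulrDr addrA mulrN.
Qed.

Lemma rotinv_pull T c u k : nsq u = 1 -> rotinv T (c + u * k) -> rotinv (pull T c u) k.
Proof.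
move=> hu h b p d hd; rewrite !pull_tile // => /h; rewrite nsqM hu hd mul1r => /(_ erefl).
have -> : c + u * k + zeta ^+ 4 * (c + u * p - (c + u * k)) = c + u * (k + zeta ^+ 4 * (p - k)) by ring.
by rewrite mulrCA.
Qed.

Lemma small_scale d (e : R) : 0 < e -> exists2 r : R, 0 < r <= 1 & nsq (re r * d) < e.
Proof.
move=> e0; have hd := nsq_ge0 d; pose M := 1 + e + nsq d.
have M0 : 0 < M by rewrite /M; lra.
have f0 : 0 < e / M by rewrite divr_gt0.
have fM : e / M * M = e by rewrite divfK // gt_eqF.
have f1 : e / M <= 1 by rewrite ler_pdivrMr // mul1r /M; lra.
exists (e / M); first by rewrite f0.
rewrite nsqM {1}/nsq /= mul0r addr0.
move: f0 fM f1; rewrite /M; move: (e / _) => f f0 fM f1; nra.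
Qed.

(** A small move from [x] towards the center of the second tile stays inside the first and enters
    the interior of the second. *)
Lemma strict_unique T b p u b' p' u' x : good T -> nsq u = 1 -> nsq u' = 1 ->
  T (tile b p u) -> T (tile b' p' u') -> stile b p u x -> tile b' p' u' x ->
  tile b p u = tile b' p' u'.
Proof.
move=> [_ _ g3 _] hu hu' hT hT' hx hx'.
have [e e0 he] := in_stile hu hx.
have [r r01 hr] := small_scale (cen b' p' u' - x) e0.
apply: (g3 _ _ _ _ _ _ (x + re r * (cen b' p' u' - x))) => //; last exact: stile_dense.
by apply: he; rewrite [x + _]addrC addrK.
Qed.

(** By [tile_inj] the turned base is a side of the same tile; no side of a square makes an angle of
    120 degrees with its base, and only the next side of a triangle does. *)
Lemma rotation_self b p u : nsq u = 1 ->
  tile b p u = tile b (zeta ^+ 4 * p) (zeta ^+ 4 * u) -> b = false /\ zeta ^+ 4 * p = p + u.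
Proof.
move=> hu e; have hu' : nsq (zeta ^+ 4 * u) = 1 by rewrite nsqM nsq_zetaX mul1r.
have [_ [j]] := tile_inj hu hu' e; move: {e hu'} (zeta ^+ 4) (zeta4 R) => w ew.
rewrite side_mod; have : (j %% nsides b < nsides b)%N by rewrite ltn_mod; case: (b).
have u0 := unit_neq0 hu; have h3 := s3_gt0 R.
have absurd a : (Re (a - w) != 0) || (Im (a - w) != 0) -> w * u = u * a -> False.
  move=> ha /eqP; rewrite mulrC -subr_eq0 -mulrBr mulf_eq0 (negbTE u0) /= -oppr_eq0 opprB => /eqP e.
  by move: ha; rewrite e /= eqxx.
move: (j %% _)%N => k; case: b => /=.
  case: k => [|[|[|[|//]]]] _ [_] /=; rewrite -?mulrA => h; exfalso; move: h.
  - rewrite -[X in _ * _ = X]mulr1; apply: absurd; rewrite ew ?reimE /=; apply/orP; right.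
    by apply/eqP; lra.
  - by apply: absurd; rewrite ew /wt ?reimE /=; apply/orP; left; apply/eqP; lra.
  - by apply: absurd; rewrite ew /wt ?reimE /=; apply/orP; left; apply/eqP; lra.
  - by apply: absurd; rewrite ew /wt ?reimE /=; apply/orP; left; apply/eqP; lra.
case: k => [|[|[|//]]] _ [h0] /=; rewrite -?mulrA => h.
- exfalso; move: h; rewrite -[X in _ * _ = X]mulr1; apply: absurd; rewrite ew ?reimE /=.
  by apply/orP; right; apply/eqP; lra.
- by split.
- exfalso; move: h; apply: absurd; rewrite ew /wt ?reimE /=; apply/orP; right.
  by apply/eqP; lra.
Qed.

Lemma edge_code T t s : good T -> T (tset t) -> s \in orbit_code t ->
  exists b, T (tset (b, padd s.1.2 (pdir s.2), addk s.2 6)).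
Proof.
move=> [_ _ _ g4] hT hs; rewrite -(tset_orbit R hs) in hT.
have [b hb] := g4 _ _ _ (nsq_zetaX R _) hT; exists b.
by rewrite /tset /= evD ev_dir zeta_addk exprD zeta6 mulrN1.
Qed.

End Frames.

(** * The tiles at a center of a rotation of order 3 *)

Section RotationCenters.
Variable R : realType.
Local Notation C := (plane R).
Local Notation Re := (@complex.Re R).
Local Notation Im := (@complex.Im R).
Local Notation s3 := (s3 R).
Local Notation zeta := (zeta R).
Local Notation ev := (@ev R).
Local Notation tset := (@tset R).
Local Notation re r := (Complex r 0 : C).
Implicit Types (x y z p u d c w : C) (b : bool) (s t : tcode) (P : seq tcode) (T : set (set C)).

Lemma pull_tset T c u t : nsq u = 1 ->
  pull T c u (tset t) = T (tile t.1.1 (c + u * ev t.1.2) (u * zeta ^+ t.2)).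
Proof. by move=> hu; rewrite pull_tile. Qed.

Lemma tile_rotate b p u w x : nsq w = 1 -> stile b (w * p) (w * u) (w * x) <-> stile b p u x.
Proof. by move=> hw; have := stile_frame b 0 p u x hw; rewrite !add0r. Qed.

Lemma rotinv_tile T b p u : rotinv T 0 -> nsq u = 1 -> T (tile b p u) ->
  T (tile b (zeta ^+ 4 * p) (zeta ^+ 4 * u)).
Proof. by move=> h hu hT; have := h _ _ _ hu hT; rewrite subr0 add0r. Qed.

(* Three tiles obtained from one another by rotation have disjoint interiors,
   which excludes squares and points inside a side. *)
Lemma center_on_side T b u (r : R) : good T -> rotinv T 0 -> nsq u = 1 ->
  T (tile b (- (u * re r)) u) -> 0 < r < 1 -> False.
Proof.
move=> gT hr hu hT /andP[r0 r1]; have h3 := s3_bounds R.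
set p := - (u * re r) in hT.
have hT' := rotinv_tile hr hu hT.
have hu' : nsq (zeta ^+ 4 * u) = 1 by rewrite nsqM nsq_zetaX mul1r.
pose m := Num.min r (1 - r) / 4.
have [m0 mr mr1] : [/\ 0 < m, 4 * m <= r & 4 * m <= 1 - r].
  have q0 : 0 < Num.min r (1 - r) by rewrite lt_min r0; lra.
  have q1 : Num.min r (1 - r) <= 1 - r by rewrite ge_min lexx orbT.
  have q2 : Num.min r (1 - r) <= r by rewrite ge_min lexx.
  by rewrite /m; split; lra.
have sm : 0 <= s3 * m <= 174 / 100 * m by apply/andP; split; nra.
have ssm : s3 * (s3 * m) = 3 * m by rewrite mulrA s3M.
have sr : s3 * r >= 17 / 10 * r by nra.
have sr1 : s3 * (1 - r) >= 17 / 10 * (1 - r) by nra.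
have zeta5 : zeta ^+ 5 = Complex (- (s3 / 2)) (1 / 2).
  by rewrite exprSr zeta4; apply: plane_ext; rewrite ?reimE /=; have := s3M R; lra.
have h1 : stile b p u (p + u * (re r + re m * zeta ^+ 5)).
  rewrite stile_std // zeta5.
  by case: (b); [apply/std_ssq|apply/std_stri]; rewrite ?reimE /=; split; lra.
have h2 : stile b (zeta ^+ 4 * p) (zeta ^+ 4 * u) (zeta ^+ 4 * (p + u * (re r + re m * zeta))).
  rewrite tile_rotate ?nsq_zetaX // stile_std //.
  by case: (b); [apply/std_ssq|apply/std_stri]; rewrite ?reimE /=; split; lra.
(* As [p + u * re r] is 0, the direction at 150 degrees from one base is the direction at 30 degrees
   from the turned base. *)
have ex : p + u * (re r + re m * zeta ^+ 5) = zeta ^+ 4 * (p + u * (re r + re m * zeta)).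
  by rewrite /p !mulrDr !addKr [zeta ^+ 5]exprSr; ring.
rewrite -ex in h2; have [_ _ g3 _] := gT.
have [_] := rotation_self hu (g3 _ _ _ _ _ _ _ hu hu' hT hT' h1 h2).
have -> : p + u = u * (1 - re r) by rewrite /p; ring.
rewrite /p mulrN mulrCA -mulrN => /(mulfI (unit_neq0 hu)) /(congr1 Im).
by rewrite zeta4 ?reimE /=; nra.
Qed.

Lemma sub_tiling_cat T P Q : sub_tiling T P -> sub_tiling T Q -> sub_tiling T (P ++ Q).
Proof. by move=> h1 h2 t; rewrite mem_cat => /orP[/h1|/h2]. Qed.

(** A tile at 0 and its successor counterclockwise have to fit before the first one turned by 120
    degrees. Hence both are triangles, and their orbits form the hexagon. *)
Lemma center_at_vertex T b : good T -> rotinv T 0 -> T (tset (b, (Z0, Z0, Z0, Z0), 0%N)) ->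
  sub_tiling T hex_code.
Proof.
move=> gT hr h0; have rot t : T (tset t) -> T (tset (rot_code 4 t)).
  by move=> ht; apply: (rot_orbitP hr ht); rewrite !inE eqxx orbT.
have no s t : T (tset s) -> T (tset t) -> conflict s t = false.
  by move=> hs ht; apply/negP => /(conflictP gT hs ht).
(* [k] is both the index of the side ending at 0 and, in units of 30 degrees, the angle of the tile
   at 0, hence the direction of that side reversed. *)
pose k := if b then 3%N else 2%N.
have [b' hb'] : exists b', T (tset (b', (Z0, Z0, Z0, Z0), k)).
  have hs : iter k next_code (b, (Z0, Z0, Z0, Z0), 0%N) \in orbit_code (b, (Z0, Z0, Z0, Z0), 0%N).
    by apply: iter_in_orbit; rewrite /k; case: (b).
  have [b' hb'] := edge_code gT h0 hs; exists b'.
  have e : (b', padd (iter k next_code (b, (Z0, Z0, Z0, Z0), 0%N)).1.2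
        (pdir (iter k next_code (b, (Z0, Z0, Z0, Z0), 0%N)).2),
      addk (iter k next_code (b, (Z0, Z0, Z0, Z0), 0%N)).2 6) = (b', (Z0, Z0, Z0, Z0), k).
    by rewrite /k; case: (b); case: (b').
  by rewrite -e.
have cT b1 : conflict (b1, (Z0, Z0, Z0, Z0), 3%N) (rot_code 4 (true, (Z0, Z0, Z0, Z0), 0%N)).
  by case: b1; vm_compute.
have cF : conflict (true, (Z0, Z0, Z0, Z0), 2%N) (rot_code 4 (false, (Z0, Z0, Z0, Z0), 0%N)).
  by vm_compute.
have := no _ _ hb' (rot _ h0); move: h0 hb'; rewrite /k; case: b {k} => h0; first by rewrite cT.
case: b' => [|h2 _]; first by rewrite cF.
have -> : hex_code = rot_orbit (false, (Z0, Z0, Z0, Z0), 0%N) ++ rot_orbit (false, (Z0, Z0, Z0, Z0), 2%N).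
  by [].
by apply: sub_tiling_cat; apply: rot_orbitP.
Qed.

Lemma rotinv_pull0 T u : nsq u = 1 -> rotinv T 0 -> rotinv (pull T 0 u) 0.
Proof. by move=> hu hr; apply: rotinv_pull => //; rewrite mulr0 addr0. Qed.

Lemma rotation_center T : good T -> rotinv T 0 ->
  exists2 u, nsq u = 1 & sub_tiling (pull T 0 u) hex_code \/ sub_tiling (pull T 0 u) tri_code.
Proof.
move=> gT hr; have [g1 g2 g3 _] := gT.
have [A hA] := g2 0; have [b [p [u [hu eA]]]] := g1 _ hA.
rewrite {}eA in hA * => h0; have hA' := rotinv_tile hr hu hA.
have hu' : nsq (zeta ^+ 4 * u) = 1 by rewrite nsqM nsq_zetaX mul1r.
have [hs|] := pselect (stile b p u 0).
  have hs' : stile b (zeta ^+ 4 * p) (zeta ^+ 4 * u) 0.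
    by rewrite -(mulr0 (zeta ^+ 4)) tile_rotate // nsq_zetaX.
  have [eb ep] := rotation_self hu (g3 _ _ _ _ _ _ _ hu hu' hA hA' hs hs').
  exists u => //; right; apply: rot_orbitP; first exact: rotinv_pull0.
  rewrite pull_tset //= mulr1 add0r -eb.
  suff -> : u * ev (Zneg 4, Z0, Zneg 4, Z0) = p by [].
  have -> : u = (zeta ^+ 4 - 1) * p by rewrite mulrBl ep mul1r addrC addKr.
  rewrite mulrAC -[RHS]mul1r; congr (_ * p).
  have h3 := s3M R; rewrite zeta4; apply: plane_ext; rewrite ?reimE !evE;
    change (zr R Z0) with (0 : R); change (zr R (Zneg 4)) with (- 4 : R); rewrite /=; lra.
move=> /existsNP[j /negP]; rewrite -leNgt; have := h0 j.
have : tile b (side b p u j).1 (side b p u j).2 0 by rewrite tile_side.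
move: (hA); rewrite -{1}(tile_side b p u j); have := nsq_side b p u j; rewrite hu.
case: (side b p u j) => q v /= hv hT tv l0 l1.
have {l0 l1} l : left q v 0 = 0 by lra.
have [z ez] := frame_ex q 0 hv.
have iz : Im z = 0.
  move: l; rewrite ez -[X in left X]addr0 -{1}(mulr0 v) -[X in left _ X]mulr1.
  by rewrite left_frame hv mul1r /left ?reimE; lra.
have zE : z = re (Re z) by apply: plane_ext.
have eq : q = - (v * re (Re z)) by rewrite -zE; apply/eqP; rewrite -addr_eq0 -ez.
have hz : 0 <= Re z <= 1.
  move: tv; rewrite ez tile_std //; have h3 := s3_gt0 R.
  by case: (b) => [/std_sq[]|/std_tri[]]; rewrite ?iz => *; apply/andP; split; nra.
have based v' : nsq v' = 1 -> T (tile b 0 v') ->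
    exists2 u, nsq u = 1 & sub_tiling (pull T 0 u) hex_code \/ sub_tiling (pull T 0 u) tri_code.
  move=> hv' hT'; exists v' => //; left; apply: (center_at_vertex (b := b)).
  - exact: good_pull.
  - exact: rotinv_pull0.
  - by rewrite pull_tset //= ev0 mulr0 addr0 mulr1.
have [r0|r0] := eqVneq (Re z) 0.
  apply: (based v) => //; move: hT; rewrite eq r0 -[re 0]/(0 : C) mulr0 oppr0.
  by [].
have [r1|r1] := eqVneq (Re z) 1.
  have := nsq_side b q v 1; rewrite hv => /based; apply.
  have := tile_side b q v 1; have -> : (side b q v 1).1 = 0.
    by rewrite /= eq r1 -[re 1]/(1 : C) mulr1 addNr.
  by move=> ->.
have hz' : 0 < Re z < 1 by move: hz r0 r1; rewrite !lt_neqAle [0 == _]eq_sym => /andP[-> ->] -> ->.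
by exfalso; apply: (@center_on_side T b v (Re z) gT hr hv _ hz'); rewrite -eq.
Qed.

End RotationCenters.

(** * Relative positions of neighbouring patches *)

Section Links.
Variable R : realType.
Local Notation C := (plane R).
Local Notation Re := (@complex.Re R).
Local Notation Im := (@complex.Im R).
Local Notation s3 := (s3 R).
Local Notation zeta := (zeta R).
Local Notation ev := (@ev R).
Local Notation tset := (@tset R).
Local Notation re r := (Complex r 0 : C).
Implicit Types (x y z p u d c w : C) (b : bool) (s t : tcode) (P : seq tcode) (T : set (set C)).

Lemma patches_complete_nth i : (i < size patches)%N -> complete (patch i).
Proof. by move=> hi; apply: (all_nthP [::] patches_complete). Qed.

Lemma patch_at T : good T -> rotinv T 0 ->
  exists u i, [/\ nsq u = 1, (i < size patches)%N & sub_tiling (pull T 0 u) (patch i)].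
Proof.
move=> gT hr; have [u hu hc] := rotation_center gT hr.
have gT' := good_pull 0 gT hu; have hr' := rotinv_pull0 hu hr.
have [P hP hsub] : exists2 P, P \in patches & sub_tiling (pull T 0 u) P.
  case: hc => /(explore_sound 20 gT' hr')[P hP hsub]; exists P; try exact: hsub.
    by rewrite -patchesE mem_cat; apply/orP; left.
  by rewrite -patchesE mem_cat; apply/orP; right.
by exists u, (index P patches); rewrite index_mem hP /patch nth_index.
Qed.

Lemma repsP i t : (i < size patches)%N -> t \in patch i ->
  exists n r, [/\ r \in nth [::] reps i, (r.2 < 12)%N & t = rot_code (4 * n) r].
Proof.
move=> hi ht.
have : all (fun i => all (fun t => has (fun n => has (fun r => (r.2 < 12)%N && (t == rot_code (4 * n) r)) (nth [::] reps i))
  [:: 0; 1; 2]%N) (patch i)) (iota 0 (size patches)) by vm_compute.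
move=> /allP/(_ i); rewrite mem_iota => /(_ hi)/allP/(_ t ht)/hasP[n _ /hasP[r hr /andP[wr /eqP e]]].
by exists n, r.
Qed.

Lemma nsqN z : nsq (- z) = nsq z. Proof. by rewrite /nsq ?reimE !mulrNN. Qed.

(** [1164 / 1000] bounds [(7 + 4 sqrt 3) / 12], the squared half-distance of two neighbours; there
    remains room for a small move towards the center of a tile. *)
Lemma nsq_le_center x c : nsq c <= 2 -> nsq x <= 1164 / 1000 ->
  nsq (x + re (1 / 20) * c) <= 25 / 16.
Proof.
rewrite /nsq ?reimE /= !mul0r !subr0 !addr0.
have := sqr_ge0 (Re x / 2 - Re c / 10); have := sqr_ge0 (Im x / 2 - Im c / 10).
by rewrite !expr2; move: (Re x) (Im x) (Re c) (Im c) => a b c' d; lra.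
Qed.

(** The midpoint of 0 and [w] is covered by both patches. It may lie on a boundary, so a point [x']
    in the interior of [t] serves to show that [t] belongs to both; equating its two codes gives the
    position of the second patch. *)
Lemma link_exists T w i : good T -> rotinv T 0 -> rotinv T w -> w != 0 ->
  nsq w <= (7 + 4 * s3) / 3 -> i \in linked -> sub_tiling T (patch i) ->
  exists l, [/\ l \in links i, w = ev l.1.1 & sub_tiling T (place l.1.1 l.2 (patch l.1.2))].
Proof.
move=> gT h0 hw w0 nw hi hsub.
have hi' : (i < size patches)%N by move: hi; rewrite !inE => /or4P[|||/or3P[]] /eqP->.
have hs := s3_bounds R.
have gT1 := good_pull w gT (nsq_zetaX R 0).
have hr1 : rotinv (pull T w (zeta ^+ 0)) 0.
  by apply: rotinv_pull; rewrite ?nsq_zetaX // mulr0 addr0.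
have [u1 [i1 [hu1 hi1 hsub1]]] := patch_at gT1 hr1.
have {hsub1}hsub1 n t : t \in patch i1 ->
    T (tile t.1.1 (w + u1 * zeta ^+ (4 * n) * ev t.1.2) (u1 * zeta ^+ (4 * n) * zeta ^+ t.2)).
  move=> /hsub1; rewrite pull_tset // add0r => h.
  have hd : nsq (u1 * zeta ^+ t.2) = 1 by rewrite nsqM hu1 nsq_zetaX mul1r.
  have := rotinv0 n hr1 hd h; rewrite pull_tile ?nsq_zetaX // !mul1r.
  by rewrite [zeta ^+ _ * (u1 * ev _)]mulrCA [zeta ^+ _ * (u1 * zeta ^+ t.2)]mulrCA !mulrA.
pose x := re (1 / 2) * w.
have nx : nsq x <= 1164 / 1000 by rewrite /x nsqM {1}/nsq /= mul0r addr0; lra.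
have [t ht hx] : exists2 t, t \in patch i & tset t x.
  by apply: complete_cover; [apply: patches_complete_nth|lra].
pose c := cen t.1.1 (ev t.1.2) (zeta ^+ t.2).
pose x' := x + re (1 / 20) * (c - x).
have hx' : stile t.1.1 (ev t.1.2) (zeta ^+ t.2) x'.
  by apply: stile_dense => //; [apply: nsq_zetaX|lra].
have nc : nsq (c - x) <= 2.
  by apply: tile_diam hx => //; [apply: nsq_zetaX|apply/stile_tile/cen_stile/nsq_zetaX].
have nxw : nsq (x - w) <= 1164 / 1000.
  have -> : x - w = - x by rewrite /x; apply: plane_ext; rewrite ?reimE /=; lra.
  by rewrite nsqN.
have [y ey] := frame_ex w x' hu1.
have ny : nsq y <= 25 / 16.
  have : nsq (u1 * y) <= 25 / 16.
    have -> : u1 * y = (x - w) + re (1 / 20) * (c - x).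
      by rewrite addrAC -/x' ey addrAC subrr add0r.
    exact: (nsq_le_center nc nxw).
  by rewrite nsqM hu1 mul1r.
have [t1 ht1 hy] : exists2 t1, t1 \in patch i1 & tset t1 y.
  by apply: complete_cover => //; apply: patches_complete_nth.
(* Up to a rotation of order 3 about [w], the shared tile is a listed representative; [u2] absorbs
   this rotation. *)
have [n [r [hr wr er]]] := repsP hi1 ht1.
pose u2 := u1 * zeta ^+ (4 * n); have hu2 : nsq u2 = 1 by rewrite nsqM hu1 nsq_zetaX mul1r.
have hd2 : nsq (u2 * zeta ^+ r.2) = 1 by rewrite nsqM hu2 nsq_zetaX mul1r.
have hB : T (tile r.1.1 (w + u2 * ev r.1.2) (u2 * zeta ^+ r.2)) /\
          tile r.1.1 (w + u2 * ev r.1.2) (u2 * zeta ^+ r.2) x'.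
  have h1 := hsub1 0%N _ ht1; rewrite mulr1 in h1.
  have h2 : tile t1.1.1 (w + u1 * ev t1.1.2) (u1 * zeta ^+ t1.2) x' by rewrite ey tile_frame.
  move: h1 h2; rewrite er; case: (r) => [[b p] k] /=.
  by rewrite ev_rot zeta_addk exprD /u2 [zeta ^+ k * _]mulrC !mulrA.
case: hB => hTB hxB.
have eB := strict_unique gT (nsq_zetaX R _) hd2 (hsub _ ht) hTB hx' hxB.
have [eb [j]] := tile_inj (nsq_zetaX R _) hd2 eB.
move=> ej; have [_ wf _ _] := completeP R (patches_complete_nth hi').
have hj : (j %% nsides t.1.1 < nsides t.1.1)%N by rewrite ltn_mod; case: (t.1.1).
have hs' := iter_in_orbit hj.
have [eb' es ws] := iter_next_code R t (j %% nsides t.1.1).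
move: es; rewrite -side_mod -ej; move: hs' eb' ws; move: (iter _ _ t) => s hs' eb' ws es.
have {}ws := ws (wf _ ht).
have ep : ev s.1.2 = w + u2 * ev r.1.2 by have := congr1 fst es.
have ek : zeta ^+ s.2 = u2 * zeta ^+ r.2 by have := congr1 snd es.
pose m := addk s.2 (12 - r.2); pose D := psub s.1.2 (prot m r.1.2).
(* Here the unknown rotation turns out to be a power of zeta. *)
have um : zeta ^+ m = u2.
  by rewrite /m zeta_addk exprD ek -mulrA zeta_inv ?mulr1 // ltnW.
have eD : ev D = w by rewrite /D evB ev_rot um ep addrK.
have hplace : sub_tiling T (place D m (patch i1)).
  move=> q /mapP[[[b p] k] hq ->]; have := hsub1 n _ hq.
  by rewrite /tset /= evD ev_rot eD zeta_addk exprD um -/u2 [zeta ^+ k * _]mulrC.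
have hcand : candidate t D.
  rewrite /candidate; apply/and3P; split.
  - by apply/eqP => e; move: w0; rewrite -eD e ev0 eqxx.
  - move: nw; rewrite -eD nsq_ev; case: (nsq576 D) => n1 n2; rewrite (qposE R) !qvalE !zrB.
    by change (zr R (Zpos 1344)) with (1344 : R); change (zr R (Zpos 768)) with (768 : R); lra.
  - case: eqP => //= e; have := ev_half R e; rewrite eD => ew.
    apply/(insideE R _ (wf _ ht)).1; rewrite (_ : ev (phalf D) = x) // /x ew.
    by apply: plane_ext; rewrite ?reimE /=; lra.
have hl : (D, i1, m) \in candidates (patch i).
  rewrite mem_undup; apply/flattenP; eexists; first by apply/mapP; exists t.
  apply/flattenP; eexists; first by apply/mapP; exists s.
  apply/flattenP; eexists; first by apply/mapP; exists i1; rewrite ?mem_iota.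
  rewrite mem_pmap; apply/mapP; exists r => //.
  by rewrite -eb eqxx; cbv zeta; rewrite -/m -/D hcand.
have /andP[/eqP eL /allP hL] := allP links_checked _ hi.
move: hl; rewrite -eL => /mapP[[l c1] hlc /= el]; subst l.
exists (D, i1, m); split => //.
have /= /orP[//|/and3P[c1P c1Q hconf]] := hL _ hlc.
exfalso; apply: conflictP gT _ _ hconf; first exact/hsub/mem_nth.
exact/hplace/mem_nth.
Qed.

End Links.

(** * Eisenstein integers and the lattice of centers *)

Section Lattice.
Variable R : realType.
Local Notation C := (plane R).
Local Notation Re := (@complex.Re R).
Local Notation Im := (@complex.Im R).
Local Notation s3 := (s3 R).
Local Notation zeta := (zeta R).
Local Notation re r := (Complex r 0 : C).
Implicit Types (x y z p q u d c w : C) (b : bool) (s t : tcode) (P : seq tcode) (T : set (set C)).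

(** The Eisenstein integers Z[omega], since [zeta ^ 2 = 1 + omega]. *)
Definition eis q := exists m n : int, q = m%:~R + n%:~R * zeta ^+ 2.

Lemma intC (m : int) : m%:~R = re m%:~R. Proof. by rewrite -(rmorph_int (real_complex R)). Qed.
Lemma zeta4E : zeta ^+ 4 = zeta ^+ 2 - 1.
Proof. by rewrite zeta4 zeta2; apply: plane_ext; rewrite ?reimE /=; lra. Qed.

Lemma eis_int (m : int) : eis m%:~R. Proof. by exists m, 0; rewrite mul0r addr0. Qed.
Lemma eis0 : eis 0. Proof. exact: (eis_int 0). Qed.
Lemma eis1 : eis 1. Proof. exact: (eis_int 1). Qed.
Lemma eisD q q' : eis q -> eis q' -> eis (q + q').
Proof. by move=> [m [n ->]] [m' [n' ->]]; exists (m + m'), (n + n'); rewrite !intrD; ring. Qed.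
Lemma eisN q : eis q -> eis (- q).
Proof. by move=> [m [n ->]]; exists (- m), (- n); rewrite !intrN; ring. Qed.
Lemma eis_zeta q k : eis q -> eis (zeta ^+ (2 * k) * q).
Proof.
move=> hq; elim: k => [|k [m [n IH]]]; first by rewrite mul1r.
exists (- n), (m + n); rewrite mulnS exprD -mulrA IH intrN intrD.
have -> : zeta ^+ 2 * (m%:~R + n%:~R * zeta ^+ 2) = m%:~R * zeta ^+ 2 + n%:~R * zeta ^+ 4.
  by rewrite (exprD _ 2 2); ring.
by rewrite zeta4E; ring.
Qed.

(* The weighted mean of the squared distances to the vertices of a unit triangle
   is at most 1/3, with barycentric coordinates as weights. *)
Lemma eis_near z : exists2 q, eis q & nsq (z - q) <= 1 / 3.
Proof.
have h3 := s3M R.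
pose b := 2 * s3 * Im z / 3; pose a := Re z - b / 2.
have ez : z = re a + re b * zeta ^+ 2.
  rewrite zeta2; apply: plane_ext; rewrite ?reimE /= /a /b; first lra.
  have e : s3 * (s3 * Im z) = 3 * Im z by rewrite mulrA h3.
  by lra.
have /andP[a0 a1] := floor_itv a; have /andP[b0 b1] := floor_itv b.
move: a0 a1 b0 b1; set m := Num.floor a; set n := Num.floor b; rewrite !intrD => a0 a1 b0 b1.
pose s : R := a - m%:~R; pose t : R := b - n%:~R.
have [s0 s1 t0 t1] : [/\ 0 <= s, s < 1, 0 <= t & t < 1] by rewrite /s /t; split; lra.
have dist (i j : int) : nsq (z - ((m + i)%:~R + (n + j)%:~R * zeta ^+ 2)) =
    (s - i%:~R) * (s - i%:~R) + (s - i%:~R) * (t - j%:~R) + (t - j%:~R) * (t - j%:~R).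
  have -> : z - ((m + i)%:~R + (n + j)%:~R * zeta ^+ 2) = re (s - i%:~R) + re (t - j%:~R) * zeta ^+ 2.
    by rewrite ez !intC !intrD /s /t; apply: plane_ext; rewrite ?reimE /=; ring.
  rewrite zeta2 /nsq ?reimE /=; move: (s - _) (t - _) => x y.
  have e : y * y * (s3 * s3) = 3 * (y * y) by rewrite h3; ring.
  by lra.
apply: contrapT => no.
have far (i j : int) : 1 / 3 < (s - i%:~R) * (s - i%:~R) + (s - i%:~R) * (t - j%:~R) + (t - j%:~R) * (t - j%:~R).
  rewrite -dist ltNge; apply/negP => h; apply: no.
  by exists ((m + i)%:~R + (n + j)%:~R * zeta ^+ 2) => //; exists (m + i), (n + j).
have := far 0 0; have := far 1 0; have := far 0 1; have := far 1 1.
rewrite !subr0; move: (s) (t) s0 s1 t0 t1 {far dist} => x y x0 x1 y0 y1 h11 h01 h10 h00.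
have [le|le] := leP (x + y) 1.
  have : 0 <= (1 - x - y) * (x * x + x * y + y * y - 1 / 3) by apply: mulr_ge0; lra.
  have : 0 <= x * ((x - 1) * (x - 1) + (x - 1) * y + y * y - 1 / 3) by apply: mulr_ge0; lra.
  have : 0 <= y * (x * x + x * (y - 1) + (y - 1) * (y - 1) - 1 / 3) by apply: mulr_ge0; lra.
  have := sqr_ge0 (x - y); have := sqr_ge0 (x + y - 2 / 3); rewrite !expr2; nra.
have : 0 <= (x + y - 1) * ((x - 1) * (x - 1) + (x - 1) * (y - 1) + (y - 1) * (y - 1) - 1 / 3) by apply: mulr_ge0; lra.
have : 0 <= (1 - y) * ((x - 1) * (x - 1) + (x - 1) * y + y * y - 1 / 3) by apply: mulr_ge0; lra.
have : 0 <= (1 - x) * (x * x + x * (y - 1) + (y - 1) * (y - 1) - 1 / 3) by apply: mulr_ge0; lra.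
have := sqr_ge0 (x - y); have := sqr_ge0 (x + y - 4 / 3); rewrite !expr2; nra.
Qed.

(** [1 - zeta ^ 4] divides 3 and [zeta ^ 2] is congruent to 2, so the class of [m + n zeta ^ 2] is
    that of [m + 2 n] modulo 3. The class of 2 is represented by [zeta ^ 2], which is a neighbour of
    both 0 and 1. *)
Lemma eis_residue q : eis q ->
  exists q' r, [/\ eis q', r \in [:: 0; 1; zeta ^+ 2] & q = (1 - zeta ^+ 4) * q' + r].
Proof.
move=> [m [n ->]].
have [k [i [hi hmn]]] : exists k i : int, (i \in [:: 0; 1; 2]) /\ m + 2 * n = 3 * k + i.
  exists ((m + 2 * n) %/ 3)%Z, ((m + 2 * n) %% 3)%Z; split; last by rewrite {1}(divz_eq (m + 2 * n) 3) mulrC.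
  have := modz_ge0 (m + 2 * n) (isT : 3 != 0 :> int); have := ltz_pmod (m + 2 * n) (isT : 0 < 3 :> int).
  by rewrite !inE; lia.
have zz : (1 - zeta ^+ 4) * (1 + zeta ^+ 2) = 3.
  have -> : (1 - zeta ^+ 4) * (1 + zeta ^+ 2) = 1 + zeta ^+ 2 - zeta ^+ 4 - zeta ^+ 6 by rewrite (exprD _ 4 2); ring.
  by rewrite zeta6 zeta4E; ring.
have {hmn}hm : m%:~R = 3 * k%:~R + i%:~R - 2 * n%:~R :> C.
  by have := congr1 (fun j : int => j%:~R : C) hmn; rewrite /= !intrD !intrM /= => /eqP; rewrite eq_sym -subr_eq => /eqP <-; ring.
have ek : eis (k%:~R * (1 + zeta ^+ 2) - n%:~R).
  by exists (k - n), k; rewrite intrB; ring.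
have e2 : 1 - zeta ^+ 4 = 2 - zeta ^+ 2 by rewrite zeta4E; ring.
have main : m%:~R + n%:~R * zeta ^+ 2 = (1 - zeta ^+ 4) * (k%:~R * (1 + zeta ^+ 2) - n%:~R) + i%:~R.
  have -> : (1 - zeta ^+ 4) * (k%:~R * (1 + zeta ^+ 2) - n%:~R) =
    k%:~R * ((1 - zeta ^+ 4) * (1 + zeta ^+ 2)) - (1 - zeta ^+ 4) * n%:~R by ring.
  by rewrite zz e2 hm; ring.
move: hi main; rewrite !inE => /or3P[] /eqP-> main.
- by exists (k%:~R * (1 + zeta ^+ 2) - n%:~R), 0; rewrite !inE eqxx.
- by exists (k%:~R * (1 + zeta ^+ 2) - n%:~R), 1; rewrite !inE eqxx orbT.
exists (k%:~R * (1 + zeta ^+ 2) - n%:~R + 1), (zeta ^+ 2); rewrite !inE eqxx !orbT; split => //.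
  exact: eisD ek eis1.
have e3 : 2%:~R = (1 - zeta ^+ 4) + zeta ^+ 2 by rewrite e2; ring.
by rewrite main e3; ring.
Qed.

Lemma pull_pull T c u c' u' : pull (pull T c u) c' u' = pull T (c + u * c') (u * u').
Proof.
have e : (fun z => c + u * z) \o (fun z => c' + u' * z) = (fun z => c + u * c' + u * u' * z).
  by apply/funext => z /=; ring.
by apply/seteqP; split => A; rewrite /pull /= image_comp e.
Qed.

Definition centered T w := good T /\ forall q, eis q -> rotinv T (w * q).

Lemma centered_pull T w q u : centered T w -> eis q -> nsq u = 1 ->
  centered (pull T (w * q) u) (w / u).
Proof.
move=> [gT hr] hq hu; split; first exact: good_pull.
move=> q' hq'; apply: rotinv_pull => //.
have -> : w * q + u * (w / u * q') = w * (q + q').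
  by rewrite mulrDr mulrA [u * (w / u)]mulrCA divff ?mulr1 // unit_neq0.
exact/hr/eisD.
Qed.

(** The rotation by 240 degrees about 0 followed by the one by 120 degrees about [w * q] is this
    translation. *)
Lemma centered_translate T w q b p u : centered T w -> eis q -> nsq u = 1 ->
  T (tile b p u) -> T (tile b (p + (1 - zeta ^+ 4) * w * q) u).
Proof.
move=> [_ hr] hq hu hT; have hr0 := hr _ eis0; rewrite mulr0 in hr0.
have h1 := rotinv0 2 hr0 hu hT.
have := hr _ hq _ _ _ _ h1; rewrite nsqM nsq_zetaX hu mul1r => /(_ erefl).
have e : zeta ^+ 4 * zeta ^+ (4 * 2) = 1 by rewrite -exprD zeta12.
have -> : w * q + zeta ^+ 4 * (zeta ^+ (4 * 2) * p - w * q) =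
  zeta ^+ 4 * zeta ^+ (4 * 2) * p + (1 - zeta ^+ 4) * w * q.
  by move: (zeta ^+ 4) (zeta ^+ (4 * 2)) => z z'; ring.
by rewrite [_ * (_ * u)]mulrA e !mul1r.
Qed.

End Lattice.

(** * Three patches determine the whole tiling *)

Section Classification.
Variable R : realType.
Local Notation C := (plane R).
Local Notation Re := (@complex.Re R).
Local Notation Im := (@complex.Im R).
Local Notation s3 := (s3 R).
Local Notation zeta := (zeta R).
Local Notation ev := (@ev R).
Local Notation tset := (@tset R).
Implicit Types (x y z p q u v d c w : C) (b : bool) (s t : tcode) (P : seq tcode) (T : set (set C)).

Lemma covering_patch T c u i b p v x : good T -> nsq u = 1 -> (i < size patches)%N ->
  sub_tiling (pull T c u) (patch i) -> nsq (x - c) <= 25 / 16 ->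
  nsq v = 1 -> T (tile b p v) -> stile b p v x ->
  exists2 t, t \in patch i & tile b p v = tile t.1.1 (c + u * ev t.1.2) (u * zeta ^+ t.2).
Proof.
move=> gT hu hi hsub hx hv hT hs; have [y ey] := frame_ex c x hu.
have [t ht hy] : exists2 t, t \in patch i & tset t y.
  apply: complete_cover; first exact: patches_complete_nth.
  by move: hx; rewrite ey addrC addKr nsqM hu mul1r.
exists t => //; have := hsub _ ht; rewrite pull_tset // => hB.
have hd : nsq (u * zeta ^+ t.2) = 1 by rewrite nsqM hu nsq_zetaX mul1r.
by apply: (strict_unique gT hv hd hT hB hs); rewrite ey tile_frame.
Qed.

(** Since [|w| ^ 2 / 3 <= (7 + 4 sqrt 3) / 9 = 1.547...] and [25 / 16 = 1.5625], this holds with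
    little to spare. *)
Lemma near_center w x : w != 0 -> nsq w <= (7 + 4 * s3) / 3 ->
  exists2 q, eis q & nsq (x - w * q) <= 25 / 16.
Proof.
move=> w0 hw; have [q hq h] := eis_near (x / w); exists q => //.
have -> : x - w * q = w * (x / w - q) by rewrite mulrBr mulrCA divff // mulr1.
by rewrite nsqM; have := nsq_ge0 w; have := nsq_ge0 (x / w - q); have := s3_bounds R; nra.
Qed.

Lemma centered0 T w : centered T w -> good T /\ rotinv T 0.
Proof. by move=> [gT hr]; split => //; have := hr _ (eis0 R); rewrite mulr0. Qed.

Lemma square_center T w p v : centered T w -> w != 0 -> nsq w <= (7 + 4 * s3) / 3 ->
  nsq v = 1 -> T (tile true p v) ->
  exists q u i, [/\ eis q, nsq u = 1, i \in linked & sub_tiling (pull T (w * q) u) (patch i)].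
Proof.
move=> hT w0 hw hv hA.
have [q hq hx] := near_center (cen true p v) w0 hw.
have [gT1 hr1] := centered0 (centered_pull hT hq (nsq_zetaX R 0)).
have [u [i [hu hi]]] := patch_at gT1 hr1.
rewrite pull_pull mulr0 addr0 mul1r => hsub.
exists q, u, i; split => //.
have [t ht e] := covering_patch hT.1 hu hi hsub hx hv hA (cen_stile _ _ hv).
have hd : nsq (u * zeta ^+ t.2) = 1 by rewrite nsqM hu nsq_zetaX mul1r.
have [et _] := tile_inj hv hd e.
have : all (fun i => has (fun t => t.1.1) (patch i) ==> (i \in linked)) (iota 0 (size patches)) by vm_compute.
move=> /allP/(_ i); rewrite mem_iota => /(_ hi)/implyP; apply.
by apply/hasP; exists t; rewrite // -et.
Qed.

Lemma distinct_ptsF (a a' : pt) : ev a = ev a' -> distinct_pts a a' = false.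
Proof.
move=> e; rewrite /distinct_pts (qposE R); apply/negbTE; rewrite -leNgt.
have : nsq (ev (psub a a')) = 0 by rewrite evB e subrr /nsq /= mul0r addr0.
by rewrite nsq_ev; lra.
Qed.

Lemma sub_place T D m P : sub_tiling T (place D m P) -> sub_tiling (pull T (ev D) (zeta ^+ m)) P.
Proof.
move=> h [[b p] k] ht; rewrite pull_tset ?nsq_zetaX //=.
have /h : (b, padd D (prot m p), addk k m) \in place D m P by apply/mapP; exists (b, p, k).
by rewrite /tset /= evD ev_rot zeta_addk addnC exprD.
Qed.

Lemma neighbour_links T w i : centered T w -> w != 0 -> nsq w <= (7 + 4 * s3) / 3 ->
  i \in linked -> sub_tiling T (patch i) ->
  exists l l', [/\ l \in links i, l' \in links i, w = ev l.1.1, w * zeta ^+ 2 = ev l'.1.1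
    & sub_tiling T (place l.1.1 l.2 (patch l.1.2)) /\ sub_tiling T (place l'.1.1 l'.2 (patch l'.1.2))].
Proof.
move=> hT w0 hw hi hsub; have [gT hr0] := centered0 hT.
have hr1 := hT.2 _ (eis1 R); rewrite mulr1 in hr1.
have hr2 := hT.2 _ (eis_zeta 1 (eis1 R)); rewrite mulr1 in hr2.
have [l [hl el sl]] := link_exists gT hr0 hr1 w0 hw hi hsub.
have w2 : w * zeta ^+ (2 * 1) != 0 by rewrite mulf_neq0 // unit_neq0 // nsq_zetaX.
have [|l' [hl' el' sl']] := link_exists gT hr0 hr2 w2 _ hi hsub; first by rewrite nsqM nsq_zetaX mulr1.
by exists l, l'.
Qed.

(** A center near the square has a patch with a square. If it is not the hexagon of type 3, one of
    two neighbours at 60 degrees is, and the origin is moved there. *)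
Lemma hex_center T w p v : centered T w -> w != 0 -> nsq w <= (7 + 4 * s3) / 3 ->
  nsq v = 1 -> T (tile true p v) ->
  exists q u, [/\ eis q, nsq u = 1 & sub_tiling (pull T (w * q) u) (patch 3)].
Proof.
move=> hT w0 hw hv hA.
have [q [u [i [hq hu hi hsub]]]] := square_center hT w0 hw hv hA.
have [ei|ni] := eqVneq i 3%N; first by exists q, u; rewrite -ei.
have hT' := centered_pull hT hq hu.
have u0 := unit_neq0 hu.
have w0' : w / u != 0 by rewrite mulf_neq0 // invr_eq0.
have hw' : nsq (w / u) <= (7 + 4 * s3) / 3.
  have e : nsq (u * (w / u)) = nsq (w / u) by rewrite nsqM hu mul1r.
  by rewrite -e mulrCA divff // mulr1.
have [l [l' [hl hl' el el' [sl sl']]]] := neighbour_links hT' w0' hw' hi hsub.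
have step (z : C) D m : eis z -> w / u * z = ev D -> sub_tiling (pull T (w * q) u) (place D m (patch 3)) ->
    exists q u, [/\ eis q, nsq u = 1 & sub_tiling (pull T (w * q) u) (patch 3)].
  move=> hz eD /sub_place; rewrite pull_pull -eD => h.
  exists (q + z), (u * zeta ^+ m); split; first exact: eisD.
    by rewrite nsqM hu nsq_zetaX mul1r.
  by move: h; have -> : w * q + u * (w / u * z) = w * (q + z)
    by rewrite mulrDr mulrA [u * (w / u)]mulrCA divff // mulr1.
have hi' : i \in [:: 1; 2; 5; 6; 7]%N by move: hi ni; rewrite !inE => /or4P[|||/or3P[]] /eqP->.
have /allP/(_ _ hl)/allP/(_ _ hl') := allP neighbours_checked _ hi'.
rewrite distinct_ptsF; last by rewrite ev_rot -el -el' mulrC.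
rewrite orFb => /orP[] /eqP e3.
  by apply: (step 1 l.1.1 l.2 (eis1 R)); rewrite ?mulr1 // -e3.
apply: (step (zeta ^+ 2) l'.1.1 l'.2); [|exact: el'|by rewrite -e3].
by have := eis_zeta 1 (eis1 R); rewrite mulr1.
Qed.

Lemma translate_tile b p v b' p' v' a : tile b p v = tile b' p' v' -> tile b (p + a) v = tile b' (p' + a) v'.
Proof.
move=> /(congr1 (fun A => (fun z => a + 1 * z) @` A)); have h : nsq (1 : C) = 1 by rewrite /nsq /=; lra.
by rewrite !frame_image // !mul1r ![a + _]addrC.
Qed.

Lemma rotate_tile b p v b' p' v' u : nsq u = 1 ->
  tile b p v = tile b' p' v' <-> tile b (u * p) (u * v) = tile b' (u * p') (u * v').
Proof.
move=> hu; have e b1 p1 v1 : tile b1 (u * p1) (u * v1) = (fun z => 0 + u * z) @` tile b1 p1 v1.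
  by rewrite frame_image // add0r.
by rewrite !e; split => [->//|/(frame_image_inj hu)].
Qed.

(** The tile is near some center [w * q]; a translation of [(1 - zeta ^ 4) * w * Z[omega]] replaces
    [q] by its residue 0, 1 or [zeta ^ 2], and [F] collects the patches around these three
    points. *)
Lemma all_tiles T w l l' b p v : centered T w -> w != 0 -> nsq w <= (7 + 4 * s3) / 3 ->
  w = ev l.1.1 -> w * zeta ^+ 2 = ev l'.1.1 -> (l.1.2 < size patches)%N -> (l'.1.2 < size patches)%N ->
  let F := patch 3 ++ place l.1.1 l.2 (patch l.1.2) ++ place l'.1.1 l'.2 (patch l'.1.2) in
  sub_tiling T F -> nsq v = 1 -> T (tile b p v) ->
  exists t q, [/\ t \in F, eis q & tile b p v = tile t.1.1 (ev t.1.2 + (1 - zeta ^+ 4) * w * q) (zeta ^+ t.2)].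
Proof.
move=> hT w0 hw el el' hi hi' F hF hv hA.
have [q hq hx] := near_center (cen b p v) w0 hw.
have [q' [r [hq' hr eq]]] := eis_residue hq.
pose a := (1 - zeta ^+ 4) * w * q'.
have hA' : T (tile b (p - a) v).
  by have := centered_translate hT (eisN hq') hv hA; rewrite mulrN.
have hx' : nsq (cen b (p - a) v - w * r) <= 25 / 16.
  by move: hx; rewrite eq /cen /a; congr (nsq _ <= _); ring.
have place_in D m P t : t \in P -> (t.1.1, padd D (prot m t.1.2), addk t.2 m) \in place D m P.
  by case: t => [[b1 p1] k1] ht; apply/mapP; exists (b1, p1, k1).
have finish D m i : (i < size patches)%N -> ev D = w * r -> {subset place D m (patch i) <= F} ->
    exists t q, [/\ t \in F, eis q & tile b p v = tile t.1.1 (ev t.1.2 + (1 - zeta ^+ 4) * w * q) (zeta ^+ t.2)].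
  move=> hi0 eD sF.
  have hsub : sub_tiling (pull T (w * r) (zeta ^+ m)) (patch i).
    by rewrite -eD; apply: sub_place => t /sF/hF.
  have [t ht e] := covering_patch hT.1 (nsq_zetaX R m) hi0 hsub hx' hv hA' (cen_stile _ _ hv).
  exists (t.1.1, padd D (prot m t.1.2), addk t.2 m), q'; split => //; first exact/sF/place_in.
  have := translate_tile a e; rewrite subrK => ->.
  by rewrite /= evD ev_rot eD zeta_addk addnC exprD.
move: hr finish; rewrite !inE => /or3P[] /eqP-> finish.
- apply: (finish (Z0, Z0, Z0, Z0) 0%N 3%N) => //; first by rewrite ev0 mulr0.
  move=> t /mapP[[[b1 p1] k1] ht ->]; rewrite mem_cat; apply/orP; left.
  have /allP/(_ _ ht)/= wk : all (fun t => (t.2 < 12)%N) (patch 3) by vm_compute.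
  change ((b1, padd (Z0, Z0, Z0, Z0) (prot 0 p1), addk k1 0) \in patch 3).
  have -> : padd (Z0, Z0, Z0, Z0) (prot 0 p1) = p1 by case: (p1) => [[[? ?] ?] ?].
  by rewrite /addk addn0 wk.
- by apply: (finish l.1.1 l.2 l.1.2) => //; [rewrite mulr1|move=> t h; rewrite !mem_cat h orbT].
by apply: (finish l'.1.1 l'.2 l'.1.2) => // t h; rewrite !mem_cat h !orbT.
Qed.

Lemma same_modP (d : pt) t (g : tcode) : same_mod d t g ->
  exists2 q, eis q & forall a, tile t.1.1 (ev t.1.2 + a) (zeta ^+ t.2) =
                               tile g.1.1 (ev g.1.2 + ev d * q + a) (zeta ^+ g.2).
Proof.
rewrite /same_mod; case: eqP => // eb; rewrite anyE => /hasP[r hr]; case: eqP => // ek hd.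
have [q hq eq] : exists2 q, eis q & ev t.1.2 = ev r.1.2 + ev d * q.
  have et : ev t.1.2 = ev r.1.2 + ev (psub t.1.2 r.1.2) by rewrite evB addrBC.
  move: hd et; rewrite inE => /orP[/eqP->|/mapP[j _ ->]] ->.
    by exists 0; [exact: eis0|rewrite ev0 mulr0].
  exists (zeta ^+ (2 * j) * 1); first exact/eis_zeta/eis1.
  by rewrite ev_rot mulr1 [ev d * _]mulrC.
exists q => // a; rewrite eq -ek -!addrA eb.
have := tset_orbit R hr; rewrite /tset; have [j ->] := orbit_codeP hr.
by have [-> _ _] := iter_next_code R g j => /translate_tile ->.
Qed.

(** [same_mod] only tests short vectors, but the equalities it gives persist under all further
    translations. The two inclusions of [generates] give the two directions. *)
Lemma generated T w l l' (X : generators) b p v :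
  centered T w -> w != 0 -> nsq w <= (7 + 4 * s3) / 3 ->
  w = ev l.1.1 -> w * zeta ^+ 2 = ev l'.1.1 -> (l.1.2 < size patches)%N -> (l'.1.2 < size patches)%N ->
  sub_tiling T (patch 3 ++ place l.1.1 l.2 (patch l.1.2) ++ place l'.1.1 l'.2 (patch l'.1.2)) ->
  generates l l' X -> nsq v = 1 ->
  let: (G, d, s) := X in
  T (tile b p v) <-> exists h q, [/\ h \in hex_orbit G, eis q
    & tile b (zeta ^+ s * p) (zeta ^+ s * v) = tile h.1.1 (ev h.1.2 + ev d * q) (zeta ^+ h.2)].
Proof.
case: X => [[G d] s] hT w0 hw el el' hi hi' hF; rewrite /generates.
set F := (X in sub_tiling _ X) in hF *.
rewrite anyE !everyE; case: ifP => // /hasP[j]; rewrite mem_iota => hj /eqP ej.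
case: ifP => // /allP hFG /allP hGF hv.
have ed : zeta ^+ s * ((1 - zeta ^+ 4) * w) = zeta ^+ (2 * j) * ev d.
  by rewrite -ev_rot -ej ev_rot evB ev_rot -el mulrBl mul1r.
split.
  move=> hA; have [t [q [ht hq e]]] := all_tiles hT w0 hw el el' hi hi' hF hv hA.
  have /hFG : rot_code s t \in map (rot_code s) F by apply: map_f.
  rewrite anyE => /hasP[h hh /same_modP[q' hq' e']].
  exists h, (q' + zeta ^+ (2 * j) * q); split => //; first exact/eisD/eis_zeta.
  have := e' (ev d * (zeta ^+ (2 * j) * q)); rewrite -addrA -mulrDr => <-.
  move/(rotate_tile _ _ _ _ _ _ (nsq_zetaX R s)): e => ->.
  case: (t) => [[b1 p1] k1] /=; rewrite ev_rot zeta_addk addnC exprD mulrDr.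
  by rewrite [zeta ^+ s * (_ * q)]mulrA ed [ev d * _]mulrCA mulrA.
move=> [h [q [hh hq e]]].
have := hGF _ hh; rewrite anyE => /hasP[_ /mapP[t ht ->] /same_modP[q' hq' e']].
have {}e' := e' (ev d * (q - q')); move: e'; rewrite -addrA -mulrDr [q' + _]addrC subrK -e => e'.
(* The inverse of the unit by which [d] differs from the turned translation vector. *)
have e12 : zeta ^+ (2 * j) * zeta ^+ (2 * (6 - j)) = 1.
  by rewrite -exprD -mulnDr subnKC ?zeta12 // ltnW.
have et : tile b p v = tile t.1.1 (ev t.1.2 + (1 - zeta ^+ 4) * w * (zeta ^+ (2 * (6 - j)) * (q - q'))) (zeta ^+ t.2).
  apply/(rotate_tile _ _ _ _ _ _ (nsq_zetaX R s)); rewrite -e'.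
  case: (t) => [[b1 p1] k1] /=; rewrite ev_rot zeta_addk addnC exprD [zeta ^+ s * (_ + _)]mulrDr.
  rewrite [zeta ^+ s * (_ * (_ * _))]mulrA ed mulrACA.
  by rewrite e12 mul1r.
rewrite et; apply: centered_translate => //; first exact/eis_zeta/eisD/eisN.
  exact: nsq_zetaX.
exact: hF.
Qed.

End Classification.

(** * The three named tilings in coded form *)

Section NamedTilings.
Variable R : realType.
Local Notation C := (plane R).
Local Notation Re := (@complex.Re R).
Local Notation Im := (@complex.Im R).
Local Notation s3 := (s3 R).
Local Notation zeta := (zeta R).
Local Notation ev := (@ev R).
Local Notation re r := (Complex r 0 : C).
Implicit Types (p q u v w : C) (b : bool) (g h : tcode) (G : seq tcode) (x y d : pt) (k j : nat).

Lemma sqrt3E : sqrt3 R = re s3.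
Proof.
have -> : sqrt3 R = sqrtC ((re s3) ^+ 2).
  by congr sqrtC; apply: plane_ext; rewrite expr2 ?reimE /=; have := s3M R; lra.
by apply: sqrCK; rewrite re_ge0 ltW // s3_gt0.
Qed.

Lemma eE k : e R k = zeta ^+ k.
Proof.
congr (_ ^+ k); rewrite sqrt3E imaginaryE.
have n2 : (2 : C) != 0 by apply/eqP => -[]; lra.
by apply: (mulIf n2); rewrite divfK //; apply: plane_ext; rewrite ?reimE /=; lra.
Qed.

Lemma hex_latticeP (d p : C) : hex_lattice d p <-> exists2 q, eis q & p = d * q.
Proof.
rewrite /hex_lattice /=; split => [[m [n ->]]|[_ [m [n ->]] ->]].
  by exists (m%:~R + n%:~R * e R 2) => //; exists m, n; rewrite eE.
by exists m, n; rewrite eE.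
Qed.

Definition tiling_of G d : set (set C) :=
  [set A | exists h q, [/\ h \in hex_orbit G, eis q
    & A = tile h.1.1 (ev h.1.2 + ev d * q) (zeta ^+ h.2)]].

Definition coded_tile p k g : set C :=
  tile g.1.1 (p + zeta ^+ (2 * k) * ev g.1.2) (zeta ^+ (2 * k) * zeta ^+ g.2).

Lemma tiling_ofP G d A : tiling_of G d A <->
  exists p k g, [/\ hex_lattice (ev d) p, g \in G & A = coded_tile p k g].
Proof.
split => [[h [q [/flattenP[_ /mapP[k _ ->] /mapP[g hg ->]] hq ->]]]|[p [k [g [/hex_latticeP[q hq ->] hg ->]]]]].
  exists (ev d * q), k, g; split => //; first by apply/hex_latticeP; exists q.
  by case: (g) => [[b x] j]; rewrite /coded_tile /= ev_rot zeta_addk addnC exprD addrC.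
exists (rot_code (2 * (k %% 6)) g), q; split => //.
  apply/flattenP; exists [seq rot_code (2 * (k %% 6)) g | g <- G]; last exact: map_f.
  by apply/mapP; exists (k %% 6)%N; rewrite // mem_iota ltn_mod.
case: (g) => [[b x] j]; rewrite /coded_tile [in RHS]/= ev_rot zeta_addk [(j + _)%N]addnC exprD addrC.
suff -> : zeta ^+ (2 * (k %% 6)) = zeta ^+ (2 * k) by [].
by rewrite -(zeta_mod R (2 * k)) -(muln_modr 2 k 6).
Qed.

(** All vertices in the definitions of the named tilings are rewritten in this form, so that
    matching them with codes is a computation in [pt]. *)
Definition pnt p k x := p + zeta ^+ (2 * k) * ev x.

Lemma pnt0 p k : p = pnt p k (Z0, Z0, Z0, Z0). Proof. by rewrite /pnt ev0 mulr0 addr0. Qed.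
Lemma pnt_e p k j : p + e R (2 * k + j) = pnt p k (pdir j).
Proof. by rewrite eE /pnt ev_dir exprD. Qed.
Lemma pnt_e0 p k : p + e R (2 * k) = pnt p k (pdir 0).
Proof. by rewrite -{1}[(2 * k)%N]addn0 pnt_e. Qed.
Lemma pntD p k x j : pnt p k x + e R (2 * k + j) = pnt p k (padd x (pdir j)).
Proof. by rewrite eE /pnt evD ev_dir exprD mulrDr addrA. Qed.
Lemma pntD0 p k x : pnt p k x + e R (2 * k) = pnt p k (padd x (pdir 0)).
Proof. by have := pntD p k x 0; rewrite addn0. Qed.
Lemma pntD2 p k x j : pnt p k x + 2 * e R (2 * k + j) = pnt p k (padd x (padd (pdir j) (pdir j))).
Proof. by rewrite eE /pnt !evD ev_dir exprD; ring. Qed.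
Lemma pntD20 p k x : pnt p k x + 2 * e R (2 * k) = pnt p k (padd x (padd (pdir 0) (pdir 0))).
Proof. by rewrite eE /pnt !evD ev_dir; ring. Qed.
Lemma s3_zeta : re s3 = zeta ^+ 1 + zeta ^+ 11.
Proof.
rewrite (exprD _ 6 5) (exprD _ 4 1) zeta6 zeta4 expr1; apply: plane_ext; rewrite ?reimE /=; have := s3M R; lra.
Qed.
Lemma pnt_sqrt3 p k x : pnt p k x + sqrt3 R * e R (2 * k) = pnt p k (padd x (padd (pdir 1) (pdir 11))).
Proof. by rewrite sqrt3E s3_zeta eE /pnt !evD !ev_dir; ring. Qed.
Lemma pnt_center p k : p + (1 + sqrt3 R) * e R (2 * k + 1) =
  pnt p k (padd (pdir 1) (padd (pdir 2) (pdir 12))).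
Proof. by rewrite sqrt3E s3_zeta eE /pnt !evD !ev_dir exprD; ring. Qed.

Definition pntE p k := (pnt_center p k, pnt_e0 p k, pnt_e p k).
Definition pntDE := (pntD0, pntD, pntD20, pntD2, pnt_sqrt3).

Definition vertex_code g j : pt := (iter j next_code g).1.2.

Lemma vertexE p k g j : pnt p k (vertex_code g j) =
  (side g.1.1 (pnt p k g.1.2) (zeta ^+ (2 * k) * zeta ^+ g.2) j).1.
Proof.
have [_ h _] := iter_next_code R g j; rewrite side_frame /=.
by rewrite /pnt /vertex_code; congr (_ + _ * _); have := congr1 fst h.
Qed.

Lemma nsq_zetaXM k j : nsq (zeta ^+ k * zeta ^+ j) = 1.
Proof. by rewrite nsqM !nsq_zetaX mulr1. Qed.

Lemma tri_code_tile p k g (x y z : pt) : ~~ g.1.1 ->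
  [:: x; y; z] = [seq vertex_code g j | j <- [:: 0; 1; 2]%N] ->
  tri (pnt p k x) (pnt p k y) (pnt p k z) = coded_tile p k g.
Proof.
move=> hg [-> -> ->]; rewrite !vertexE /coded_tile (negbTE hg) -tri_tile ?nsq_zetaXM //=.
have h : 1 + wt R false = zeta ^+ 2 by rewrite zeta2; apply: plane_ext; rewrite ?reimE /wt /=; lra.
by rewrite -h mulrDr mulr1 !addrA.
Qed.

Lemma wt_square (P U : C) : P + U + U * wt R true + U * wt R true * wt R true = P + U * wt R true.
Proof.
have h : 1 + wt R true + wt R true * wt R true = wt R true by rewrite wt_sq; ring.
move: (wt R true) h => a h.
have -> : P + U + U * a + U * a * a = P + U * (1 + a + a * a) by ring.
by rewrite h.
Qed.

Lemma quad_code_tile p k g (x y z t : pt) : g.1.1 ->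
  [:: x; y; z; t] = [seq vertex_code g j | j <- [:: 0; 1; 2; 3]%N] ->
  quad (pnt p k x) (pnt p k y) (pnt p k z) (pnt p k t) = coded_tile p k g.
Proof.
move=> hg [-> -> -> ->]; rewrite !vertexE /coded_tile hg -quad_tile ?nsq_zetaXM //=.
by rewrite wt_square /wt !zeta3.
Qed.

(** For the squares that the named tilings list clockwise. *)
Lemma quad_code_tile_rev p k g (x y z t : pt) : g.1.1 ->
  [:: x; y; z; t] = [seq vertex_code g j | j <- [:: 0; 3; 2; 1]%N] ->
  quad (pnt p k x) (pnt p k y) (pnt p k z) (pnt p k t) = coded_tile p k g.
Proof.
move=> hg [-> -> -> ->]; rewrite -(@quad_code_tile p k g (vertex_code g 0) _ _ _ hg erefl).
rewrite !vertexE hg /= wt_square; exact/esym/quadC.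
Qed.

Lemma tilingQE : @tilingQ R = tiling_of gensQ.1.1 gensQ.1.2.
Proof.
have tiles p k :
  [/\ tri p (p + e R (2 * k + 1)) (p + e R (2 * k + 3)) = coded_tile p k (nth no_tile gensQ.1.1 0),
    quad (p + e R (2 * k + 1)) (p + e R (2 * k + 3)) (p + e R (2 * k + 3) + e R (2 * k + 2))
      (p + e R (2 * k + 1) + e R (2 * k + 2)) = coded_tile p k (nth no_tile gensQ.1.1 1)
  & tri (p + e R (2 * k + 1)) (p + e R (2 * k + 1) + e R (2 * k))
      (p + e R (2 * k + 1) + e R (2 * k + 2)) = coded_tile p k (nth no_tile gensQ.1.1 2)].
  split; rewrite !(pntE p k) ?pntDE.
  - by rewrite {1}(pnt0 p k); apply: tri_code_tile.
  - exact: quad_code_tile_rev.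
  - exact: tri_code_tile.
have ed : 1 + sqrt3 R = ev gensQ.1.2.
  rewrite sqrt3E s3_zeta -[1]/(zeta ^+ 0) -!ev_dir -!evD; by congr ev.
apply/seteqP; split => A.
  move=> [p [k [hp]]] /=; have [e1 e2 e3] := tiles p k; rewrite e1 e2 e3 => hA.
  apply/tiling_ofP; rewrite -ed; case: hA => ->.
  - by exists p, k, (nth no_tile gensQ.1.1 0); split => //; rewrite mem_nth.
  - by exists p, k, (nth no_tile gensQ.1.1 1); split => //; rewrite mem_nth.
  - by exists p, k, (nth no_tile gensQ.1.1 2); split => //; rewrite mem_nth.
move=> /tiling_ofP[p [k [g [hp /(nthP no_tile)[i hi <-] ->]]]]; exists p, k; rewrite ed; split => //.
have [e1 e2 e3] := tiles p k; rewrite /= e1 e2 e3.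
by case: i hi => [|[|[|//]]] _; [apply: Or31|apply: Or32|apply: Or33].
Qed.

Lemma tilingRE : @tilingR R = tiling_of gensR.1.1 gensR.1.2.
Proof.
have tiles p k : let a := p + e R (2 * k + 1) in let b := p + e R (2 * k + 3) in
    let u := e R (2 * k) in let v := e R (2 * k + 2) in
  [/\ tri p a b = coded_tile p k (nth no_tile gensR.1.1 0),
      quad a b (b + v) (a + v) = coded_tile p k (nth no_tile gensR.1.1 1),
      quad (a + v) (b + v) (b + 2 * v) (a + 2 * v) = coded_tile p k (nth no_tile gensR.1.1 2)
    & [/\ tri a (a + u) (a + v) = coded_tile p k (nth no_tile gensR.1.1 3),
          tri (a + u) (a + 2 * u) (a + u + v) = coded_tile p k (nth no_tile gensR.1.1 4),
          tri (a + v) (a + u + v) (a + 2 * v) = coded_tile p k (nth no_tile gensR.1.1 5)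
        & tri (a + u) (a + u + v) (a + v) = coded_tile p k (nth no_tile gensR.1.1 6)]].
  split => [||| ]; last split; rewrite !(pntE p k) ?pntDE.
  - by rewrite {1}(pnt0 p k); apply: tri_code_tile.
  - exact: quad_code_tile_rev.
  - exact: quad_code_tile_rev.
  - exact: tri_code_tile.
  - exact: tri_code_tile.
  - exact: tri_code_tile.
  - exact: tri_code_tile.
have ed : 2 + sqrt3 R = ev gensR.1.2.
  rewrite sqrt3E s3_zeta (_ : 2 = zeta ^+ 0 + zeta ^+ 0) // -!ev_dir -!evD; by congr ev.
apply/seteqP; split => A.
  move=> [p [k [hp]]] /=; have [e0 e1 e2 [e3 e4 e5 e6]] := tiles p k.
  rewrite e0 e1 e2 e3 e4 e5 e6 => hA; apply/tiling_ofP; rewrite -ed.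
  suff [i hi ->] : exists2 i, (i < size gensR.1.1)%N & A = coded_tile p k (nth no_tile gensR.1.1 i).
    by exists p, k, (nth no_tile gensR.1.1 i); split => //; rewrite mem_nth.
  case: hA => [->|[->|->]|[->|->|->|->]];
    by [exists 0%N|exists 1%N|exists 2%N|exists 3%N|exists 4%N|exists 5%N|exists 6%N].
move=> /tiling_ofP[p [k [g [hp /(nthP no_tile)[i hi <-] ->]]]]; exists p, k; rewrite ed; split => //.
have [e0 e1 e2 [e3 e4 e5 e6]] := tiles p k; rewrite /= e0 e1 e2 e3 e4 e5 e6.
case: i hi => [|[|[|[|[|[|[|//]]]]]]] _.
- exact: Or31.
- by apply: Or32; left.
- by apply: Or32; right.
- by apply/Or33/Or41.
- by apply/Or33/Or42.
- by apply/Or33/Or43.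
- by apply/Or33/Or44.
Qed.

Lemma tilingSE : @tilingS R = tiling_of gensS.1.1 gensS.1.2.
Proof.
have tiles p k : let u := e R (2 * k) in let v := e R (2 * k + 2) in
    let a := p + u in let b := p + v in
    let r' := a + e R (2 * k + 11) in let r := a + e R (2 * k + 1) in
    let s := b + e R (2 * k + 1) in let t := p + (1 + sqrt3 R) * e R (2 * k + 1) in
  [/\ tri p a b = coded_tile p k (nth no_tile gensS.1.1 0),
      tri a r' r = coded_tile p k (nth no_tile gensS.1.1 1),
      tri (a + sqrt3 R * u) r' r = coded_tile p k (nth no_tile gensS.1.1 2)
    & [/\ tri r s t = coded_tile p k (nth no_tile gensS.1.1 3),
          quad a b s r = coded_tile p k (nth no_tile gensS.1.1 4),
          quad s t (t + e R (2 * k + 3)) (s + e R (2 * k + 3)) = coded_tile p k (nth no_tile gensS.1.1 5)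
        & quad t r (r + e R (2 * k + 11)) (t + e R (2 * k + 11)) = coded_tile p k (nth no_tile gensS.1.1 6)]].
  split => [||| ]; last split; rewrite !(pntE p k) ?pntDE.
  - by rewrite {1}(pnt0 p k); apply: tri_code_tile.
  - exact: tri_code_tile.
  (* This triangle and the next are listed clockwise. *)
  - by rewrite triC; apply: tri_code_tile.
  - by rewrite triC; apply: tri_code_tile.
  - exact: quad_code_tile_rev.
  - exact: quad_code_tile.
  - exact: quad_code_tile.
have ed : 2 + sqrt3 R = ev gensS.1.2.
  rewrite sqrt3E s3_zeta (_ : 2 = zeta ^+ 0 + zeta ^+ 0) // -!ev_dir -!evD; by congr ev.
apply/seteqP; split => A.
  move=> [p [k [hp]]] /=; have [e0 e1 e2 [e3 e4 e5 e6]] := tiles p k.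
  rewrite e0 e1 e2 e3 e4 e5 e6 => hA; apply/tiling_ofP; rewrite -ed.
  suff [i hi ->] : exists2 i, (i < size gensS.1.1)%N & A = coded_tile p k (nth no_tile gensS.1.1 i).
    by exists p, k, (nth no_tile gensS.1.1 i); split => //; rewrite mem_nth.
  case: hA => [->|[->|->]|->|[->|->|->]];
    by [exists 0%N|exists 1%N|exists 2%N|exists 3%N|exists 4%N|exists 5%N|exists 6%N].
move=> /tiling_ofP[p [k [g [hp /(nthP no_tile)[i hi <-] ->]]]]; exists p, k; rewrite ed; split => //.
have [e0 e1 e2 [e3 e4 e5 e6]] := tiles p k; rewrite /= e0 e1 e2 e3 e4 e5 e6.
case: i hi => [|[|[|[|[|[|[|//]]]]]]] _.
- exact: Or41.
- by apply: Or42; left.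
- by apply: Or42; right.
- exact: Or43.
- by apply/Or44/Or31.
- by apply/Or44/Or32.
- by apply/Or44/Or33.
Qed.

End NamedTilings.

(** * From symmetries of the tiling to a lattice of centers *)

Section Symmetries.
Variable R : realType.
Local Notation C := (plane R).
Local Notation Re := (@complex.Re R).
Local Notation Im := (@complex.Im R).
Local Notation s3 := (s3 R).
Local Notation zeta := (zeta R).
Local Notation ev := (@ev R).
Local Notation re r := (Complex r 0 : C).
Implicit Types (x y z p q u v c w : C) (b : bool) (T : set (set C)) (d : pt).

Lemma nsq1 : nsq (1 : C) = 1. Proof. exact: (nsq_zetaX R 0). Qed.

Lemma nsqV u : nsq u = 1 -> nsq u^-1 = 1.
Proof. by move=> hu; rewrite -[LHS]mul1r -hu -nsqM divff ?nsq1 // unit_neq0. Qed.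

Lemma move_tile T (f : C -> C) c u b p v : f = (fun z => c + u * z) -> nsq u = 1 -> move f T = T ->
  T (tile b p v) -> T (tile b (c + u * p) (u * v)).
Proof. by move=> ef hu hT hA; rewrite -hT -frame_image // -ef; exists (tile b p v). Qed.

Lemma rotationE c u : rotation c u = (fun z => (c - u * c) + u * z).
Proof. by apply/funext => z; rewrite /rotation; ring. Qed.

Lemma cube_roots u : u ^+ 3 = 1 -> u <> 1 -> u = zeta ^+ 4 \/ u = zeta ^+ 8.
Proof.
move=> u3 u1; have e8 : zeta ^+ 8 = - 1 - zeta ^+ 4.
  by rewrite (exprD _ 6 2) zeta6 zeta4E; ring.
have e : zeta ^+ 4 * zeta ^+ 8 = 1 by rewrite -exprD zeta12.
have : (u - 1) * ((u - zeta ^+ 4) * (u - zeta ^+ 8)) = 0.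
  have -> : (u - zeta ^+ 4) * (u - zeta ^+ 8) =
    u ^+ 2 - u * (zeta ^+ 4 + zeta ^+ 8) + zeta ^+ 4 * zeta ^+ 8 by ring.
  rewrite e; move: e8; move: (zeta ^+ 8) (zeta ^+ 4) => z8 z4 ->.
  by rewrite -(subrr (1 : C)) -[X in _ = X - 1]u3; ring.
move=> /eqP; rewrite !mulf_eq0 !subr_eq0 => /or3P[/eqP//|/eqP ?|/eqP ?]; by [left|right].
Qed.

(** The rotation may turn by 240 degrees; its square then turns by 120. *)
Lemma order3_rotinv T c u : nsq u = 1 -> has_order (rotation c u) 3 ->
  move (rotation c u) T = T -> rotinv T c.
Proof.
move=> hu [_ h3 h1] hT.
have step b p v : T (tile b p v) -> T (tile b (c + u * (p - c)) (u * v)).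
  by move/(move_tile (rotationE c u) hu hT); rewrite mulrBr addrAC addrA.
have u3 : u ^+ 3 = 1.
  by have := h3 (c + 1); rewrite /= /rotation ![c + _ - c]addrAC subrr !add0r mulr1 => /addrI.
have u1 : u <> 1.
  move=> e; apply: (h1 1%N) => // z.
  by rewrite /= /rotation e mul1r addrC subrK.
case: (cube_roots u3 u1) => e b p v _ hA; first by rewrite -e; apply: step.
have := step _ _ _ (step _ _ _ hA).
have e4 : u * u = zeta ^+ 4 by rewrite e -exprD (exprD _ 12 4) zeta12 mul1r.
by rewrite addrAC subrr add0r !mulrA e4.
Qed.

Definition transinv T v := forall b p u, nsq u = 1 -> T (tile b p u) -> T (tile b (p + v) u).

Lemma transinv_move T v : move (translation v) T = T -> transinv T v.
Proof.
move=> hT b p u _ hA; have et : translation v = (fun z => v + 1 * z).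
  by apply/funext => z; rewrite mul1r addrC.
by have := move_tile et nsq1 hT hA; rewrite !mul1r addrC.
Qed.

Lemma transinvD T v w : transinv T v -> transinv T w -> transinv T (v + w).
Proof. by move=> hv hw b p u hu /(hv _ _ _ hu) /(hw _ _ _ hu); rewrite addrA. Qed.

Lemma transinv_int T v (m : int) : transinv T v -> transinv T (- v) -> transinv T (v * m%:~R).
Proof.
have nat w (n : nat) : transinv T w -> transinv T (w *+ n).
  move=> hw; elim: n => [|n IH]; first by move=> b p u _; rewrite addr0.
  by rewrite mulrS; apply: transinvD.
move=> h h'; case: m => n; first by rewrite -pmulrn mulr_natr; apply: nat.
by rewrite NegzE mulrNz mulrN -pmulrn mulr_natr -mulNrn; apply: nat.
Qed.

(** Conjugation of the translation by the rotation, whose inverse is applied as its square. *)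
Lemma transinv_rot T c v : rotinv T c -> transinv T v -> transinv T (zeta ^+ 4 * v).
Proof.
move=> hr hv b p u hu hA.
have n4 x : nsq x = 1 -> nsq (zeta ^+ 4 * x) = 1 by rewrite nsqM nsq_zetaX mul1r.
have := hr _ _ _ _ (hv _ _ _ _ (hr _ _ _ _ (hr _ _ _ hu hA))).
move=> /(_ (n4 _ (n4 _ hu)) (n4 _ (n4 _ hu)) (n4 _ hu)).
have z12 : zeta ^+ 4 * (zeta ^+ 4 * zeta ^+ 4) = 1 by rewrite -!exprD zeta12.
have -> : zeta ^+ 4 * (zeta ^+ 4 * (zeta ^+ 4 * u)) = zeta ^+ 4 * (zeta ^+ 4 * zeta ^+ 4) * u by ring.
have -> : c + zeta ^+ 4 * (c + zeta ^+ 4 * (c + zeta ^+ 4 * (p - c) - c) + v - c) =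
   c + zeta ^+ 4 * (zeta ^+ 4 * zeta ^+ 4) * (p - c) + zeta ^+ 4 * v by ring.
by rewrite z12 !mul1r addrBC.
Qed.

Lemma transinv_eis T c v q : rotinv T c -> transinv T v -> transinv T (- v) -> eis q ->
  transinv T (v * q).
Proof.
move=> hr h h' [m [n ->]].
have z2 : zeta ^+ 2 = zeta ^+ 4 + 1 by rewrite zeta4E subrK.
have h4 := transinv_rot hr h; have := transinv_rot hr h'; rewrite mulrN => h4'.
have -> : v * (m%:~R + n%:~R * zeta ^+ 2) = v * m%:~R + (v * n%:~R + zeta ^+ 4 * v * n%:~R).
  by rewrite z2; ring.
by apply: transinvD; [|apply: transinvD]; apply: transinv_int.
Qed.

Lemma nsq_1_zeta4 : nsq (1 - zeta ^+ 4) = 3.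
Proof. by rewrite zeta4 /nsq ?reimE /=; have := s3M R; lra. Qed.

(* The product of the rotation about c with the translation by v q is the
   rotation about the point obtained from c by adding v q / (1 - zeta ^+ 4). *)
Lemma centered_transinv T c v : good T -> rotinv T c -> transinv T v -> transinv T (- v) ->
  centered (pull T c 1) (v / (1 - zeta ^+ 4)).
Proof.
move=> gT hr h h'; split; first exact/good_pull/nsq1.
move=> q hq; apply: rotinv_pull; first exact: nsq1.
move=> b p u hu /(hr _ _ _ hu) hA.
have := transinv_eis hr h h' hq _ hA; rewrite nsqM nsq_zetaX mul1r => /(_ hu).
congr (T (tile _ _ _)).
have n0 : 1 - zeta ^+ 4 != 0.
  by apply/eqP => e; have := nsq_1_zeta4; rewrite e /nsq /=; lra.
rewrite mul1r -{1}[v](divfK n0); move: (v / _) => w; ring.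
Qed.

Lemma norm_length v (r : R) : `|v| = re r -> nsq v = r ^+ 2 /\ 0 <= r.
Proof.
by rewrite normE => -[<-]; rewrite sqr_sqrtr ?nsq_ge0 // sqrtr_ge0.
Qed.

Lemma isometry_frame c u : nsq u = 1 -> is_isometry (fun z => c + u * z : C).
Proof. by move=> hu z w; rewrite !normE nsq_frame hu mul1r. Qed.

(** The isometry leaves the frame and turns by [zeta ^ s]: it maps [z] to [zeta ^ s (z - c) / u]. *)
Lemma move_generated T c u G d s : good T -> nsq u = 1 ->
  (forall b p v, nsq v = 1 -> pull T c u (tile b p v) <-> exists h q, [/\ h \in hex_orbit G, eis q
    & tile b (zeta ^+ s * p) (zeta ^+ s * v) = tile h.1.1 (ev h.1.2 + ev d * q) (zeta ^+ h.2)]) ->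
  exists2 f : C -> C, is_isometry f & move f T = tiling_of G d.
Proof.
move=> [gT _ _ _] hu hG; have u0 := unit_neq0 hu.
have hz := nsq_zetaX R s; have z0 := unit_neq0 hz.
pose m := zeta ^+ s / u; pose a := - (m * c).
have hm : nsq m = 1 by rewrite nsqM hz mul1r nsqV.
have fE p : a + m * p = zeta ^+ s * ((p - c) / u) by rewrite /a /m; ring.
exists (fun z => a + m * z); first exact: isometry_frame.
apply/seteqP; split => [_ [A hA <-]|_ [h [q [hh hq ->]]]].
  have [b [p [v [hv eA]]]] := gT _ hA.
  have hv' : nsq (v / u) = 1 by rewrite nsqM hv mul1r nsqV.
  have /(hG _ _ _ hv')[h [q [hh hq e]]] : pull T c u (tile b ((p - c) / u) (v / u)).
    by rewrite pull_tile // frameK // mulrCA divff // mulr1 -eA.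
  exists h, q; split => //; rewrite eA frame_image // fE -e /m; congr (tile _ _ _); ring.
have hv' : nsq (zeta ^+ h.2 / zeta ^+ s) = 1 by rewrite nsqM nsq_zetaX mul1r nsqV.
have := hG h.1.1 ((ev h.1.2 + ev d * q) / zeta ^+ s) _ hv'.
rewrite ![zeta ^+ s * (_ / _)]mulrCA divff // !mulr1 => -[_ hT].
have := hT (ex_intro _ h (ex_intro _ q (And3 hh hq erefl))); rewrite pull_tile // => hA.
exists (tile h.1.1 (c + u * ((ev h.1.2 + ev d * q) / zeta ^+ s)) (u * (zeta ^+ h.2 / zeta ^+ s))) => //.
rewrite frame_image // fE addrAC subrr add0r; congr (tile _ _ _).
  by rewrite [u * _]mulrC mulfK // mulrCA divff // mulr1.
by rewrite /m mulrA divfK // mulrCA divff // mulr1.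
Qed.

End Symmetries.

Theorem proposition5p7 (R : realType)
    (Lam : set (plane R -> plane R)) (T : set (set (plane R))) (tau : R) :
  isometry_group Lam -> discrete_group Lam -> cocompact Lam ->
  has_rotation_of_order 3 Lam ->
  tiling T -> edge_to_edge T ->
  (exists2 A, T A & is_unit_triangle A) ->
  (exists2 A, T A & is_unit_square A) ->
  (forall f, Lam f -> move f T = T) ->
  is_minimum tau (translation_lengths Lam) ->
  tau <= 2 + Num.sqrt 3 ->
  exists2 f : plane R -> plane R, is_isometry f &
    [\/ move f T = @tilingQ R, move f T = @tilingR R | move f T = @tilingS R].
Proof.
move=> [_ _ _ hinv] _ _ [c [u [/unitP hu hLu ou]]] hT he _ [A TA [l [p [v [/unitP hv ->]]] eA]] hmove.
move=> [[t [hLt ot /norm_length[nt tau0]]] _] htau.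
have gT := tiling_good hT he.
have hr := order3_rotinv hu ou (hmove _ hLu).
have ht := transinv_move (hmove _ hLt).
have ht' : transinv T (- t).
  have [g [Lg _ gK]] := hinv _ hLt; apply: transinv_move.
  have eg : translation (- t) = g by apply/funext => z; rewrite -[z in LHS]gK /translation addrK.
  by rewrite eg; apply: hmove.
have hc := centered_transinv gT hr ht ht'; set w := t / _ in hc.
have n3 : nsq w = nsq t / 3.
  have n0 : 1 - zeta R ^+ 4 != 0.
    by apply/eqP => e; have := nsq_1_zeta4 R; rewrite e /nsq /=; lra.
  by rewrite -[t](divfK n0) -/w (nsqM w) nsq_1_zeta4; field.
have w0 : w != 0.
  apply/eqP => w0; apply: (ot 1%N) => // z; rewrite /= /translation.
  have -> : t = 0; last by rewrite addr0.
  by apply: nsq_eq0; move: n3; rewrite w0 /nsq /=; lra.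
(* [(2 + sqrt 3) ^ 2 = 7 + 4 sqrt 3], and dividing by [1 - omega] divides squared lengths by 3. *)
have hw : nsq w <= (7 + 4 * s3 R) / 3.
  rewrite n3 nt expr2; move: htau; rewrite -/(s3 R) => htau.
  by have := s3M R; have := s3_gt0 R; nra.
have hA : pull T c 1 (tile true (p - c) v).
  by rewrite pull_tile ?nsq1 // !mul1r addrBC -quad_tile // zeta3 [v * _]mulrC; move: TA; rewrite eA imaginaryE.
have [q [u' [hq hu' hsub]]] := hex_center hc w0 hw hv hA.
have hc' := centered_pull hc hq hu'.
set w' := w / u' in hc'; set T' := pull _ _ _ in hsub hc'.
have w0' : w' != 0 by rewrite mulf_neq0 // invr_eq0 unit_neq0.
have hw' : nsq w' <= (7 + 4 * s3 R) / 3 by rewrite nsqM nsqV // mulr1.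
have [l1 [l2 [hl1 hl2 e1 e2 [hs1 hs2]]]] := neighbour_links hc' w0' hw' (isT : 3%N \in linked) hsub.
have /allP hsize : all (fun l : link => (l.1.2 < size patches)%N) (links 3) by vm_compute.
have := tilings_checked; rewrite /check_tilings everyE => /allP/(_ _ hl1).
rewrite everyE => /allP/(_ _ hl2).
(* The second neighbour is the first turned by 60 degrees, so the vacuous alternative of the check
   does not apply. *)
rewrite (distinct_ptsF (R := R)); last by rewrite ev_rot -e1 -e2 mulrC.
rewrite anyE => /hasP[X hX hgen].
have hF : sub_tiling T' (patch 3 ++ place l1.1.1 l1.2 (patch l1.1.2) ++ place l2.1.1 l2.2 (patch l2.1.2)).
  by do 2![apply: sub_tiling_cat => //].
have main : exists2 f : plane R -> plane R, is_isometry f & move f T = tiling_of X.1.1 X.1.2.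
  case: X hX hgen => [[G d] s] _ hgen.
  apply: (@move_generated R T (c + 1 * (w * q)) (1 * u') G d s) => //; first by rewrite mul1r.
  move=> b p' v' hv'; rewrite -pull_pull.
  exact: (generated b p' hc' w0' hw' e1 e2 (hsize _ hl1) (hsize _ hl2) hF hgen hv').
case: main => f hf ef; exists f => //; rewrite ef.
move: hX; rewrite !inE => /or3P[] /eqP->.
- by apply: Or31; rewrite tilingQE.
- by apply: Or32; rewrite tilingRE.
- by apply: Or33; rewrite tilingSE.
Qed.
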